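(* Assume the setting and assumptions (i)–(iii) of the context. Let $(\mu_t)_{t\ge0}$ and $(\nu_t)_{t\ge0}$ be two weak solutions of $\partial_t\mu_t+\nabla\cdot(v_{\mu_t}\mu_t)=0$. Suppose that for every $T\in(0,\infty)$ there is $M_T<\infty$ such that, writing $m_2(\rho):=\int\|x\|^2\rho(dx)$, $$\int_0^T\{1+m_2(\mu_t)+m_2(\nu_t)\}\,dt\le M_T.$$ Then there exists a finite constant $C>0$, depending only on the constants in the bounds of the assumptions, such that for any $T>0$, $$\sup_{0\le t\le T}W_2(\mu_t,\nu_t)\le\exp\{CM_T\}\,W_2(\mu_0,\nu_0).$$ (Here $\mu_0,\nu_0$ are the initial laws of the two solutions and need not be the law in assumption (iii).)
   Context: **Setting.** $\pi(dx)\propto e^{-V(x)}dx$ is a probability measure on $\mathbb R^d$; $W_s$ is the Wasserstein-$s$ distance; $\mathsf{KL}$ is relative entropy. With the kernel $\widetilde k$ below, $v_\rho(x):=\int\{-\widetilde k(x,y)\nabla V(y)+\nabla_2\widetilde k(x,y)\}\rho(dy)$ ($\nabla_2$: gradient in the second argument). Weak solutions of the mean-field equation $\partial_t\mu_t+\nabla\cdot(v_{\mu_t}\mu_t)=0$ are tested against $C_c^1(\mathbb R^d)$ functions. $\mathsf{KSD}(\rho\|\pi):=\big\|\int\{-\widetilde k(\cdot,x)\nabla V(x)+\nabla_2\widetilde k(\cdot,x)\}\rho(dx)\big\|_{\mathcal H^d}$, $\mathcal H^d$ the $\mathbb R^d$-valued RKHS of $\widetilde k$. For an SVGD particle system, $\mu_t^N$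 is the empirical measure of the $N$ particles. **Exponent.** $\mathfrak r(d,\nu):=\frac{d}{3(4d+1)}\cdot\frac1{\frac{3d}2+\frac{11}6+\left(\frac83+\frac1d\right)\nu}\in(0,1)$. **Assumptions.** (i) $\widetilde k(u,v)=1+\langle u,v\rangle+\Psi(u-v)$ with $\Psi(z):=\frac{2^{1-(d/2+\nu)}}{\Gamma(d/2+\nu)}\|\Sigma z\|_2^\nu K_{-\nu}(\|\Sigma z\|_2)$, $\Sigma$ strictly positive definite, $\nu>3/2$, $K_{-\nu}$ the modified Bessel function of the second kind. (ii) $V$ is positive, $C^3$, and for some $L<\infty$: $\|\nabla V(x)\|\le L(1+\|x\|)$, $\|\nabla^2V(x)\|_{\rm op}\le L$. For some $a>0$, $\beta_0,\beta_1\ge0$: $-\langle x,\nabla V(x)\rangle+d\le-a\|x\|^2+\beta_1\|x\|+\beta_0$ for all $x$. Langevin contractivity: for $dZ_t=-\frac12\nabla V(Z_t)dt+dB_t$, $Z_0=x$ (solution $Z^x_t$), there are $\rho_s:[0,\infty)\to[0,\infty)$, $s=1,2$, with $W_s(\mathrm{Law}(Z_t^x),\mathrm{Law}(Z_t^y))\le\rho_s(t)\|x-y\|$ for all $x,y,t\ge0$, $\int_0^\infty\rho_1(t)dt<\infty$; this is assumed so that the following comparison applies: there is $C_{\rm KGM}<\infty$ with $W_2(\rho,\pi)\le C_{\rm KGM}\big(1\vee\mathsf{KSD}(\rho\|\pi)^{1-\mathfrak r}\big)\mathsf{KSD}(\rho\|\pi)^{\mathfrak r}$ for every probability measure $\rho$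 with finite second moment. (iii) $P_0^N$, the joint law of the initial particle configuration, satisfies $\sup_N\frac1N\mathsf{KL}(P_0^N\|\pi^{\otimes N})<\infty$; there are positive constants $\alpha_{\rm init},\beta_{\rm init},c_{\rm init},C_{\rm init}$ and a deterministic law $\mu_*\in\mathcal P_2(\mathbb R^d)$ (the mean-field initial law) with a density, $\int\|x\|^2d\mu_*<\infty$, $\mathsf{KL}(\mu_*\|\pi)<\infty$, such that $\mathbb P\big(W_2(\mu_0^N,\mu_* )>c_{\rm init}N^{-\alpha_{\rm init}}\big)\le C_{\rm init}(\log N)^{-\beta_{\rm init}}$ for $N\ge1$ (the right side being $+\infty$ at $N=1$). *)

(* Defs.v *)
From HB Require Import structures.
From mathcomp Require Import all_boot all_order all_algebra.
From mathcomp Require Import all_classical all_reals all_analysis.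

Set Implicit Arguments.
Unset Strict Implicit.
Unset Printing Implicit Defensive.

Import Order.TTheory GRing.Theory Num.Theory.
Import numFieldNormedType.Exports.

Local Open Scope classical_set_scope.
Local Open Scope ring_scope.

(* R^d is ['rV[R]_d]. The library norm on ['rV[R]_d] is the sup norm; it is
   used only through the topology it induces. *)

Section euclidean.
Context {R : realType} {d : nat}.
Implicit Types u v : 'rV[R]_d.

Definition dotp u v : R := \sum_(i < d) u 0 i * v 0 i.

Definition enorm u : R := Num.sqrt (dotp u u).

Definition opnorm (A : 'M[R]_d) : R :=
  sup [set enorm (A *m u^T)^T | u in [set u | enorm u <= 1]].

Definition spd (A : 'M[R]_d) : Prop :=
  A^T = A /\ forall u, u != 0 -> 0 < dotp u (A *m u^T)^T.

End euclidean.

(* Borel sigma-algebra of R^d, presented as the product sigma-algebra (as the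
   library does for tuples). *)
Definition rV_display : measure_display.
Proof. by constructor. Qed.

Section measurable_rV.
Variables (R : realType) (n : nat).

Let coors : 'I_n -> 'rV[R]_n -> R := fun i x => x 0 i.

Let rV_set0 : g_sigma_preimage coors set0.
Proof. exact: sigma_algebra0. Qed.

Let rV_setC A : g_sigma_preimage coors A -> g_sigma_preimage coors (~` A).
Proof. exact: sigma_algebraC. Qed.

Let rV_bigcup (F : _^nat) : (forall i, g_sigma_preimage coors (F i)) ->
  g_sigma_preimage coors (\bigcup_i (F i)).
Proof. exact: sigma_algebra_bigcup. Qed.

HB.instance Definition _ := @isMeasurable.Build rV_display
  'rV[R]_n (g_sigma_preimage coors) rV_set0 rV_setC rV_bigcup.

End measurable_rV.

Lemma measurable_fun_rVP (R : realType) d (T : measurableType d) n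
    (f : T -> 'rV[R]_n) :
  (forall i, measurable_fun [set: T] (fun x => f x 0 i)) ->
  measurable_fun [set: T] f.
Proof.
move=> mf.
apply: (@measurability _ _ _ _ _ _
  (\big[setU/set0]_(i < n)
     preimage_set_system setT (fun v : 'rV[R]_n => v 0 i) measurable)) => //.
move=> _ [A + <-].
elim/big_ind : _ => [//|F G HF HG [/HF //|/HG //]|i _ [B mB <-]].
by rewrite setTI -comp_preimage; exact: mf.
Qed.

Definition mpushforward d1 d2 (T1 : measurableType d1) (T2 : measurableType d2)
    (R : realType) (m : {measure set T1 -> \bar R}) (f : T1 -> T2)
    (mf : measurable_fun [set: T1] f) : {measure set T2 -> \bar R} :=
  measure_function_pushforward__canonical__measure_function_Measure m mf.

Section tensor_power.
Context {d} {T : measurableType d} {R : realType}.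

Let consp n (p : n.-tuple T * T) : n.+1.-tuple T := [tuple of p.2 :: p.1].

Let measurable_consp n : measurable_fun [set: n.-tuple T * T] (@consp n).
Proof. by apply: measurable_cons; [exact: measurable_snd|exact: measurable_fst]. Qed.

Fixpoint tensor_power (m : {sigma_finite_measure set T -> \bar R}) (n : nat) :
    {measure set (n.-tuple T) -> \bar R} :=
  match n with
  | 0 => \d_([tuple] : 0.-tuple T)
  | k.+1 => mpushforward (tensor_power m k \x m)%E (@measurable_consp k)
  end.

Lemma tensor_power_box (m : {sigma_finite_measure set T -> \bar R}) n
    (A : 'I_n -> set T) : (forall i, measurable (A i)) ->
  tensor_power m n [set t | forall i, A i (tnth t i)] =
  (\prod_(i < n) m (A i))%E.
Proof.
elim: n A => [|n IH] A mA /=.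
  by rewrite big_ord0 diracE mem_set//= => -[].
rewrite /pushforward.
rewrite (_ : _ @^-1` _ =
  [set t | forall i, A (lift ord0 i) (tnth t i)] `*` A ord0); last first.
  apply/seteqP; split => [[t x]/= At|[t x]/= [At Ax] i].
    split => [i|]; last by have := At ord0; rewrite tnth0.
    by have := At (lift ord0 i); rewrite tnthS.
  by case: (unliftP ord0 i) => [j ->|->]; rewrite ?tnthS ?tnth0.
rewrite product_measure1E//; first by rewrite big_ord_recl muleC (IH (fun i => A (lift ord0 i))).
rewrite (_ : [set t | _] = \bigcap_(i in [set: 'I_n])
  ((@tnth n T)^~ i @^-1` A (lift ord0 i))); last first.
  by apply/seteqP; split => [t At i _|t At i]; exact: At.
apply: fin_bigcap_measurable => [|i _]; first exact: finite_finset.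
by rewrite -[_ @^-1` _]setTI; exact: measurable_tnth.
Qed.

Variable P : probability T R.

Definition tensor_prob n : set (n.-tuple T) -> \bar R := tensor_power P n.
Arguments tensor_prob : clear implicits.

HB.instance Definition _ n := Measure.on (tensor_prob n).

Let tensor_prob_setT n : tensor_prob n [set: n.-tuple T] = 1%E.
Proof.
have := @tensor_power_box P n (fun=> setT) (fun=> measurableT).
rewrite big1 => [<-|i _]; last exact: probability_setT.
by congr (tensor_power P n _); apply/seteqP; split.
Qed.

HB.instance Definition _ n := Measure_isProbability.Build _ _ _
  (tensor_prob n) (tensor_prob_setT n).

End tensor_power.
Arguments tensor_prob {d T R} P n _.

Section lebesgue_rV.
Context {R : realType} {d : nat}.

Let tuple_rV (t : d.-tuple R) : 'rV[R]_d := \row_i tnth t i.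

Let measurable_tuple_rV : measurable_fun [set: d.-tuple R] tuple_rV.
Proof.
apply: measurable_fun_rVP => i.
by under eq_fun do rewrite mxE; exact: measurable_tnth.
Qed.

Definition lebesgue_rV : {measure set 'rV[R]_d -> \bar R} :=
  mpushforward (tensor_power (@lebesgue_measure R) d) measurable_tuple_rV.

End lebesgue_rV.

Section measures.
Context {R : realType}.

Definition kl d (T : measurableType d) (mu nu : probability T R) : \bar R :=
  if `[< mu `<< nu >] then
    (\int[mu]_x lne (Radon_Nikodym (charge_of_finite_measure mu) nu x))%E
  else +oo%E.

Definition has_density d (T : measurableType d) (mu nu : set T -> \bar R)
    (f : T -> R) : Prop :=
  [/\ measurable_fun [set: T] f, (forall x, 0 <= f x) &
      forall A, measurable A -> mu A = (\int[nu]_(x in A) (f x)%:E)%E].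

Variable d : nat.
Let E := 'rV[R]_d.

Definition coupling (mu nu : {measure set E -> \bar R})
    (g : probability (E * E)%type R) : Prop :=
  forall A, measurable A -> g (fst @^-1` A) = mu A /\ g (snd @^-1` A) = nu A.

(* Wasserstein distance of order s >= 1; it takes values in [0, +oo]. *)
Definition wass (s : nat) (mu nu : {measure set E -> \bar R}) : \bar R :=
  poweR (ereal_inf [set (\int[g]_z (enorm (z.1 - z.2) ^+ s)%:E)%E |
                     g in coupling mu nu]) s%:R^-1.

Definition m2 (mu : {measure set E -> \bar R}) : \bar R :=
  (\int[mu]_x (enorm x ^+ 2)%:E)%E.

Definition empirical N (x : N.-tuple E) : {measure set E -> \bar R} :=
  mscale (N%:R^-1 : R)%:nng (msum (fun i => \d_(nth 0 x i)) N).

End measures.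

Section calculus.
Context {R : realType} {d : nat}.
Implicit Types (f : 'rV[R]_d -> R) (x : 'rV[R]_d).

Definition evec (i : 'I_d) : 'rV[R]_d := delta_mx 0 i.

Definition grad f x : 'rV[R]_d := \row_i 'D_(evec i) f x.

Definition hess f x : 'M[R]_d :=
  \matrix_(i, j) 'D_(evec j) ('D_(evec i) f) x.

(* f is of class C^k *)
Fixpoint Ck (k : nat) f : Prop :=
  continuous f /\
  if k is k'.+1 then
    forall i, (forall x, derivable f x (evec i)) /\ Ck k' ('D_(evec i) f)
  else True.

Definition Cc1 f : Prop := Ck 1 f /\ compact (closure [set x | f x != 0]).

End calculus.

Section matern_kernel.
Context {R : realType}.
Implicit Types nu r s : R.

Definition Gamma s : R :=
  \int[lebesgue_measure]_(t in `]0, +oo[) (t `^ (s - 1) * expR (- t)).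

Definition cosh r : R := (expR r + expR (- r)) / 2.

(* Modified Bessel function of the second kind, for r > 0 and any real order:
   K_nu(r) = int_0^oo exp(- r cosh t) cosh(nu t) dt. *)
Definition besselK nu r : R :=
  \int[lebesgue_measure]_(t in `[0, +oo[) (expR (- r * cosh t) * cosh (nu * t)).

Variable d : nat.

Definition matern_profile nu r : R :=
  2 `^ (1 - (d%:R / 2 + nu)) / Gamma (d%:R / 2 + nu) * r `^ nu
    * besselK (- nu) r.

(* [besselK] diverges at 0; [Psi] is extended by continuity there. *)
Definition Psi nu (Sigma : 'M[R]_d) (z : 'rV[R]_d) : R :=
  let r := enorm (Sigma *m z^T)^T in
  if r == 0 then lim (matern_profile nu s @[s --> 0^'+])
  else matern_profile nu r.

Definition ktilde nu (Sigma : 'M[R]_d) (u v : 'rV[R]_d) : R :=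
  1 + dotp u v + Psi nu Sigma (u - v).

End matern_kernel.

(* The reproducing kernel Hilbert space of k, which is unique; [ip] is only
   meaningful on [carrier]. *)
Record rkhs (R : realType) (X : Type) (k : X -> X -> R) := RKHS {
  carrier : set (X -> R);
  ip : (X -> R) -> (X -> R) -> R;
  carrier0 : carrier (fun=> 0);
  carrier_lin : forall (a : R) f g, carrier f -> carrier g ->
    carrier (fun x => a * f x + g x);
  ip_sym : forall f g, carrier f -> carrier g -> ip f g = ip g f;
  ip_lin : forall (a : R) f g h, carrier f -> carrier g -> carrier h ->
    ip (fun x => a * f x + g x) h = a * ip f h + ip g h;
  ip_ge0 : forall f, carrier f -> 0 <= ip f f;
  ip_eq0 : forall f, carrier f -> ip f f = 0 -> f = (fun=> 0);
  ip_complete : forall u : nat -> X -> R, (forall n, carrier (u n)) ->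
    (forall e : R, 0 < e -> exists N, forall m n, (N <= m)%N -> (N <= n)%N ->
       ip (u m \- u n) (u m \- u n) < e) ->
    exists2 f, carrier f &
      ip (u n \- f) (u n \- f) @[n --> \oo] --> (0 : R);
  carrier_kernel : forall x, carrier (fun y => k y x);
  reproducing : forall f x, carrier f -> ip f (fun y => k y x) = f x }.

Section svgd.
Context {R : realType} {d : nat}.
Let E := 'rV[R]_d.
Implicit Types (V : E -> R) (k : E -> E -> R) (rho : probability E R).

Definition vfield V k rho (x : E) : E :=
  \row_i \int[rho]_y (- (k x y *: grad V y) + grad (k x) y) 0 i.

(* The norm of [vfield V k rho] in the d-fold product of the RKHS of k. *)
Definition ksd V k (H : rkhs k) rho : R :=
  Num.sqrt (\sum_(i < d) ip H (fun x => vfield V k rho x 0 i)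
                              (fun x => vfield V k rho x 0 i)).

(* The time integrand of the weak formulation, required to be integrable so
   that the identity is meaningful. *)
Definition weak_solution V k (mu : R -> probability E R) : Prop :=
  forall phi : E -> R, Cc1 phi -> forall t : R, 0 <= t ->
  let flux s := \int[mu s]_x dotp (grad phi x) (vfield V k (mu s) x) in
  lebesgue_measure.-integrable `[0, t] (EFin \o flux) /\
  \int[mu t]_x phi x =
  \int[mu 0]_x phi x + \int[lebesgue_measure]_(s in `[0, t]) flux s.

Definition kgm_exponent (n : nat) (nu : R) : R :=
  n%:R / (3 * (4 * n%:R + 1))
    * (1 / (3 * n%:R / 2 + 11 / 6 + (8 / 3 + 1 / n%:R) * nu)).

Definition kgm_comparison V k (H : rkhs k) (pi : probability E R)
    (C r : R) : Prop :=
  forall rho : probability E R, (m2 rho < +oo)%E ->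
  (wass 2 rho pi <= (C * Num.max 1 (ksd V H rho `^ (1 - r))
                       * ksd V H rho `^ r)%:E)%E.

(* Standard Brownian motion (indexed by R, only times t >= 0 matter):
   increments are mutually independent, and the coordinates of an increment
   over [s, t] are independent with law N(0, t - s). *)
Definition brownian dO (O : measurableType dO) (P : probability O R)
    (B : R -> {RV P >-> E}) : Prop :=
  [/\ {ae P, forall w, B 0 w = 0},
      {ae P, forall w, {within `[0, +oo[, continuous (fun t : R => B t w)}} &
      forall (n : nat) (t : nat -> R), 0 <= t 0%N ->
        {homo t : i j / (i < j)%N >-> i < j} ->
        forall A : 'I_n -> 'I_d -> set R, (forall l i, measurable (A l i)) ->
        P [set w | forall l i, A l i ((B (t l.+1) w - B (t l) w) 0 i)] =
        (\prod_(l < n) \prod_(i < d)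
           normal_prob 0 (Num.sqrt (t l.+1 - t l)) (A l i))%E].

(* Z solves dZ_t = - grad V (Z_t) / 2 dt + dB_t with Z_0 = x. The noise being
   additive, the stochastic equation is a pathwise integral equation. *)
Definition langevin V dO (O : measurableType dO) (P : probability O R)
    (B Z : R -> {RV P >-> E}) (x : E) : Prop :=
  {ae P, forall w,
    {within `[0, +oo[, continuous (fun t : R => Z t w)} /\
    forall t : R, 0 <= t -> forall i,
      Z t w 0 i = x 0 i
        - 1 / 2 * \int[lebesgue_measure]_(s in `[0, t]) grad V (Z s w) 0 i
        + B t w 0 i}.

Definition langevin_contractivity V : Prop :=
  exists (dO : measure_display) (O : measurableType dO) (P : probability O R)
    (B : R -> {RV P >-> E}) (Z : E -> R -> {RV P >-> E})
    (rho1 rho2 : R -> R),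
  [/\ brownian B, (forall x, langevin V B (Z x) x),
      (forall t : R, 0 <= t -> 0 <= rho1 t /\ 0 <= rho2 t),
      (forall (x y : E) (t : R), 0 <= t ->
         (wass 1 (distribution P (Z x t)) (distribution P (Z y t))
            <= (rho1 t * enorm (x - y))%:E)%E /\
         (wass 2 (distribution P (Z x t)) (distribution P (Z y t))
            <= (rho2 t * enorm (x - y))%:E)%E) &
      lebesgue_measure.-integrable `[0, +oo[ (EFin \o rho1)].

Record potential_assumption V (L a beta0 beta1 : R) : Prop := {
  V_gt0 : forall x, 0 < V x;
  V_C3 : Ck 3 V;
  V_grad : forall x, enorm (grad V x) <= L * (1 + enorm x);
  V_hess : forall x, opnorm (hess V x) <= L;
  V_dissipative : forall x,
    - dotp x (grad V x) + d%:R <= - a * enorm x ^+ 2 + beta1 * enorm x + beta0;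
  V_contractive : langevin_contractivity V }.

Definition gibbs V (pi : probability E R) : Prop :=
  exists c : R, has_density pi lebesgue_rV (fun x => c * expR (- V x)).

(* P0 N is the joint law of the N initial particles; N = 0 is irrelevant. *)
Record initial_assumption (pi : probability E R)
    (P0 : forall N, probability (N.-tuple E) R) (mustar : probability E R)
    (alpha beta c C : R) : Prop := {
  init_kl : (ereal_sup [set (N%:R^-1)%:E * kl (P0 N) (tensor_prob pi N) |
                        N in [set N | (0 < N)%N]] < +oo)%E;
  init_density : exists p, has_density mustar lebesgue_rV p;
  init_m2 : (m2 mustar < +oo)%E;
  init_kl_mustar : (kl mustar pi < +oo)%E;
  init_chaos : forall N, (0 < N)%N ->
    (P0 N [set x | (c * N%:R `^ (- alpha))%:E < wass 2 (empirical x) mustar]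
       <= if N == 1%N then +oo else (C * ln N%:R `^ (- beta))%:E)%E }.

End svgd.

(* Main.v *)
(* Reparametrize time by the clock m(t) = int_0^t h, where h bounds
   1 + m2(mu) + m2(nu). In clock time the drift of either solution grows at most
   linearly and is Lipschitz, uniformly in time, so that dyadic compositions of
   Euler steps converge to Lipschitz maps (sewing). These maps push mu_s to mu_t:
   on a compactly supported Lipschitz test function averaged at scale eps, one
   Euler step of length D costs O(D^2 / eps + eps D), and 2^j of them are
   affordable when eps tends to 0 after j tends to infinity.

   Pushing a coupling of (mu_s, nu_s) of squared cost f by the two maps, over a
   clock step D, gives a coupling of (mu_t, nu_t) of cost at most
   (1 + C D) f + K D^3, where C depends only on the growth and Lipschitz constants
   of the field: 1 + m2(nu_s) is bounded by a universal multiple of h at all later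
   times of the step, which lets the clock absorb the moments. Summing over small
   steps yields the factor exp(C m(T)).

   The Matern profile is a mixture of Gaussians exp(- exp(-t) |Sigma z|^2 / 4)
   (translate the integral defining K_nu); Lipschitz bounds for it and for its
   gradient follow by integration. *)

From HB Require Import structures.
Require Import Defs.
From mathcomp Require Import all_boot all_order all_algebra.
From mathcomp Require Import all_classical all_reals all_analysis.
From mathcomp Require Import measurable_realfun ring lra.

Set Implicit Arguments.
Unset Strict Implicit.
Unset Printing Implicit Defensive.

Import Order.TTheory GRing.Theory Num.Theory.
Import numFieldNormedType.Exports.

Local Open Scope classical_set_scope.
Local Open Scope ring_scope.

(** * Lipschitz functions *)

(** The Lipschitz and growth constants of the field carry second moments that are finite only at
    almost every time, with no bound uniform on [0, T]; hence the change of clock instead of a flow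
    in physical time. The delicate term is the change of measure in the field: at a point y it costs
    (1 + |y|) sqrt(h) S, where S is the L2 distance between the coupled positions. Squared and
    integrated against nu_s, it yields m_s h S^2 with m_s the moment of nu_s, whereas the clock pays
    for h^2. So m_s <= A h is required at every later time of the step, however small h is there. It
    holds because a flow map cannot shrink 1 + |x| by more than an exponential of the elapsed clock:
    a small moment at a later time forces a small moment at the start. The constant K of the cubic
    error depends on moment bounds of the two solutions, but steps of length D accumulate an error
    of order D^2 only, so that the limiting rate involves nothing but d and the constant c of the
    field. The final constant is half this rate because the propagated cost is the square of the
    distance. *)

Lemma le_of_eq disp (T : porderType disp) (x y : T) : x = y -> (x <= y)%O.
Proof. by move=> ->. Qed.

Definition lip (R : realType) (U V : normedModType R) (L : R) (f : U -> V) :=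
  forall x y, `|f x - f y| <= L * `|x - y|.

(** The working class of test functions. Unlike C^1 functions of compact support, it is stable under
    composition with proper Lipschitz maps such as the Euler steps, which need not be
    differentiable. *)
Definition lipc (R : realType) (d : nat) (L r : R) (f : 'rV[R]_d -> R) :=
  lip L (f : 'rV[R]_d -> R) /\ (forall x, r <= `|x| -> f x = 0).

Section rV_norm.
Context {R : realType} {d : nat}.
Implicit Types x y : 'rV[R]_d.

Lemma norm_coord x i : `|x 0 i| <= `|x|.
Proof.
rewrite [leRHS]mx_normrE.
by apply: (le_bigmax _ (fun ij : 'I_1 * 'I_d => `|x ij.1 ij.2|) (0, i)).
Qed.

Lemma norm_le_coord x (c : R) : 0 <= c -> (forall i, `|x 0 i| <= c) ->
  `|x| <= c.
Proof.
move=> c0 xc; rewrite [leLHS]mx_normrE; apply: bigmax_le => // -[i j] _ /=.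
by rewrite ord1.
Qed.

Lemma lip_continuous (V : normedModType R) (L : R) (f : 'rV[R]_d -> V) :
  lip L f -> continuous f.
Proof.
move=> Lf x; apply/(@cvgrPdist_le _ _ _ (nbhs x)) => /= e e0.
have L0 : 0 < `|L| + 1 by rewrite ltr_wpDl.
near=> y; apply: (le_trans (Lf _ _)).
have : `|x - y| <= e / (`|L| + 1).
  by near: y; apply: cvgr_dist_le => //; rewrite divr_gt0.
rewrite ler_pdivlMr// mulrC; apply: le_trans.
by rewrite ler_wpM2r// (le_trans (ler_norm _))// lerDl.
Unshelve. all: by end_near. Qed.

Lemma measurable_coord (i : 'I_d) :
  measurable_fun [set: 'rV[R]_d] (fun x => x 0 i).
Proof.
move=> _ B mB; rewrite setTI; apply: sub_sigma_algebra.
rewrite (bigD1 i)//=; left.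
by exists B => //; rewrite setTI.
Qed.

End rV_norm.

(** * Joint measurability of Carathéodory functions *)

Section caratheodory.
Context {R : realType} {d : nat}.

Definition grid (n : nat) (k : 'rV[int]_d) : 'rV[R]_d :=
  \row_i ((k 0 i)%:~R / n.+1%:R).

Definition gidx (n : nat) (x : 'rV[R]_d) : 'rV[int]_d :=
  \row_i Num.floor (n.+1%:R * x 0 i).

Lemma grid_close n (x : 'rV[R]_d) : `|x - grid n (gidx n x)| <= n.+1%:R^-1.
Proof.
apply: norm_le_coord => [|i]; first by rewrite invr_ge0.
rewrite !mxE; have n0 : (0 : R) < n.+1%:R by [].
have /andP[] := floor_itv (n.+1%:R * x 0 i); set k := Num.floor _.
rewrite intrD => h1 h2; rewrite ger0_norm ?subr_ge0 ?ler_pdivrMr//.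
  rewrite lerBlDl -[X in _ + X]mul1r -mulrDl ler_pdivlMr// mulrC ltW//.
by rewrite mulrC.
Qed.

Lemma grid_cvg (x : 'rV[R]_d) : grid n (gidx n x) @[n --> \oo] --> x.
Proof.
apply/cvgrPdist_le => /= e e0; near=> n; apply: (le_trans (grid_close _ _)).
rewrite -[leRHS]invrK lef_pV2 ?posrE ?invr_gt0// -natr1.
rewrite (@le_trans _ _ n%:R) ?lerDl//.
by near: n; exact: nbhs_infty_ger.
Unshelve. all: by end_near. Qed.

Lemma measurable_gidx n k : measurable [set x | gidx n x = k].
Proof.
have -> : [set x | gidx n x = k] =
    \bigcap_(i in [set: 'I_d]) ((fun x : 'rV[R]_d => x 0 i) @^-1`
      ((fun y => Num.floor (n.+1%:R * y)) @^-1` [set k 0 i])).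
  apply/seteqP; split => [x /= <- i _ /=|x /= xk]; first by rewrite mxE.
  by apply/rowP => i; rewrite mxE; exact: xk.
apply: fin_bigcap_measurable => [|i _]; first exact: finite_finset.
rewrite -[X in measurable X]setTI; apply: (measurable_coord i) => //.
rewrite [X in measurable X](_ : _ =
  `[(k 0 i)%:~R / n.+1%:R, (k 0 i + 1)%:~R / n.+1%:R[%classic)//.
apply/seteqP; split => y /=; rewrite in_itv/= ler_pdivrMr// ltr_pdivlMr//.
  by move=> <-; rewrite ![y * _]mulrC floor_itv.
by rewrite (mulrC y) => h; apply: floor_def.
Qed.

(** Rounding the second variable to a grid of mesh 1/(n+1) leaves countably many cells, on each of
    which the function depends measurably on the first variable alone; continuity then gives a
    pointwise limit of measurable functions. *)
Lemma caratheodory d' (T : measurableType d') (f : T -> 'rV[R]_d -> R) :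
  (forall x, measurable_fun [set: T] (f^~ x)) ->
  (forall t, continuous (f t)) ->
  measurable_fun [set: T * 'rV[R]_d] (fun p => f p.1 p.2).
Proof.
move=> mf cf.
apply: (@measurable_fun_cvg _ _ _ setT
    (fun n p => f p.1 (grid n (gidx n p.2)))) => //; last first.
  move=> p _; exact: (cvg_comp _ _ (@grid_cvg p.2) (cf p.1 p.2)).
move=> n _ B mB; rewrite setTI.
rewrite [X in measurable X](_ : _ = \bigcup_(k in [set: 'rV[int]_d])
  (((fun t => f t (grid n k)) @^-1` B) `*` [set x | gidx n x = k])).
  apply: countable_bigcupT_measurable => [|k]; first exact: countableP.
  apply: measurableX; last exact: measurable_gidx.
  by rewrite -[X in measurable X]setTI; exact: mf.
apply/seteqP; split => [p /= h|p /= [k _ [/= h1 h2]]]; last by rewrite h2.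
by exists (gidx n p.2).
Qed.

Lemma continuous_measurable_rV (f : 'rV[R]_d -> R) : continuous f ->
  measurable_fun [set: 'rV[R]_d] f.
Proof.
move=> cf; have /= := @caratheodory _ unit (fun=> f) (fun=> measurable_cst _) (fun=> cf).
exact: (measurable_fun_pair2 tt).
Qed.

End caratheodory.

(** * Open boxes and Lipschitz approximations of their indicators *)

Section boxes.
Context {R : realType} {d : nat}.
Local Notation E := 'rV[R]_d.

Definition box (a b : E) : set E := [set x | forall i, a 0 i < x 0 i < b 0 i].

Definition boxes : set (set E) := [set A | exists a b, A = box a b].

Lemma setI_closed_boxes : setI_closed boxes.
Proof.
move=> _ _ [a [b ->]] [a' [b' ->]].
exists (\row_i Num.max (a 0 i) (a' 0 i)), (\row_i Num.min (b 0 i) (b' 0 i)).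
apply/seteqP; split => [x [/= h1 h2] i|x /= h].
  rewrite !mxE gt_max lt_min.
  by have /andP[-> ->] := h1 i; have /andP[-> ->] := h2 i.
by split => i; have := h i; rewrite !mxE gt_max lt_min => /andP[/andP[? ?] /andP[? ?]];
  apply/andP.
Qed.

Lemma measurable_box a b : measurable (box a b).
Proof.
have -> : box a b = \bigcap_(i in [set: 'I_d]) ((fun x : E => x 0 i) @^-1`
    `]a 0 i, b 0 i[%classic).
  by apply/seteqP; split => [x /= xk i _|x /= xk i];
    have /= := xk i; rewrite in_itv/= //; apply.
apply: fin_bigcap_measurable => [|i _]; first exact: finite_finset.
by rewrite -[X in measurable X]setTI; apply: (measurable_coord i).
Qed.

(** The identity is measurable from the sigma-algebra of boxes because each coordinate is: a slab is
    the union of the boxes whose other sides are ]-n, n[. *)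
Lemma measurable_rV_boxes : @measurable _ E `<=` <<s boxes >>.
Proof.
move=> A mA.
have m1 : measurable_fun [set: g_sigma_algebraType boxes] (id : _ -> E).
  apply: measurable_fun_rVP => i.
  apply: (measurability _ (RGenOpens.measurableE R)) => _ [_ [x [y ->]] <-].
  rewrite setTI [X in measurable X](_ : _ = \bigcup_n
    box (\row_j if j == i then x else - n%:R)
        (\row_j if j == i then y else n%:R)).
    by apply: bigcupT_measurable => n; apply: sub_sigma_algebra; do 2 eexists.
  apply/seteqP; split => [z /=|z [n _ /= /(_ i)]]; last first.
    by rewrite !mxE eqxx in_itv.
  rewrite in_itv/= => zi; exists (Num.bound `|z|) => //= j; rewrite !mxE.
  case: eqP => [->//|_].
  have : `|z 0 j| < (Num.bound `|z|)%:R.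
    by apply: le_lt_trans (norm_coord _ _) (archi_boundP _).
  by rewrite ltr_norml.
by have := m1 measurableT _ mA; rewrite setTI.
Qed.

Lemma box_ind (P : set E -> Prop) : lambda_system setT P ->
  (forall a b, P (box a b)) -> forall A, measurable A -> P A.
Proof.
move=> lP Pbox A /measurable_rV_boxes.
apply: (lambda_system_subset setI_closed_boxes lP) => //.
by move=> _ [a [b ->]].
Qed.

(** Positive exactly on the open box and 1-Lipschitz, so that n times the depth, truncated to
    [0, 1], converges to the indicator from below. The seed 1 caps the depth and keeps it positive
    in dimension 0. *)
Definition box_depth (a b x : E) : R :=
  \big[Num.min/1]_(i < d) Num.min (x 0 i - a 0 i) (b 0 i - x 0 i).

Definition bump (a b : E) (n : nat) (x : E) : R :=
  Num.min 1 (Num.max 0 (n%:R * box_depth a b x)).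

Lemma ler_dist_min (s t u v e : R) : `|s - u| <= e -> `|t - v| <= e ->
  `|Num.min s t - Num.min u v| <= e.
Proof.
rewrite !ler_distl => /andP[? ?] /andP[? ?].
by case: (leP s t) => ?; case: (leP u v) => ?; lra.
Qed.

Lemma ler_dist_max (s t u v e : R) : `|s - u| <= e -> `|t - v| <= e ->
  `|Num.max s t - Num.max u v| <= e.
Proof.
rewrite !ler_distl => /andP[? ?] /andP[? ?].
by case: (leP s t) => ?; case: (leP u v) => ?; lra.
Qed.

Lemma box_depth_lip a b x y :
  `|box_depth a b x - box_depth a b y| <= `|x - y|.
Proof.
rewrite /box_depth; elim/big_ind2 : _ => [|s t u v|i _].
- by rewrite subrr normr0.
- exact: ler_dist_min.
have := norm_coord (x - y) i; rewrite !mxE => h.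
have -> : x 0 i - a 0 i = (x 0 i - y 0 i) + (y 0 i - a 0 i) by ring.
apply: ler_dist_min; first by rewrite addrK.
by rewrite (_ : _ - _ = - (x 0 i - y 0 i)) ?normrN//; ring.
Qed.

Lemma box_depth_gt0 a b x : (0 < box_depth a b x) <-> box a b x.
Proof.
rewrite /box_depth; split => [h i|h]; last first.
  by apply: lt_bigmin => // i _; rewrite lt_min !subr_gt0.
suff : 0 < Num.min (x 0 i - a 0 i) (b 0 i - x 0 i).
  by rewrite lt_min !subr_gt0.
by apply: (lt_le_trans h); exact: bigmin_le_cond.
Qed.

Lemma bump_ge0 a b n x : 0 <= bump a b n x.
Proof. by rewrite /bump le_min ler01 le_max lexx. Qed.

Lemma bump_le1 a b n x : bump a b n x <= 1.
Proof. by rewrite /bump ge_min lexx. Qed.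

Lemma bump_lipc a b n : lipc n%:R (`|a| + `|b| + 1) (bump a b n).
Proof.
split => [x y|x hx].
  apply: ler_dist_min; first by rewrite subrr normr0 mulr_ge0.
  apply: ler_dist_max; first by rewrite subrr normr0 mulr_ge0.
  by rewrite -mulrBr normrM ger0_norm// ler_wpM2l// box_depth_lip.
have [h|h] := ltP 0 (box_depth a b x); last first.
  by rewrite /bump max_l ?min_r// mulr_ge0_le0.
exfalso; move/box_depth_gt0 : h => h.
have : `|x| <= `|a| + `|b|.
  apply: norm_le_coord => [|i]; first by rewrite addr_ge0.
  have /andP[h1 h2] := h i.
  have := norm_coord a i; have := norm_coord b i.
  rewrite !ler_norml => /andP[? ?] /andP[? ?].
  by apply/andP; split; lra.
by move: hx; lra.
Qed.

Lemma bump_cvg a b x : bump a b n x @[n --> \oo] --> (\1_(box a b) x : R).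
Proof.
have [h|h] := ltP 0 (box_depth a b x); last first.
  rewrite (_ : (fun n => _) = cst 0).
    rewrite indicE memNset; first exact: cvg_cst.
    by move/box_depth_gt0; rewrite ltNge h.
  by apply/funext => n; rewrite /bump max_l ?min_r// mulr_ge0_le0.
rewrite indicE mem_set/=; last exact/box_depth_gt0.
apply: cvg_near_cst; near=> n; rewrite /bump max_r ?mulr_ge0 ?ltW//.
rewrite min_l// -ler_pdivrMr//.
  by near: n; exact: nbhs_infty_ger.
by near: n; exact: nbhs_infty_gtr.
Unshelve. all: by end_near. Qed.

End boxes.

(** * Domination for real-valued integrals *)

Section integrable_prob.
Context d (T : measurableType d) (R : realType).

Lemma integrable_scale (mu : {measure set T -> \bar R}) (D : set T) (k : R)
    (f : T -> R) : measurable D -> mu.-integrable D (EFin \o f) ->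
  mu.-integrable D (EFin \o (fun x => k * f x)).
Proof.
move=> mD fi; rewrite (_ : EFin \o _ = (fun x => k%:E * (f x)%:E))%E//.
exact: integrableZl.
Qed.

Lemma integrable_le (mu : {measure set T -> \bar R}) (D : set T) (f g : T -> R) :
  measurable D -> measurable_fun D f -> mu.-integrable D (EFin \o g) ->
  (forall x, D x -> `|f x| <= g x) -> mu.-integrable D (EFin \o f).
Proof.
move=> mD mf ig fg; apply: (le_integrable mD _ _ ig).
  exact/measurable_EFinP.
by move=> x Dx /=; rewrite lee_fin (le_trans (fg _ Dx))// ler_norm.
Qed.

Lemma ler_norm_Rintegral (mu : {measure set T -> \bar R}) (D : set T)
    (f g : T -> R) : measurable D ->
  measurable_fun D f -> mu.-integrable D (EFin \o g) ->
  (forall x, D x -> `|f x| <= g x) ->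
  `|\int[mu]_(x in D) f x| <= \int[mu]_(x in D) g x.
Proof.
move=> mD mf ig fg; have iF := integrable_le mD mf ig fg.
apply: (le_trans (le_normr_Rintegral mD iF)).
apply: le_Rintegral => //.
exact: (integrable_norm iF).
Qed.

Lemma EFin_Rintegral (mu : {measure set T -> \bar R}) (D : set T)
    (f : T -> R) : measurable D -> mu.-integrable D (EFin \o f) ->
  (\int[mu]_(x in D) f x)%:E = (\int[mu]_(x in D) (f x)%:E)%E.
Proof. by move=> mD iF; rewrite /Rintegral fineK//; exact: integrable_fin_num. Qed.

Lemma integrable_prob (P : probability T R) (f : T -> R) (c : R) :
  measurable_fun [set: T] f -> (forall x, `|f x| <= c) ->
  P.-integrable [set: T] (EFin \o f).
Proof.
move=> mf fc; apply: (@integrable_le _ _ _ (cst c)) => //.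
exact: finite_measure_integrable_cst.
Qed.

Lemma Rintegral_prob_cst (P : probability T R) (c : R) :
  \int[P]_(_ in [set: T]) c = c.
Proof. by rewrite Rintegral_cst//= probability_setT mulr1. Qed.

Lemma ler_norm_Rintegral_prob (P : probability T R) (f : T -> R) (c : R) :
  measurable_fun [set: T] f -> (forall x, `|f x| <= c) ->
  `|\int[P]_x f x| <= c.
Proof.
move=> mf fc; rewrite -[leRHS](Rintegral_prob_cst P).
apply: ler_norm_Rintegral => //; exact: finite_measure_integrable_cst.
Qed.

End integrable_prob.

(** * Probabilities are determined by Lipschitz test functions *)

Section test_functions.
Context {R : realType} {d : nat}.
Local Notation E := 'rV[R]_d.

Lemma lipc_bounded (L r : R) (f : E -> R) : lipc L r f ->
  exists c, forall x, `|f x| <= c.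
Proof.
move=> [Lf f0]; exists (`|f 0| + `|L| * `|r|) => x.
have [/f0->|xr] := leP r `|x|; first by rewrite normr0 addr_ge0 ?mulr_ge0.
rewrite -[f x](subrK (f 0)) addrC (le_trans (ler_normD _ _))// lerD2l.
apply: (le_trans (Lf x 0)); rewrite subr0.
apply: (@le_trans _ _ (`|L| * `|x|)); first by rewrite ler_wpM2r// ler_norm.
by rewrite ler_wpM2l// (le_trans (ltW xr))// ler_norm.
Qed.

Lemma lip_measurable (L : R) (f : E -> R) : lip L (f : E -> R) ->
  measurable_fun [set: E] f.
Proof. by move=> Lf; apply: continuous_measurable_rV; exact: (lip_continuous Lf). Qed.

Lemma lipc_integrable (P : probability E R) (L r : R) (f : E -> R) :
  lipc L r f -> P.-integrable [set: E] (EFin \o f).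
Proof.
move=> Lf; have [c fc] := lipc_bounded Lf.
by apply: integrable_prob fc; apply: lip_measurable Lf.1.
Qed.

Lemma cvg_integral_bump (P : probability E R) a b :
  (\int[P]_x bump a b n x)%:E @[n --> \oo] --> P (box a b).
Proof.
have -> : (fun n => (\int[P]_x bump a b n x)%:E) =
          (fun n => (\int[P]_x (bump a b n x)%:E)%E).
  apply/funext => n; rewrite EFin_Rintegral//.
  exact: (lipc_integrable P (bump_lipc a b n)).
have -> : P (box a b) = (\int[P]_x (\1_(box a b) x)%:E)%E.
  by rewrite integral_indic ?setIT//; exact: measurable_box.
apply: (@dominated_cvg _ _ _ P setT measurableT _ _ (cst 1%E)) => //.
- move=> n; apply/measurable_EFinP; exact: lip_measurable (bump_lipc a b n).1.
- move=> x _; apply: cvg_EFin; first by near=> n.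
  exact: bump_cvg.
- exact: finite_measure_integrable_cst.
- move=> n x _ /=; rewrite lee_fin ger0_norm ?bump_ge0// bump_le1//.
Unshelve. all: by end_near. Qed.

(** By dominated convergence the bumps transfer equality to boxes, which are stable under
    intersection and generate the Borel sets. *)
Lemma eq_prob_lipc (P Q : probability E R) :
  (forall L r f, lipc L r f -> \int[P]_x f x = \int[Q]_x f x) ->
  forall A, measurable A -> P A = Q A.
Proof.
move=> PQ A mA; suff : measurable A /\ P A = Q A by case.
move: A mA; apply: box_ind => [|a b]; last first.
  split; first exact: measurable_box.
  have h1 := @cvg_integral_bump P a b; have h2 := @cvg_integral_bump Q a b.
  apply: (cvg_unique _ h1); first exact: ereal_hausdorff.
  rewrite /= (_ : (fun n => _) = (fun n => (\int[Q]_x bump a b n x)%:E))//.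
  by apply/funext => n; rewrite (PQ _ _ _ (bump_lipc a b n)).
split => //.
- by split; rewrite ?probability_setT.
- move=> A B BA [mA PA] [mB PB]; split; first exact: measurableD.
  rewrite !measureD ?(le_lt_trans (probability_le1 _ _)) ?ltry//.
  have -> : A `&` B = B by exact/setIidr.
  by congr (_ - _)%E; [exact: PA|exact: PB].
- move=> F ndF mF.
  have mU : measurable (\bigcup_n F n).
    by apply: bigcupT_measurable => n; have [] := mF n.
  split => //.
  have h1 := @nondecreasing_cvg_mu _ _ _ P F (fun n => (mF n).1) mU ndF.
  have h2 := @nondecreasing_cvg_mu _ _ _ Q F (fun n => (mF n).1) mU ndF.
  apply: (cvg_unique _ h1); first exact: ereal_hausdorff.
  rewrite /= (_ : P \o F = Q \o F)//.
  by apply/funext => n; have [] := mF n.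
Qed.

(** The same passage from bumps to boxes to Borel sets. It makes a curve of probabilities a kernel
    in time when only its integrals against test functions are known to be measurable. *)
Lemma measurable_family_lipc d' (T : measurableType d') (P : T -> probability E R) :
  (forall L r f, lipc L r f ->
    measurable_fun [set: T] (fun t => \int[P t]_x f x)) ->
  forall A, measurable A -> measurable_fun [set: T] (fun t => P t A).
Proof.
move=> mP A mA; suff : measurable A /\ measurable_fun [set: T] (fun t => P t A).
  by case.
move: A mA; apply: box_ind => [|a b]; last first.
  split; first exact: measurable_box.
  apply: (emeasurable_fun_cvg (fun n t => (\int[P t]_x bump a b n x)%:E)).
    by move=> n; apply/measurable_EFinP; exact: mP (bump_lipc a b n).
  by move=> t _; exact: cvg_integral_bump.
split => //.
- split => //; rewrite (_ : (fun _ => _) = cst 1%E)//.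
  by apply/funext => t; rewrite probability_setT.
- move=> A B BA [mA PA] [mB PB]; split; first exact: measurableD.
  rewrite (_ : (fun _ => _) = (fun t => P t A - P t B)%E).
    exact: emeasurable_funB.
  by apply/funext => t; rewrite measureD ?(setIidr BA) ?(le_lt_trans (probability_le1 _ _))
    ?ltry.
- move=> F ndF mF.
  have mU : measurable (\bigcup_n F n).
    by apply: bigcupT_measurable => n; have [] := mF n.
  split => //.
  apply: (emeasurable_fun_cvg (fun n t => P t (F n))).
    by move=> n; exact: (mF n).2.
  move=> t _.
  exact: (@nondecreasing_cvg_mu _ _ _ (P t) F (fun n => (mF n).1) mU ndF).
Qed.

End test_functions.

(** * Averaging along the coordinates *)

Section primitive.
Context {R : realType}.
Local Notation mu := (@lebesgue_measure R).
Implicit Types U W : R -> R.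

Lemma lip_continuous_R (L : R) U : lip L U -> continuous U.
Proof.
move=> LU x; apply/cvgrPdist_le => /= e e0.
have L0 : 0 < `|L| + 1 by rewrite ltr_wpDl.
near=> y; apply: (le_trans (LU _ _)).
have : `|x - y| <= e / (`|L| + 1).
  by near: y; apply: cvgr_dist_le => //; rewrite divr_gt0.
rewrite ler_pdivlMr// mulrC; apply: le_trans.
by rewrite ler_wpM2r// (le_trans (ler_norm _))// lerDl.
Unshelve. all: by end_near. Qed.

Lemma continuous_integrable_itv U (a b : R) : continuous U ->
  mu.-integrable `[a, b] (EFin \o U).
Proof.
by move=> cU; apply: continuous_compact_integrable;
  [exact: segment_compact|exact: continuous_subspaceT].
Qed.

Lemma ex_primitive U (N : R) : continuous U ->
  exists W, forall t, - N < t < N -> is_derive t 1 W (U t).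
Proof.
move=> cU; exists (fun t => \int[mu]_(s in `[- N, t]) U s) => t /andP[h1 h2].
have [dW vW] := @continuous_FTC1_closed _ U (- N) t N h2
  (continuous_integrable_itv _ _ cU) h1 (cU t).
apply: DeriveDef; [exact: dW|rewrite -derive1E; exact: vW].
Qed.

(** By the mean value theorem W(b + k) - W(b) = k U(c), with c at distance at most |k| from b. *)
Lemma primitive_taylor U W (L b k : R) : lip L U ->
  (forall t, `|t - b| <= `|k| -> is_derive t 1 W (U t)) ->
  `|W (b + k) - W b - k * U b| <= L * k ^+ 2.
Proof.
move=> LU dW.
have cW (t : R) : `|t - b| <= `|k| -> {for t, continuous W}.
  by move=> /dW /@ex_derive /derivable1_diffP /differentiable_continuous.
have [k0|k0] := leP 0 k.
- have [|||c] := @MVT_segment _ W U b (b + k); first by rewrite lerDl.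
  + move=> x; rewrite in_itv/= => /andP[h1 h2]; apply: dW.
    by rewrite !ger0_norm ?subr_ge0 ?(ltW h1)//; lra.
  + apply: derivable_within_continuous => x; rewrite in_itv/= => /andP[h1 h2].
    apply: (@ex_derive _ _ _ _ _ _ _ (dW _ _)).
    by rewrite !ger0_norm ?subr_ge0//; lra.
  rewrite in_itv/= => /andP[h1 h2] ->.
  rewrite (_ : U c * _ - _ = k * (U c - U b)); last by ring.
  rewrite normrM expr2 mulrA (mulrC L) -mulrA ger0_norm// ler_wpM2l//.
  have L0 : L * `|c - b| <= L * k.
    have := LU (b + 1) b; rewrite addrAC subrr add0r normr1 mulr1.
    move=> /(le_trans (normr_ge0 _)) L0.
    by rewrite ler_wpM2l// ger0_norm; lra.
  exact: le_trans (LU _ _) L0.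
- have [|||c] := @MVT_segment _ W U (b + k) b; first by rewrite gerDl ltW.
  + move=> x; rewrite in_itv/= => /andP[h1 h2]; apply: dW.
    by rewrite (ltr0_norm k0) ltr0_norm ?subr_lt0//; lra.
  + apply: derivable_within_continuous => x; rewrite in_itv/= => /andP[h1 h2].
    apply: (@ex_derive _ _ _ _ _ _ _ (dW _ _)).
    by rewrite (ltr0_norm k0) ler0_norm ?subr_le0//; lra.
  rewrite in_itv/= => /andP[h1 h2] h.
  rewrite (_ : W (b + k) - _ - _ = - (W b - W (b + k)) - k * U b); last by ring.
  rewrite h (_ : _ - _ = k * (U c - U b)); last by ring.
  rewrite normrM -[k ^+ 2]sqrrN expr2 mulrA (mulrC L) -mulrA ltr0_norm//.
  rewrite ler_wpM2l ?oppr_ge0 ?(ltW k0)//.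
  have L0 : L * `|c - b| <= L * - k.
    have := LU (b + 1) b; rewrite addrAC subrr add0r normr1 mulr1.
    move=> /(le_trans (normr_ge0 _)) L0.
    by rewrite ler_wpM2l// ler0_norm; lra.
  exact: le_trans (LU _ _) L0.
Qed.

(** With W a primitive of U, the integral is (W(1 + k) - W(1)) - (W(k) - W(0)), and each bracket is
    known up to L k^2. *)
Lemma integral_shift_taylor U (L k : R) : lip L U ->
  `|\int[mu]_(s in `[0, 1]) (U (s + k) - U s) - k * (U 1 - U 0)|
    <= 2 * L * k ^+ 2.
Proof.
move=> LU; have cU := lip_continuous_R LU.
(* The interval of radius |k| + 2 contains [0, 1] and its translate by k in its interior. *)
have [W dW] := @ex_primitive U (`|k| + 2) cU.
have dW' (t : R) : `|t| < `|k| + 2 -> is_derive t 1 W (U t).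
  by rewrite ltr_norml => /dW.
pose G s := W (s + k) - W s.
have dG (s : R) : `|s| < 2 -> is_derive s 1 G (U (s + k) - U s).
  move=> s2; apply: is_deriveB; last first.
    by apply: dW'; rewrite (lt_le_trans s2)// lerDr.
  rewrite -[X in is_derive _ _ _ X]mulr1.
  apply: (@is_derive1_comp _ W (fun s => s + k)).
    by apply: dW'; rewrite (le_lt_trans (ler_normD _ _))// addrC ltrD2l.
  rewrite -[X in is_derive _ _ _ X]addr0; apply: is_deriveD.
have cG (s : R) : `|s| < 2 -> {for s, continuous G}.
  by move=> /dG /@ex_derive /derivable1_diffP /differentiable_continuous.
have h01 : forall s : R, 0 <= s <= 1 -> `|s| < 2.
  by move=> s /andP[? ?]; rewrite ger0_norm//; lra.
have eG : \int[mu]_(s in `[0, 1]) (U (s + k) - U s) = G 1 - G 0.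
  rewrite /Rintegral (@continuous_FTC2 _ _ G)//.
  - apply: continuous_subspaceT => s; apply: cvgB; last exact: cU.
    apply: (cvg_comp (fun s => s + k) U); last exact: cU.
    by apply: cvgD; [exact: cvg_id|exact: cvg_cst].
  - split.
    + move=> s; rewrite in_itv/= => /andP[? ?].
      by apply: (@ex_derive _ _ _ _ _ _ _ (dG _ _)); apply: h01; lra.
    + by apply: cvg_at_right_filter; apply: cG; apply: h01; lra.
    + by apply: cvg_at_left_filter; apply: cG; apply: h01; lra.
  - move=> s; rewrite in_itv/= => /andP[? ?]; rewrite derive1E.
    by apply: derive_val; apply: dG; apply: h01; lra.
rewrite eG /G.
have t1 : `|W (1 + k) - W 1 - k * U 1| <= L * k ^+ 2.
  apply: primitive_taylor => // t ht; apply: dW'.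
  rewrite -(subrK 1 t) (le_lt_trans (ler_normD _ _))// normr1.
  by rewrite ler_ltD//; lra.
have t0 : `|W (0 + k) - W 0 - k * U 0| <= L * k ^+ 2.
  apply: primitive_taylor => // t; rewrite subr0 => ht; apply: dW'.
  by rewrite (le_lt_trans ht)// ltrDl.
move: t1 t0; rewrite !ler_norml => /andP[? ?] /andP[? ?].
by apply/andP; split; lra.
Qed.

End primitive.

Section averaging.
Context {R : realType} {d : nat}.
Local Notation E := 'rV[R]_d.
Local Notation mu := (@lebesgue_measure R).
Variable eps : R.
Hypothesis eps_gt0 : 0 < eps.
Implicit Types (u v p : E -> R) (x y z : E) (i j : 'I_d) (l : seq 'I_d).

(** One-sided average over a segment of length eps. Applied once in each coordinate it acts as a
    mollifier that requires one-dimensional calculus only: the derivative of the average along e_i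
    is a difference quotient of u over the distance eps. *)
Definition avg i u x : R :=
  \int[mu]_(s in `[0, 1]) u (x + (eps * s) *: evec i).

Fixpoint avgs l u : E -> R := if l is i :: l' then avg i (avgs l' u) else u.

Lemma norm_evec i : `|evec i : E| <= 1.
Proof.
apply: norm_le_coord => // j; rewrite mxE eqxx/=.
by case: eqP => _; rewrite ?normr1 ?normr0.
Qed.

Lemma norm_Zevec i (a : R) : `|a *: (evec i : E)| <= `|a|.
Proof. by rewrite normrZ ler_piMr// norm_evec. Qed.

Lemma lip_line' (L : R) u x i : 0 <= L -> lip L u ->
  lip (L * eps) (fun s : R => u (x + (eps * s) *: evec i)).
Proof.
move=> L0 Lu s t /=; apply: (le_trans (Lu _ _)); rewrite -mulrA ler_wpM2l//.
rewrite opprD addrACA subrr add0r -scalerBl (le_trans (norm_Zevec _ _))//.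
by rewrite -mulrBr normrM (gtr0_norm eps_gt0).
Qed.

Lemma integrable_line (L : R) u x i : 0 <= L -> lip L u ->
  mu.-integrable `[0, 1] (EFin \o (fun s : R => u (x + (eps * s) *: evec i))).
Proof.
move=> L0 Lu; apply: continuous_integrable_itv.
exact: lip_continuous_R (lip_line' x i L0 Lu).
Qed.

Lemma Rintegral01_cst (c : R) : \int[mu]_(_ in `[0, 1]) c = c.
Proof. by rewrite Rintegral_cst//= lebesgue_measure_itv/= lte01 oppr0 adde0/= mulr1. Qed.

Lemma avg_close (L L' c : R) u v x y i : 0 <= L -> 0 <= L' ->
  lip L u -> lip L' v ->
  (forall s : R, 0 <= s <= 1 ->
    `|u (x + (eps * s) *: evec i) - v (y + (eps * s) *: evec i)| <= c) ->
  `|avg i u x - avg i v y| <= c.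
Proof.
move=> L0 L'0 Lu Lv h; rewrite /avg -RintegralB//; last 2 first.
  exact: (integrable_line _ _ L0 Lu).
  exact: (integrable_line _ _ L'0 Lv).
rewrite -[leRHS]Rintegral01_cst; apply: ler_norm_Rintegral => //.
- apply: measurable_funB; apply: measurable_funTS; apply: continuous_measurable_fun.
    exact: lip_continuous_R (lip_line' _ _ L0 Lu).
  exact: lip_continuous_R (lip_line' _ _ L'0 Lv).
- by apply: continuous_integrable_itv => ?; exact: cvg_cst.
Qed.

Lemma lip_avg (L : R) u i : 0 <= L -> lip L u -> lip L (avg i u).
Proof.
move=> L0 Lu x y; apply: (avg_close L0 L0 Lu Lu) => s _.
by apply: (le_trans (Lu _ _)); rewrite opprD addrACA subrr addr0.
Qed.

Lemma lip_avgs (L : R) u l : 0 <= L -> lip L u -> lip L (avgs l u).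
Proof. by move=> L0 Lu; elim: l => //= i l IH; exact: lip_avg. Qed.

(** Averages in the directions of l only see translates by vectors z of norm at most size l times
    eps, so a uniform comparison of translates passes to the averages. *)
Lemma avgs_close (L L' c : R) u v l x y : 0 <= L -> 0 <= L' ->
  lip L u -> lip L' v ->
  (forall z, `|z| <= (size l)%:R * eps -> `|u (x + z) - v (y + z)| <= c) ->
  `|avgs l u x - avgs l v y| <= c.
Proof.
move=> L0 L'0 Lu Lv; elim: l x y => [|i l IH] x y h /=.
  by have := h 0; rewrite normr0 mul0r !addr0; apply.
apply: (avg_close L0 L'0 (lip_avgs l L0 Lu) (lip_avgs l L'0 Lv)) => s s01.
apply: IH => z zl; rewrite -!addrA; apply: h.
rewrite (le_trans (ler_normD _ _))// -natr1 mulrDl mul1r addrC lerD//.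
rewrite (le_trans (norm_Zevec _ _))//; case/andP: s01 => s0 s1.
by rewrite ger0_norm ?mulr_ge0 ?(ltW eps_gt0)// ler_piMr// ltW.
Qed.

Lemma avgs_cst l (c : R) x : avgs l (cst c) x = c.
Proof.
elim: l x => //= i l IH x; rewrite /avg.
under eq_Rintegral do rewrite IH.
exact: Rintegral01_cst.
Qed.

Lemma lip_cst (c : R) : lip 0 (cst c : E -> R).
Proof. by move=> x y; rewrite subrr normr0 mul0r. Qed.

Lemma avgs_dist (L c a : R) u l x : 0 <= L -> lip L u ->
  (forall z, `|z| <= (size l)%:R * eps -> `|u (x + z) - a| <= c) ->
  `|avgs l u x - a| <= c.
Proof.
move=> L0 Lu h; rewrite -(avgs_cst l a x).
by apply: (avgs_close L0 (lexx 0) Lu (@lip_cst a)) => z /h.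
Qed.

Lemma avgs_near (L : R) u l x : 0 <= L -> lip L u ->
  `|avgs l u x - u x| <= L * ((size l)%:R * eps).
Proof.
move=> L0 Lu; apply: (avgs_dist L0 Lu) => z zl.
by apply: (le_trans (Lu _ _)); rewrite addrAC subrr add0r ler_wpM2l.
Qed.

Lemma lipc_avgs (L r : R) u l : 0 <= L -> lipc L r u ->
  lipc L (r + (size l)%:R * eps) (avgs l u).
Proof.
move=> L0 [Lu u0]; split; first exact: lip_avgs.
move=> x xr; apply/eqP; rewrite -normr_le0 -[avgs l u x]subr0.
apply: (avgs_dist L0 Lu) => z zl; rewrite u0 ?subrr ?normr0//.
rewrite -(lerD2r `|z|) (@le_trans _ _ (r + (size l)%:R * eps)) ?lerD2l//.
by rewrite (le_trans xr)// -{1}(addrK z x) (le_trans (ler_normB _ _)).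
Qed.

(** Says that p is the partial derivative of u along e_i, with a quadratic remainder uniform in x.
    In this quantitative form the property is inherited by averages in the other directions. *)
Definition taylor i u p (K : R) :=
  forall x h, `|u (x + h *: evec i) - u x - h * p x| <= K * h ^+ 2.

Lemma taylor_avg_same (L : R) u i : 0 <= L -> lip L u ->
  taylor i (avg i u) (fun x => (u (x + eps *: evec i) - u x) / eps)
    (2 * L / eps).
Proof.
move=> L0 Lu x h; pose U s := u (x + (eps * s) *: evec i).
have LU : lip (L * eps) U by exact: lip_line'.
have e0 : eps != 0 by rewrite gt_eqF.
have := integral_shift_taylor (h / eps) LU.
have -> : 2 * (L * eps) * (h / eps) ^+ 2 = 2 * L / eps * h ^+ 2.
  by rewrite expr2; field.
have -> : h / eps * (U 1 - U 0) = h * ((u (x + eps *: evec i) - u x) / eps).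
  rewrite /U mulr1 mulr0 scale0r addr0; ring.
rewrite /avg -RintegralB//; last 2 first.
  exact: (integrable_line _ _ L0 Lu).
  exact: (integrable_line _ _ L0 Lu).
suff -> : (fun s => u (x + h *: evec i + (eps * s) *: evec i)
    - u (x + (eps * s) *: evec i)) = (fun s => U (s + h / eps) - U s) by [].
apply/funext => s; rewrite /U; congr (u _ - _).
rewrite -addrA -scalerDl; congr (x + _ *: _).
by rewrite mulrDr [RHS]addrC mulrCA divff// mulr1.
Qed.

(** Averaging along e_j is linear and commutes with translations along e_i, so the Taylor remainder
    itself gets averaged. *)
Lemma taylor_avg (L L' K : R) u p i j : 0 <= L -> 0 <= L' -> lip L u -> lip L' p ->
  taylor i u p K -> taylor i (avg j u) (avg j p) K.
Proof.
move=> L0 L'0 Lu Lp h x k.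
pose v y := u (y + k *: evec i) - k * p y.
have Lv : lip (L + `|k| * L') v.
  move=> y z; rewrite /v (_ : _ - _ = (u (y + k *: evec i) - u (z + k *: evec i))
    - k * (p y - p z)); last by ring.
  rewrite (le_trans (ler_normB _ _))// mulrDl lerD//.
    by apply: (le_trans (Lu _ _)); rewrite opprD addrACA subrr addr0.
  by rewrite normrM -mulrA ler_wpM2l.
have Lv0 : 0 <= L + `|k| * L' by rewrite addr_ge0// mulr_ge0.
have -> : avg j u (x + k *: evec i) - avg j u x - k * avg j p x =
          avg j v x - avg j u x.
  rewrite addrAC; congr (_ - _).
  rewrite /avg -RintegralZl//; last exact: (integrable_line _ _ L'0 Lp).
  rewrite -RintegralB//.
  - by apply: eq_Rintegral => s _; rewrite /v addrAC.
  - exact: (integrable_line _ _ L0 Lu).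
  - apply: continuous_integrable_itv => s; apply: cvgM; first exact: cvg_cst.
    exact: (lip_continuous_R (lip_line' _ _ L'0 Lp)).
apply: (avg_close Lv0 L0 Lv Lu) => s _; rewrite /v addrAC.
exact: h.
Qed.

Lemma taylor_avgs (L : R) u l i : 0 <= L -> lip L u -> i \in l ->
  exists p, [/\ taylor i (avgs l u) p (2 * L / eps),
    lip (2 * L / eps) p & forall x, `|p x| <= L].
Proof.
move=> L0 Lu; elim: l => //= j l IH; rewrite in_cons.
have [<- _|ij /= il] := eqVneq i j.
  have Ll := lip_avgs l L0 Lu.
  eexists; split; first exact: taylor_avg_same.
    move=> x y /=; rewrite -mulrBl normrM (gtr0_norm (_ : 0 < eps^-1)) ?invr_gt0//.
    rewrite mulrAC ler_wpM2r ?invr_ge0 ?(ltW eps_gt0)//.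
    rewrite opprB addrACA -opprD -[_ + _ - _]/(_ + _ - _).
    rewrite (_ : 2 * L * `|x - y| = L * `|x - y| + L * `|x - y|); last by ring.
    rewrite (_ : _ - _ = (avgs l u (x + eps *: evec i) - avgs l u (y + eps *: evec i))
        - (avgs l u x - avgs l u y)); last by ring.
    rewrite (le_trans (ler_normB _ _))// lerD//.
    by apply: (le_trans (Ll _ _)); rewrite opprD addrACA subrr addr0.
  move=> x /=; rewrite normrM (gtr0_norm (_ : 0 < eps^-1)) ?invr_gt0//.
  rewrite ler_pdivrMr//; apply: (le_trans (Ll _ _)); rewrite ler_wpM2l//.
  by rewrite addrAC subrr add0r (le_trans (norm_Zevec _ _))// gtr0_norm.
have [p [tp Lp p0]] := IH il.
have LK : 0 <= 2 * L / eps by rewrite divr_ge0 ?mulr_ge0// ltW.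
exists (avg j p); split.
- exact: (taylor_avg j L0 LK (lip_avgs l L0 Lu) Lp tp).
- exact: lip_avg.
- move=> x; rewrite -[avg j p x]subr0 -[X in _ - X](@avgs_cst [:: j] 0 x) /=.
  apply: (avg_close LK (lexx 0) Lp (@lip_cst 0)) => s _.
  by rewrite subr0.
Qed.

End averaging.

(** * From uniform Taylor bounds to C^1 test functions *)

Section taylor_calculus.
Context {R : realType} {d : nat}.
Local Notation E := 'rV[R]_d.
Implicit Types (u p : E -> R) (i : 'I_d).

Lemma taylor_derive i u p (K : R) : taylor i u p K -> forall x,
  derivable u x (evec i) /\ 'D_(evec i) u x = p x.
Proof.
move=> tu x.
have : h^-1 *: ((u \o shift x) (h *: evec i) - u x) @[h --> (0:R)^'] --> p x.
  apply/cvgrPdist_le => /= e e0.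
  have K0 : 0 < `|K| + 1 by rewrite ltr_wpDl.
  near=> h.
  have h0 : h != 0 by near: h; exact: nbhs_dnbhs_neq.
  rewrite /shift/=.
  rewrite (_ : p x - _ = - (h^-1 * (u (x + h *: evec i) - u x - h * p x))); last first.
    by rewrite (addrC x) /GRing.scale/=; field.
  rewrite normrN normrM normfV mulrC ler_pdivrMr ?normr_gt0//.
  rewrite (le_trans (tu _ _))// -real_normK ?num_real// expr2 mulrA.
  rewrite ler_wpM2r// (@le_trans _ _ ((`|K| + 1) * `|h|))//.
    by rewrite ler_wpM2r// (le_trans (ler_norm K))// lerDl.
  rewrite mulrC -ler_pdivlMr//.
  near: h; apply: dnbhs0_le; exact: divr_gt0.
move=> h; split; first by apply/cvg_ex; exists (p x).
exact: cvg_lim h.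
Unshelve. all: by end_near. Qed.

Lemma lip_bounded_compact (L r : R) u : lipc L r u ->
  compact (closure [set x | u x != 0]).
Proof.
move=> [_ u0]; apply: bounded_closed_compact; last exact: closed_closure.
exists `|r|; split; first exact: num_real.
move=> M rM x /=; rewrite /closure/= => cx.
have clB : closed [set y : E | `|y| <= `|r|].
  rewrite (_ : [set y : E | _] = Num.norm @^-1` [set y : R | y <= `|r|])//.
  apply: closed_comp => [y _|]; first exact: norm_continuous.
  exact: closed_le.
have := @closure_subset _ [set x | u x != 0] [set y : E | `|y| <= `|r|].
rewrite -(proj1 (closure_id _) clB) => /(_ _ x cx)/= h.
rewrite (le_trans (h _)) ?(ltW rM)// => y /=; apply: contra_neqT.
by rewrite -ltNge => yr; apply: u0; rewrite ltW// (le_lt_trans (ler_norm r)).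
Qed.

(** The gradient keeps the bound L whatever eps is, whereas its Lipschitz constant and the Taylor
    remainder grow like 1 / eps. This imbalance governs the later choice of eps. *)
Lemma Cc1_avgs (eps L r : R) u : 0 < eps -> 0 <= L -> lipc L r u ->
  let w := avgs eps (enum 'I_d) u in
  exists p : 'I_d -> E -> R, [/\ Cc1 w,
    forall i x, 'D_(evec i) w x = p i x,
    forall i, taylor i w (p i) (2 * L / eps),
    forall i, lip (2 * L / eps) (p i) & forall i x, `|p i x| <= L].
Proof.
move=> e0 L0 [Lu u0] w.
have ip i : exists p, [/\ taylor i w p (2 * L / eps),
    lip (2 * L / eps) p & forall x, `|p x| <= L].
  by apply: taylor_avgs => //; rewrite mem_enum.
have [p pP] := choice ip.
have wc : lipc L (r + (size (enum 'I_d))%:R * eps) w by exact: lipc_avgs.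
exists p; split => [|i x|i|i|i x]; try by have [] := pP i.
  split; last exact: lip_bounded_compact wc.
  split; first exact: lip_continuous wc.1.
  move=> i; have [tp Lp _] := pP i; split => [x|].
    by have [] := taylor_derive tp x.
  rewrite (_ : 'D_(evec i) w = p i); first by split => //; exact: lip_continuous Lp.
  by apply/funext => x; have [] := taylor_derive tp x.
by have [tp _ _] := pP i; have [] := taylor_derive tp x.
Qed.

(** Coordinates are moved one at a time. Each move costs its own remainder, and the error of reading
    its partial derivative at the displaced point; the induction closes because 1 + 2n^2 + n <= 2(n
    + 1)^2. *)
Lemma taylor_sum (K : R) u (p : 'I_d -> E -> R) : 0 <= K ->
  (forall i, taylor i u (p i) K) -> (forall i, lip K (p i)) ->
  forall x h, `|u (x + h) - u x - \sum_i h 0 i * p i x|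
    <= K * (2 * d%:R ^+ 2) * `|h| ^+ 2.
Proof.
move=> K0 tp Lp x h.
have key (l : seq 'I_d) : uniq l ->
  `|u (x + \sum_(i <- l) h 0 i *: evec i) - u x - \sum_(i <- l) h 0 i * p i x|
    <= K * (2 * (size l)%:R ^+ 2) * `|h| ^+ 2.
  elim: l => [|i l IH] /=.
    by rewrite !big_nil addr0 !subrr normr0 expr0n !mulr0 mul0r.
  move=> /andP[_ /IH{}IH]; rewrite !big_cons.
  set z := \sum_(_ <- _) _ *: _ in IH *; set q := \sum_(_ <- _) _ in IH *.
  have nz : `|z| <= (size l)%:R * `|h|.
    rewrite /z (le_trans (ler_norm_sum _ _ _))//.
    rewrite (@le_trans _ _ (\sum_(j <- l) `|h|))//.
      by apply: ler_sum => j _; rewrite (le_trans (norm_Zevec _ _))// norm_coord.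
    by rewrite big_const_seq count_predT iter_addr_0 mulr_natl.
  have t := tp i (x + z) (h 0 i).
  rewrite (_ : _ - _ = (u (x + z + h 0 i *: evec i) - u (x + z) - h 0 i * p i (x + z))
     + (u (x + z) - u x - q) + h 0 i * (p i (x + z) - p i x)); last first.
    by rewrite (addrC _ z) addrA; ring.
  rewrite (le_trans (ler_normD _ _))//.
  rewrite (le_trans (lerD (ler_normD _ _) (lexx _)))//.
  have h1 : K * h 0 i ^+ 2 <= K * `|h| ^+ 2.
    by rewrite ler_wpM2l// -real_normK ?num_real// ler_sqr ?nnegrE// norm_coord.
  have h2 : `|h 0 i * (p i (x + z) - p i x)| <= K * (size l)%:R * `|h| ^+ 2.
    rewrite normrM (@le_trans _ _ (`|h| * (K * ((size l)%:R * `|h|))))//.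
      rewrite ler_pM ?norm_coord// (le_trans (Lp i _ _))// addrAC subrr add0r.
      by rewrite ler_wpM2l.
    by apply: le_of_eq; ring.
  rewrite (le_trans (lerD (lerD (le_trans t h1) IH) h2))//.
  rewrite -[(size l).+1%:R]natr1; set n : R := (size l)%:R; have n0 : 0 <= n by [].
  rewrite (_ : _ + _ = K * `|h| ^+ 2 * (1 + 2 * n ^+ 2 + n)); last by ring.
  rewrite [leRHS](_ : _ = K * `|h| ^+ 2 * (2 * (n + 1) ^+ 2)); last by ring.
  by rewrite ler_wpM2l ?mulr_ge0//; nra.
have := key (enum 'I_d) (enum_uniq _).
rewrite size_enum_ord !big_enum/= (_ : \sum_i h 0 i *: evec i = h)//.
by rewrite [RHS]row_sum_delta.
Qed.

End taylor_calculus.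

(** * The Matern kernel *)

Section gumbel.
Context {R : realType}.
Local Notation mu := (@lebesgue_measure R).

Lemma continuous_expR_comp (f : R -> R) : continuous f ->
  continuous (fun t => expR (f t)).
Proof.
by move=> cf t; apply: (cvg_comp f (@expR R)); [exact: cf|exact: continuous_expR].
Qed.

Lemma continuous_mull (a : R) : continuous (fun t : R => a * t).
Proof. by move=> t; apply: cvgM; [exact: cvg_cst|exact: cvg_id]. Qed.

Lemma integral_shift (G : R -> R) (k : R) : continuous G ->
  (forall x, 0 <= G x) ->
  (\int[mu]_x (G x)%:E = \int[mu]_x (G (x + k))%:E)%E.
Proof.
move=> cG G0.
have dF (x : R) : is_derive x 1 (fun t : R => t + k) 1.
  by rewrite -[X in is_derive _ _ _ X]addr0; apply: is_deriveD.
have eF : derive1 (fun t : R => t + k) = cst 1.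
  by apply/funext => x; rewrite derive1E; apply: derive_val.
rewrite (@increasing_ge0_integration_by_substitutionT _ (fun t => t + k))//.
- by apply: eq_integral => x _; rewrite eF /= mulr1.
- by move=> x y; rewrite ltrD2r.
- by rewrite eF => x; exact: cvg_cst.
- by rewrite eF; exact: is_cvg_cst.
- by rewrite eF; exact: is_cvg_cst.
- apply/cvgrNyPle => A; near=> x; rewrite -lerBrDr.
  by near: x; apply: nbhs_ninfty_le; exact: num_real.
- apply/cvgryPge => A; near=> x; rewrite -lerBlDr.
  by near: x; apply: nbhs_pinfty_ge; exact: num_real.
Unshelve. all: by end_near. Qed.

Lemma integrable_expR_Ny (b : R) : 0 < b ->
  mu.-integrable `]-oo, 0] (EFin \o (fun t => expR (b * t))).
Proof.
move=> b0; have cE : continuous (fun t : R => expR (b * t)).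
  exact/continuous_expR_comp/continuous_mull.
apply/integrableP; split.
  apply/measurable_EFinP; apply: measurable_funTS; exact: continuous_measurable_fun.
under eq_integral do rewrite /= ger0_norm ?expR_ge0//.
rewrite -{1}oppr0 ge0_integration_by_substitutionNy; last 2 first.
- exact: continuous_subspaceT.
- by move=> x _; exact: expR_ge0.
have i1 := integral_exponential_pdf b0.
rewrite [X in (X < _)%E](_ : _ = (\int[mu]_(x in `[0%R, +oo[) ((b^-1)%:E * (exponential_pdf
    b x)%:E))%E).
  rewrite ge0_integralZl//; last 3 first.
  - apply/measurable_EFinP; apply: measurable_funTS; exact: measurable_exponential_pdf.
  - by move=> x _; rewrite lee_fin exponential_pdf_ge0// ltW.
  - by rewrite lee_fin invr_ge0 ltW.
  rewrite lte_mul_pinfty ?lee_fin ?invr_ge0 ?(ltW b0)//.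
  apply: (@le_lt_trans _ _ (\int[mu]_x (exponential_pdf b x)%:E)%E); last by rewrite i1 ltry.
  apply: ge0_subset_integral => //.
  - apply/measurable_EFinP; exact: measurable_exponential_pdf.
  - by move=> x _; rewrite lee_fin exponential_pdf_ge0// ltW.
apply: eq_integral => x; rewrite inE/= in_itv/= andbT => x0.
rewrite exponential_pdfE// -EFinM mulrA mulVf ?gt_eqF// mul1r.
by rewrite mulrN mulNr.
Qed.

(** Under u = e^t this is the integrand of Gamma(b). For t <= 0 it is below exp(b t). For t > 0, e^t
    >= (t / 2)^2 and the square of t / 2 - (b + 1) bound it by exp((b + 1)^2) times an exponential
    density. *)
Lemma integrable_gumbel (b : R) : 0 < b ->
  mu.-integrable [set: R] (EFin \o (fun t => expR (b * t - expR t))).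
Proof.
move=> b0.
pose g (t : R) : R := ((fun t : R => expR (b * t)) \_ `]-oo, 0]) t
   + expR ((b + 1) ^+ 2) * exponential_pdf 1 t.
apply: (@integrable_le _ _ R mu setT (fun t => expR (b * t - expR t)) g) => //.
- apply: continuous_measurable_fun; apply: continuous_expR_comp => t.
  by apply: cvgB; [exact: continuous_mull|exact: continuous_expR].
- rewrite (_ : EFin \o g = (EFin \o ((fun t : R => expR (b * t)) \_ `]-oo, 0%R])
      \+ (fun t => (expR ((b + 1) ^+ 2))%:E * (exponential_pdf 1 t)%:E))%E)//.
  apply: integrableD => //.
    rewrite -restrict_EFin; apply/integrable_restrict => //=.
    by rewrite setTI; exact: integrable_expR_Ny.
  by apply: integrableZl => //; exact: integrable_exponential_pdf.
- move=> t _; rewrite ger0_norm ?expR_ge0// /g.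
  have [t0|t0] := leP t 0.
    rewrite patchE ifT ?inE/= ?in_itv//= -[leLHS]addr0 lerD//.
      by rewrite ler_expR gerBl expR_ge0.
    by rewrite mulr_ge0 ?expR_ge0// exponential_pdf_ge0.
  rewrite patchE ifF ?add0r; last first.
    by apply/negbTE/negP; rewrite inE/= in_itv/= leNgt t0.
  rewrite exponential_pdfE ?(ltW t0)// mulN1r mul1r -expRD ler_expR.
  have h : 1 + t / 2 <= expR (t / 2) by exact: expR_ge1Dx.
  have e : expR t = expR (t / 2) ^+ 2.
    by rewrite expr2 -expRD; congr expR; lra.
  have h2 : (t / 2) ^+ 2 <= expR t by rewrite e; nra.
  have := sqr_ge0 (t / 2 - (b + 1)); rewrite !expr2 in h2 *; lra.
Qed.

End gumbel.

(** * Lipschitz and Taylor bounds for the Gaussian *)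

Section gauss.
Context {R : realType} {d : nat}.
Local Notation E := 'rV[R]_d.
Implicit Types a b k : E.

Definition gauss a : R := expR (- dotp a a).

Lemma dotp_ge0 a : 0 <= dotp a a.
Proof. by rewrite sumr_ge0// => i _; rewrite -expr2 sqr_ge0. Qed.

Lemma dotpC a b : dotp a b = dotp b a.
Proof. by apply: eq_bigr => i _; rewrite mulrC. Qed.

Lemma dotpDl a b c : dotp (a + b) c = dotp a c + dotp b c.
Proof. by rewrite -big_split; apply: eq_bigr => i _; rewrite mxE mulrDl. Qed.

Lemma dotpDr a b c : dotp c (a + b) = dotp c a + dotp c b.
Proof. by rewrite ![dotp c _]dotpC dotpDl. Qed.

Lemma dotpZl (s : R) a b : dotp (s *: a) b = s * dotp a b.
Proof. by rewrite mulr_sumr; apply: eq_bigr => i _; rewrite mxE mulrA. Qed.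

Lemma dotpZr (s : R) a b : dotp b (s *: a) = s * dotp b a.
Proof. by rewrite ![dotp b _]dotpC dotpZl. Qed.

Lemma norm_dotp a b : `|dotp a b| <= d%:R * `|a| * `|b|.
Proof.
rewrite (le_trans (ler_norm_sum _ _ _))//.
rewrite -mulrA -[X in X%:R * _]card_ord -sumr_const mulr_suml ler_sum// => i _.
by rewrite mul1r normrM ler_pM// norm_coord.
Qed.

Lemma sqr_norm_le_dotp a : `|a| ^+ 2 <= dotp a a.
Proof.
rewrite -ler_sqrt ?dotp_ge0// sqrtr_sqr ger0_norm//.
apply: norm_le_coord => [|i]; first exact: sqrtr_ge0.
rewrite -sqrtr_sqr ler_sqrt ?dotp_ge0// /dotp (bigD1 i)//= expr2 lerDl.
by rewrite sumr_ge0// => j _; rewrite -expr2 sqr_ge0.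
Qed.

Lemma gauss_ge0 a : 0 <= gauss a. Proof. exact: expR_ge0. Qed.

Lemma gauss_le a : gauss a <= expR (- `|a| ^+ 2).
Proof. by rewrite ler_expR lerN2 sqr_norm_le_dotp. Qed.

Lemma gauss_le1 a : gauss a <= 1.
Proof. by rewrite -expR0 ler_expR oppr_le0 dotp_ge0. Qed.

(** Both signs follow from e^x >= 1 + x at the difference of the squared lengths. The factor
    exp(-m^2) is kept to absorb the linear growth of the last factor. *)
Lemma gauss_diff a b (m : R) : 0 <= m -> m <= `|a| -> m <= `|b| ->
  `|gauss a - gauss b| <= expR (- m ^+ 2) * (d%:R * `|a - b| * (`|a| + `|b|)).
Proof.
have key a' b' : 0 <= m -> m <= `|a'| -> m <= `|b'| ->
  gauss a' - gauss b' <= expR (- m ^+ 2) * (d%:R * `|a' - b'| * (`|a'| + `|b'|)).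
  move=> m0 ma mb.
  have h : gauss a' * (1 + (dotp a' a' - dotp b' b')) <= gauss b'.
    rewrite [leRHS](_ : _ = gauss a' * expR (dotp a' a' - dotp b' b')).
      by rewrite ler_wpM2l ?gauss_ge0// expR_ge1Dx.
    by rewrite -expRD; congr expR; ring.
  have h2 : `|dotp a' a' - dotp b' b'| <= d%:R * `|a' - b'| * (`|a'| + `|b'|).
    rewrite (_ : _ - _ = dotp (a' - b') (a' + b')).
      rewrite (le_trans (norm_dotp _ _))// ler_wpM2l ?mulr_ge0//.
      exact: ler_normD.
    rewrite -(scaleN1r b') dotpDl !dotpDr !dotpZl (dotpC b' a'); ring.
  rewrite (@le_trans _ _ (gauss a' * `|dotp a' a' - dotp b' b'|))//.
    have := ler_norm (- (dotp a' a' - dotp b' b')); rewrite normrN => h3.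
    have := ler_wpM2l (gauss_ge0 a') h3; lra.
  rewrite ler_pM ?gauss_ge0// (le_trans (gauss_le _))// ler_expR lerN2.
  by rewrite ler_sqr ?nnegrE.
move=> m0 ma mb; rewrite ler_norml; apply/andP; split; last exact: key.
by rewrite lerNl opprB distrC (addrC `|a|); apply: key.
Qed.

Lemma mul_expRN_sqr (m : R) : 0 <= m -> m * expR (- m ^+ 2) <= 1 /\
  m ^+ 2 * expR (- m ^+ 2) <= 1.
Proof.
move=> m0; have h := expR_ge1Dx (m ^+ 2).
have e0 : 0 < expR (m ^+ 2) by exact: expR_gt0.
by rewrite !expRN !ler_pdivrMr// mul1r; split; nra.
Qed.

(** Take |b| <= |a|. If |a| <= 2 |b|, the factor exp(-|b|^2) absorbs |a| + |b|. Otherwise |a| <= 2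
    |a - b|, and the trivial bound 1 suffices unless |a| < 1. *)
Lemma gauss_lip : lip (3 * d%:R + 2) gauss.
Proof.
move=> a b.
wlog ab : a b / `|b| <= `|a|.
  move=> h; have [/h//|/ltW/h] := leP `|b| `|a|.
  by rewrite distrC (distrC b).
have d0 : 0 <= d%:R :> R by [].
have n0 : 0 <= `|a - b| by [].
have [h|h] := leP `|a| (2 * `|b|).
  have := @gauss_diff a b `|b| (normr_ge0 _) ab (lexx _).
  move=> /le_trans; apply.
  have [m1 _] := mul_expRN_sqr (normr_ge0 b).
  set e := expR _ in m1 *; have e0 : 0 <= e by exact: expR_ge0.
  rewrite (@le_trans _ _ (e * (d%:R * `|a - b| * (3 * `|b|))))//.
    by rewrite ler_wpM2l// ler_wpM2l ?mulr_ge0//; lra.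
  rewrite [leLHS](_ : _ = 3 * d%:R * `|a - b| * (`|b| * e)); last by ring.
  rewrite (@le_trans _ _ (3 * d%:R * `|a - b|))//.
    by rewrite ler_piMr ?mulr_ge0.
  by rewrite ler_wpM2r//; lra.
have hab : `|a| <= 2 * `|a - b|.
  by have := ler_normD (a - b) b; rewrite subrK; lra.
have [a1|a1] := leP 1 `|a|.
  rewrite (@le_trans _ _ 1)//; last by nra.
  rewrite ler_norml; have := gauss_ge0 a; have := gauss_ge0 b.
  by have := gauss_le1 a; have := gauss_le1 b; move=> *; apply/andP; split; lra.
have := @gauss_diff a b 0 (lexx _) (normr_ge0 _) (normr_ge0 _).
rewrite expr0n/= oppr0 expR0 mul1r => /le_trans; apply.
rewrite mulrAC ler_wpM2r// (@le_trans _ _ (d%:R * 3))//; last by lra.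
by rewrite ler_wpM2l//; have := normr_ge0 b; lra.
Qed.

(** Up to a factor -2 this is a partial derivative of [gauss]. The same comparison of norms applies,
    now with |b|^2 exp(-|b|^2) <= 1. *)
Lemma coord_gauss_lip i : lip (3 * d%:R + 2) (fun a => a 0 i * gauss a).
Proof.
move=> a b.
wlog ab : a b / `|b| <= `|a|.
  move=> h; have [/h//|/ltW/h] := leP `|b| `|a|.
  by rewrite distrC (distrC b).
have d0 : 0 <= d%:R :> R by [].
have n0 : 0 <= `|a - b| by [].
rewrite (_ : _ - _ = (a 0 i - b 0 i) * gauss a + b 0 i * (gauss a - gauss b)); last by ring.
rewrite (le_trans (ler_normD _ _))// !normrM.
have h1 : `|a 0 i - b 0 i| * `|gauss a| <= `|a - b|.
  rewrite (ger0_norm (gauss_ge0 a)) (@le_trans _ _ `|a 0 i - b 0 i|)//.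
    by rewrite ler_piMr// gauss_le1.
  by have := norm_coord (a - b) i; rewrite !mxE.
suff h2 : `|b 0 i| * `|gauss a - gauss b| <= (3 * d%:R + 1) * `|a - b| by lra.
have [h|h] := leP `|a| (2 * `|b|); last first.
  have hab : `|b| <= `|a - b|.
    by have := ler_normD (a - b) b; rewrite subrK; lra.
  rewrite (@le_trans _ _ (`|a - b| * 1))//; last by nra.
  rewrite ler_pM// ?(le_trans (norm_coord _ _) hab)//.
  rewrite ler_norml; have := gauss_ge0 a; have := gauss_ge0 b.
  by have := gauss_le1 a; have := gauss_le1 b; move=> *; apply/andP; split; lra.
have := @gauss_diff a b `|b| (normr_ge0 _) ab (lexx _).
have [_ m1] := mul_expRN_sqr (normr_ge0 b).
set e := expR _ in m1 *; have e0 : 0 <= e by exact: expR_ge0.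
move=> g1.
rewrite (@le_trans _ _ (`|b| * (e * (d%:R * `|a - b| * (3 * `|b|)))))//.
  rewrite ler_pM ?norm_coord// (le_trans g1)// ler_wpM2l//.
  by rewrite ler_wpM2l ?mulr_ge0//; lra.
rewrite [leLHS](_ : _ = 3 * d%:R * `|a - b| * (`|b| ^+ 2 * e)); last by ring.
rewrite (@le_trans _ _ (3 * d%:R * `|a - b|))//.
  by rewrite ler_piMr ?mulr_ge0.
by rewrite ler_wpM2r//; lra.
Qed.

(** The inequality e^x >= 1 + x is used from a to a + k for one side, and from a + k back to a for
    the other. The second use evaluates the Gaussian at the wrong point; the discrepancy is
    controlled by [coord_gauss_lip]. *)
Lemma gauss_taylor a k :
  `|gauss (a + k) - gauss a + 2 * dotp a k * gauss a|
    <= (6 * d%:R ^+ 2 + 7 * d%:R) * `|k| ^+ 2.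
Proof.
have d0 : 0 <= d%:R :> R by [].
have n0 : 0 <= `|k| by [].
have qk : dotp k k <= d%:R * `|k| ^+ 2.
  by rewrite expr2 mulrA (le_trans (ler_norm _))// norm_dotp.
have qe : dotp (a + k) (a + k) = dotp a a + 2 * dotp a k + dotp k k.
  by rewrite dotpDl !dotpDr (dotpC k a); ring.
have g0 := gauss_ge0 a; have g0' := gauss_ge0 (a + k).
have g1 := gauss_le1 a; have g1' := gauss_le1 (a + k).
have k0 := dotp_ge0 k.
have lo : gauss a * (1 - 2 * dotp a k - dotp k k) <= gauss (a + k).
  rewrite [leRHS](_ : _ = gauss a * expR (- 2 * dotp a k - dotp k k)).
    by rewrite ler_wpM2l// (le_trans _ (expR_ge1Dx _))//; lra.
  by rewrite -expRD; congr expR; rewrite qe; ring.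
have up : gauss (a + k) * (1 + 2 * dotp a k + dotp k k) <= gauss a.
  rewrite [leRHS](_ : _ = gauss (a + k) * expR (2 * dotp a k + dotp k k)).
    by rewrite ler_wpM2l// (le_trans _ (expR_ge1Dx _))//; lra.
  by rewrite -expRD; congr expR; rewrite qe; ring.
have diff : dotp a k * (gauss a - gauss (a + k)) <= d%:R * (3 * d%:R + 3) * `|k| ^+ 2.
  rewrite (_ : _ * _ = dotp ((gauss a - gauss (a + k)) *: a) k); last first.
    by rewrite dotpZl mulrC.
  rewrite (le_trans (ler_norm _))// (le_trans (norm_dotp _ _))//.
  rewrite expr2 mulrA ler_wpM2r// -mulrA ler_wpM2l//.
  apply: norm_le_coord => [|i]; first by rewrite mulr_ge0//; lra.
  rewrite !mxE (_ : _ * _ = (a 0 i * gauss a - (a + k) 0 i * gauss (a + k))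
     + k 0 i * gauss (a + k)); last by rewrite mxE; ring.
  rewrite (le_trans (ler_normD _ _))//.
  have := coord_gauss_lip i a (a + k).
  rewrite (_ : a - (a + k) = - k) ?normrN => [h1|]; last first.
    by rewrite opprD addrA subrr add0r.
  have : `|k 0 i * gauss (a + k)| <= `|k|.
    rewrite normrM (ger0_norm g0') (@le_trans _ _ `|k 0 i|) ?norm_coord//.
    by rewrite ler_piMr.
  lra.
have p1 : gauss a * dotp k k <= d%:R * `|k| ^+ 2.
  by rewrite (le_trans _ qk)// ler_piMl.
have p2 : 0 <= gauss (a + k) * dotp k k by rewrite mulr_ge0.
have p3 : 0 <= d%:R * `|k| ^+ 2 by rewrite mulr_ge0// sqr_ge0.
have p4 : 0 <= d%:R ^+ 2 * `|k| ^+ 2 by rewrite mulr_ge0// sqr_ge0.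
rewrite ler_norml; apply/andP; split; lra.
Qed.

End gauss.

(** * Integral representation of the Bessel function *)

Section weighted.
Context {R : realType}.
Local Notation mu := (@lebesgue_measure R).

Definition wt (b t : R) : R := expR (b * t - expR t).

Lemma continuous_wt b : continuous (wt b).
Proof.
apply: continuous_expR_comp => t.
by apply: cvgB; [exact: continuous_mull|exact: continuous_expR].
Qed.

Lemma wt_ge0 b t : 0 <= wt b t. Proof. exact: expR_ge0. Qed.

Lemma wint_integrable (b c : R) (f : R -> R) : 0 < b -> continuous f ->
  (forall t, `|f t| <= c * wt b t) -> mu.-integrable [set: R] (EFin \o f).
Proof.
move=> b0 cf h.
apply: (@integrable_le _ _ R mu setT f (fun t => c * wt b t)) => //.
- exact: continuous_measurable_fun.
- apply: integrable_scale => //; exact: integrable_gumbel.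
Qed.

Lemma wint_le (b c : R) (f : R -> R) : 0 < b -> continuous f ->
  (forall t, `|f t| <= c * wt b t) ->
  `|\int[mu]_(t in setT) f t| <= c * \int[mu]_(t in setT) wt b t.
Proof.
move=> b0 cf h; rewrite -RintegralZl//; last exact: integrable_gumbel.
apply: ler_norm_Rintegral => //; first exact: continuous_measurable_fun.
apply: integrable_scale => //; exact: integrable_gumbel.
Qed.

Definition gfac (q t : R) : R := expR (- (expR (- t) / 4) * q).

Lemma continuous_gfac q : continuous (gfac q).
Proof.
apply: continuous_expR_comp => t; apply: cvgM; last exact: cvg_cst.
apply: cvgN; apply: cvgM; last exact: cvg_cst.
apply: (continuous_expR_comp (f := fun t => - t)) => s.
by apply: cvgN; exact: cvg_id.
Qed.

Lemma gfac_ge0 q t : 0 <= gfac q t. Proof. exact: expR_ge0. Qed.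

Lemma gfac_le1 q t : 0 <= q -> gfac q t <= 1.
Proof.
by move=> q0; rewrite -expR0 ler_expR mulNr oppr_le0 mulr_ge0// divr_ge0 ?expR_ge0.
Qed.

Lemma continuous_wgt b q : continuous (fun t => wt b t * gfac q t).
Proof. by move=> t; apply: cvgM; [exact: continuous_wt|exact: continuous_gfac]. Qed.

(** Under u = e^t this is the integral over u > 0 of u^(b - 1) exp(-u - q / (4u)), the classical
    form of 2 (r / 2)^b K_b(r) when q = r^2. *)
Definition wint (b q : R) : R := \int[mu]_(t in setT) (wt b t * gfac q t).

Lemma wgt_le b q t : 0 <= q -> `|wt b t * gfac q t| <= 1 * wt b t.
Proof.
have w0 := wt_ge0 b t; move=> q0; rewrite ger0_norm; last first.
  by apply: mulr_ge0 => //; exact: gfac_ge0.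
rewrite mul1r.
by rewrite ler_piMr ?wt_ge0// gfac_le1.
Qed.

Lemma cosh_ge0 (t : R) : 0 <= cosh t.
Proof. by apply: divr_ge0 => //; apply: addr_ge0; exact: expR_ge0. Qed.

(** By parity, twice the Bessel integral is the integral over the whole line of exp(-r cosh t + nu
    t). Translating t by ln(r / 2) turns r cosh t into e^t + (r^2 / 4) e^(-t), at the price of the
    factor (r / 2)^(-nu). *)
Lemma besselK_wint (nu r : R) : 0 < nu -> 0 < r ->
  r `^ nu * besselK (- nu) r = 2 `^ nu / 2 * wint nu (r ^+ 2).
Proof.
move=> nu0 r0.
pose h t := expR (- r * cosh t + nu * t).
have ch : continuous h.
  apply: continuous_expR_comp => t; apply: cvgD; last exact: continuous_mull.
  apply: cvgM; first exact: cvg_cst.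
  apply: cvgM; last exact: cvg_cst.
  apply: cvgD; first exact: continuous_expR.
  apply: (continuous_expR_comp (f := fun t => - t)) => s.
  by apply: cvgN; exact: cvg_id.
have h0 t : 0 <= h t by exact: expR_ge0.
have mh : measurable_fun [set: R] (EFin \o h).
  by apply/measurable_EFinP; exact: continuous_measurable_fun.
have iNy : (\int[mu]_(x in `]-oo, 0%R]) (h x)%:E =
            \int[mu]_(x in `[0%R, +oo[) (h (- x))%:E)%E.
  rewrite -{1}oppr0 ge0_integration_by_substitutionNy//.
  exact: continuous_subspaceT.
have chN : continuous (fun t => h (- t)).
  by move=> t; apply: (cvg_comp (fun t => - t) h); [apply: cvgN; exact: cvg_id|exact: ch].
have iT : (\int[mu]_x (h x)%:E =
  \int[mu]_(x in `[0%R, +oo[) (2 * (expR (- r * cosh x) * cosh (- nu * x)))%:E)%E.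
  rewrite -(set_itvNyy R) (@itv_bndbnd_setU _ _ _ (BRight 0))//.
  rewrite ge0_integral_setU//=; last 3 first.
  - by apply: measurable_funTS.
  - by move=> x _; rewrite lee_fin.
  - apply/disj_setPS => x [] /=; rewrite !in_itv/= andbT => h1 h2.
    by move: h2; rewrite ltNge h1.
  rewrite iNy integral_itv_obnd_cbnd//; last first.
    by apply: measurable_funTS.
  rewrite -ge0_integralD//; last 4 first.
  - by move=> x _; rewrite lee_fin.
  - by apply: measurable_funTS; apply/measurable_EFinP; exact: continuous_measurable_fun.
  - by move=> x _; rewrite lee_fin.
  - by apply: measurable_funTS.
  apply: eq_integral => x _; rewrite -EFinD; congr EFin.
  rewrite /h /cosh opprK [expR (- x) + expR x]addrC !expRD; set a := expR (- r * _).
  rewrite !mulrN !mulNr opprK.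
  by field.
have lnr : expR (ln (r / 2)) = r / 2 by rewrite lnK// posrE divr_gt0.
pose C := expR (- nu * ln (r / 2)).
have hk x : h (x - ln (r / 2)) = C * (wt nu x * gfac (r ^+ 2) x).
  rewrite /h /C /wt /gfac -!expRD; congr expR; rewrite /cosh.
  rewrite opprB !expRD expRN lnr; field.
  by rewrite gt_eqF.
have iw : mu.-integrable [set: R] (EFin \o (fun t => wt nu t * gfac (r ^+ 2) t)).
  apply: (@wint_integrable nu 1) => //; first exact: continuous_wgt.
  by move=> t; apply: wgt_le; exact: sqr_ge0.
have eCh : ((C * wint nu (r ^+ 2))%:E = \int[mu]_x (h x)%:E)%E.
  rewrite (integral_shift (- ln (r / 2)) ch h0) -RintegralZl// EFin_Rintegral//.
    by apply: eq_integral => x _; rewrite hk.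
  exact: integrable_scale.
have iB : (2%:E * \int[mu]_(x in `[0%R, +oo[)
    (expR (- r * cosh x) * cosh (- nu * x))%:E = (C * wint nu (r ^+ 2))%:E)%E.
  rewrite -ge0_integralZl//; last first.
  - by move=> x _; rewrite lee_fin mulr_ge0 ?expR_ge0// cosh_ge0.
  - apply: measurable_funTS; apply/measurable_EFinP.
    apply: continuous_measurable_fun => t; apply: cvgM.
      apply: (continuous_expR_comp (f := fun x => - r * cosh x)) => s.
      apply: cvgM; first exact: cvg_cst.
      apply: cvgM; last exact: cvg_cst.
      apply: cvgD; first exact: continuous_expR.
      apply: (continuous_expR_comp (f := fun t => - t)) => u.
      by apply: cvgN; exact: cvg_id.
    apply: cvgM; last exact: cvg_cst.
    apply: cvgD; first by apply: continuous_expR_comp; exact: continuous_mull.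
    apply: (continuous_expR_comp (f := fun s => - (- nu * s))) => s.
    by apply: cvgN; exact: continuous_mull.
  by rewrite eCh iT.
have eC : C * r `^ nu = 2 `^ nu.
  rewrite /C /powR gt_eqF// [in RHS]gt_eqF// -expRD; congr expR.
  rewrite lnM ?posrE ?invr_gt0// lnV ?posrE//; ring.
rewrite /besselK /Rintegral.
move: iB; set I := (\int[mu]_(x in _) _)%E.
have I0 : (0 <= I)%E.
  by apply: integral_ge0 => x _; rewrite lee_fin mulr_ge0 ?expR_ge0// cosh_ge0.
(* An infinite Bessel integral is excluded, since its double has just been computed as a real
   number. *)
case: I I0 => [s _ [] e2|_|//]; last by rewrite mulry gtr0_sg// mul1e.
have -> : fine s%:E = s by [].
have -> : s = C * wint nu (r ^+ 2) / 2 by lra.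
by rewrite -eC; move: (wint _ _) => w; field.
Qed.

End weighted.

(** * Bounds on the Matern profile and its gradient *)

Section matern.
Context {R : realType} {d : nat}.
Local Notation E := 'rV[R]_d.
Local Notation mu := (@lebesgue_measure R).
Variables (nu : R) (Sigma : 'M[R]_d).
Hypothesis nu_gt1 : 1 < nu.
Implicit Types w z h : E.

Let nu_gt0 : 0 < nu. Proof. exact: lt_trans ltr01 nu_gt1. Qed.

Definition matern_cst : R :=
  2 `^ (1 - (d%:R / 2 + nu)) / Gamma (d%:R / 2 + nu) * (2 `^ nu / 2).

Definition lin z : E := (Sigma *m z^T)^T.

Lemma linD z h : lin (z + h) = lin z + lin h.
Proof. by rewrite /lin linearD mulmxDr linearD. Qed.

Lemma linZ (a : R) z : lin (a *: z) = a *: lin z.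
Proof. by rewrite /lin linearZ -scalemxAr linearZ. Qed.

Lemma linB z h : lin (z - h) = lin z - lin h.
Proof. by rewrite -scaleN1r linD linZ scaleN1r. Qed.

Definition lin_cst : R := \sum_(i < d) \sum_(j < d) `|Sigma i j|.

Lemma lin_cst_ge0 : 0 <= lin_cst.
Proof. by apply: sumr_ge0 => i _; apply: sumr_ge0. Qed.

Lemma norm_lin z : `|lin z| <= lin_cst * `|z|.
Proof.
apply: norm_le_coord => [|i]; first by rewrite mulr_ge0// lin_cst_ge0.
have -> : lin z 0 i = \sum_j Sigma i j * z 0 j.
  by rewrite !mxE; apply: eq_bigr => j _; rewrite mxE.
apply: (@le_trans _ _ ((\sum_j `|Sigma i j|) * `|z|)); last first.
  rewrite ler_wpM2r// /lin_cst [leRHS](bigD1 i)//= lerDl.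
  by apply: sumr_ge0 => j _; apply: sumr_ge0.
rewrite mulr_suml (le_trans (ler_norm_sum _ _ _))// ler_sum// => j _.
by rewrite normrM ler_wpM2l// norm_coord.
Qed.

(** From 1 - e^(-t) q / 4 <= [gfac q t] <= 1: the factor e^(-t) lowers the exponent of the weight to
    nu - 1, which is still positive. *)
Lemma wint_lip0 (q : R) : 0 <= q ->
  `|wint nu q - wint nu 0| <= q / 4 * \int[mu]_(t in setT) wt (nu - 1) t.
Proof.
move=> q0; have nu1 : 0 < nu - 1 by rewrite subr_gt0.
have iw q' : 0 <= q' -> mu.-integrable [set: R] (EFin \o (fun t => wt nu t * gfac q' t)).
  move=> q'0; apply: (@wint_integrable _ nu 1) => //; first exact: continuous_wgt.
  by move=> t; apply: wgt_le.
rewrite /wint -RintegralB//; [|exact: iw|exact: iw].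
apply: wint_le => // [t|t].
  by apply: cvgB; exact: continuous_wgt.
rewrite -mulrBr normrM (ger0_norm (wt_ge0 _ _)) distrC.
have -> : gfac 0 t = 1 by rewrite /gfac mulr0 expR0.
have g1 := gfac_le1 t q0; rewrite ger0_norm ?subr_ge0//.
have g2 : 1 - expR (- t) / 4 * q <= gfac q t.
  by rewrite /gfac mulNr expR_ge1Dx.
rewrite (@le_trans _ _ (wt nu t * (expR (- t) / 4 * q)))//.
  by rewrite ler_wpM2l ?wt_ge0//; lra.
rewrite (_ : wt (nu - 1) t = wt nu t * expR (- t)); first by lra.
by rewrite /wt -expRD; congr expR; ring.
Qed.

Lemma matern_profileE (r : R) : 0 < r ->
  matern_profile d nu r = matern_cst * wint nu (r ^+ 2).
Proof.
by move=> r0; rewrite /matern_profile /matern_cst -[RHS]mulrA -besselK_wint// mulrA.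
Qed.

(** The value of [Psi] at 0 is a limit from the right; continuity of the mixture integral at q = 0
    makes one formula valid at every point. *)
Lemma PsiE z : Psi nu Sigma z = matern_cst * wint nu (dotp (lin z) (lin z)).
Proof.
rewrite /Psi -/(lin z).
have e2 : enorm (lin z) ^+ 2 = dotp (lin z) (lin z) by rewrite sqr_sqrtr// dotp_ge0.
case: eqP => r0; last first.
  rewrite matern_profileE ?e2// lt_neqAle sqrtr_ge0 andbT eq_sym; exact/eqP.
rewrite -e2 r0 expr0n/=; apply: cvg_lim => //.
apply: (@cvg_trans _ ((fun s => matern_cst * wint nu (s ^+ 2)) x @[x --> 0^'+])).
  apply: near_eq_cvg; near=> s.
  have s0 : 0 < s by near: s; exact: nbhs_right_gt.
  by rewrite matern_profileE.
apply: cvgM; first exact: cvg_cst.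
apply/cvgrPdist_le => /= e e0.
pose W := \int[mu]_(t in setT) wt (nu - 1) t.
have W0 : 0 <= W by apply: Rintegral_ge0 => t _; exact: wt_ge0.
near=> s.
have s0 : 0 < s by near: s; exact: nbhs_right_gt.
have s1 : s < 1 by near: s; exact: nbhs_right_lt.
have s2 : s < e / (W + 1).
  by near: s; apply: nbhs_right_lt; rewrite divr_gt0// ltr_wpDl.
rewrite distrC (le_trans (wint_lip0 (sqr_ge0 s)))// -/W.
move: s2; rewrite ltr_pdivlMr ?ltr_wpDl// => s2.
have : s ^+ 2 <= s by nra.
by nra.
Unshelve. all: by end_near. Qed.

(** Scale of the Gaussian with mixing parameter t: [gfac] at the squared length of w is
    [gauss (sc t *: w)]. Each factor [sc t] lowers the exponent of the weight by 1/2, so a Lipschitz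
    bound on the gradient costs 1 in total, whence nu > 1. *)
Let sc t : R := expR (- t / 2) / 2.

Let scE t : sc t ^+ 2 = expR (- t) / 4.
Proof.
rewrite /sc expr_div_n -expRM_natl (_ : 2%:R * (- t / 2) = - t); last by field.
by congr (_ / _); ring.
Qed.

Let sc_ge0 t : 0 <= sc t. Proof. by rewrite divr_ge0// expR_ge0. Qed.

Let gfacE w t : gfac (dotp w w) t = gauss (sc t *: w).
Proof. by rewrite /gfac /gauss dotpZl dotpZr mulrA -expr2 scE mulNr. Qed.

Let wt_sc t : wt nu t * sc t = wt (nu - 1 / 2) t / 2.
Proof. by rewrite /wt /sc mulrA -expRD; congr (expR _ / _); lra. Qed.

Let wt_sc2 t : wt nu t * sc t ^+ 2 = wt (nu - 1) t / 4.
Proof. by rewrite scE /wt mulrA -expRD; congr (expR _ / _); lra. Qed.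

Let wgt_int b w : 0 < b -> mu.-integrable [set: R]
  (EFin \o (fun t => wt b t * gfac (dotp w w) t)).
Proof.
move=> b0; apply: (@wint_integrable _ b 1) => //; first exact: continuous_wgt.
by move=> t; apply: wgt_le; exact: dotp_ge0.
Qed.

Lemma Psi_bounded : exists c, forall z, `|Psi nu Sigma z| <= c.
Proof.
exists (`|matern_cst| * (1 * \int[mu]_(t in setT) wt nu t)) => z.
rewrite PsiE normrM ler_wpM2l// wint_le//; first exact: continuous_wgt.
by move=> t; apply: wgt_le; exact: dotp_ge0.
Qed.

Lemma Psi_lip : exists c, lip c (Psi nu Sigma : E -> R).
Proof.
pose W := \int[mu]_(t in setT) wt (nu - 1 / 2) t.
exists (`|matern_cst| * ((3 * d%:R + 2) * lin_cst / 2 * W)) => z z'.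
rewrite !PsiE -mulrBr normrM -[leRHS]mulrA ler_wpM2l//.
rewrite /wint -RintegralB//; [|exact: wgt_int|exact: wgt_int].
rewrite mulrAC; apply: wint_le => [|t|t]; first by have := nu_gt1; lra.
  by apply: cvgB; exact: continuous_wgt.
rewrite -mulrBr normrM (ger0_norm (wt_ge0 _ _)) !gfacE.
rewrite (@le_trans _ _ (wt nu t * ((3 * d%:R + 2) * (sc t * (lin_cst * `|z - z'|)))))//.
  rewrite ler_wpM2l ?wt_ge0// (le_trans (gauss_lip _ _))// ler_wpM2l ?addr_ge0 ?mulr_ge0//.
  by rewrite -scalerBr normrZ (ger0_norm (sc_ge0 _)) ler_wpM2l// -linB norm_lin.
apply: le_of_eq.
rewrite [LHS](_ : _ = wt nu t * sc t * ((3 * d%:R + 2) * lin_cst * `|z - z'|)).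
  by rewrite wt_sc; field.
by ring.
Qed.

(** Differentiating the Gaussian under the integral brings down -2 [sc t]^2; since [sc t]^2 is
    e^(-t) / 4, the weight takes the exponent nu - 1 and the factor -1/2 remains. *)
Definition dPsi (i : 'I_d) z : R := - (matern_cst / 2) *
  (dotp (lin z) (lin (evec i)) * wint (nu - 1) (dotp (lin z) (lin z))).

Let norm_lin_evec (i : 'I_d) : `|lin (evec i)| <= lin_cst.
Proof.
by rewrite (le_trans (norm_lin _))// ler_piMr ?lin_cst_ge0// norm_evec.
Qed.

Lemma Psi_taylor : exists c, forall i, taylor i (Psi nu Sigma) (dPsi i) c.
Proof.
pose W := \int[mu]_(t in setT) wt (nu - 1) t.
have nu1 : 0 < nu - 1 by rewrite subr_gt0.
pose C : R := 6 * d%:R ^+ 2 + 7 * d%:R.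
have C0 : 0 <= C by rewrite addr_ge0 ?mulr_ge0 ?sqr_ge0.
exists (`|matern_cst| * (C * lin_cst ^+ 2 / 4 * W)) => i z k.
rewrite !PsiE /dPsi linD linZ; set a := lin z; set e := lin (evec i).
rewrite (_ : _ - _ = matern_cst * ((wint nu (dotp (a + k *: e) (a + k *: e))
   - wint nu (dotp a a)) + k / 2 * dotp a e * wint (nu - 1) (dotp a a))); last first.
  move: (wint (nu - 1) _) (wint nu _) (wint nu (dotp a a)) => ? ? ?.
  by move: (dotp a e) => ?; field.
rewrite normrM -[leRHS]mulrA ler_wpM2l//.
rewrite /wint -RintegralB//; [|exact: wgt_int|exact: wgt_int].
rewrite -RintegralZl//; last exact: wgt_int.
rewrite -RintegralD//; last 2 first.
- apply: (@wint_integrable _ nu 2) => // [t|t].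
    by apply: cvgB; exact: continuous_wgt.
  rewrite (le_trans (ler_normB _ _))// mulrDl lerD//; apply: wgt_le; exact: dotp_ge0.
- apply: (@wint_integrable _ (nu - 1) `|k / 2 * dotp a e|) => // [t|t].
    by apply: cvgM; [exact: cvg_cst|exact: continuous_wgt].
  by rewrite normrM ler_wpM2l// -[leRHS]mul1r; apply: wgt_le; exact: dotp_ge0.
rewrite [leRHS]mulrAC; apply: wint_le => // [t|t].
  apply: cvgD; first by apply: cvgB; exact: continuous_wgt.
  by apply: cvgM; [exact: cvg_cst|exact: continuous_wgt].
rewrite !gfacE.
rewrite (_ : _ + _ = wt nu t * (gauss (sc t *: a + (sc t * k) *: e) - gauss (sc t *: a)
   + 2 * dotp (sc t *: a) ((sc t * k) *: e) * gauss (sc t *: a))); last first.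
  rewrite scalerDr scalerA dotpZl dotpZr.
  rewrite (_ : wt (nu - 1) t = wt nu t * sc t ^+ 2 * 4); last by rewrite wt_sc2; field.
  by field.
rewrite normrM (ger0_norm (wt_ge0 _ _)).
rewrite (@le_trans _ _ (wt nu t * (C * (sc t ^+ 2 * (lin_cst ^+ 2 * k ^+ 2)))))//.
  rewrite ler_wpM2l ?wt_ge0// (le_trans (gauss_taylor _ _))// ler_wpM2l//.
  rewrite normrZ normrM (ger0_norm (sc_ge0 _)) !exprMn real_normK ?num_real// -mulrA.
  rewrite ler_wpM2l ?sqr_ge0// mulrC ler_wpM2r ?sqr_ge0//.
  rewrite ler_sqr ?nnegrE ?lin_cst_ge0//; exact: norm_lin_evec.
apply: le_of_eq.
rewrite [LHS](_ : _ = wt nu t * sc t ^+ 2 * (C * (lin_cst ^+ 2 * k ^+ 2))).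
  by rewrite wt_sc2; field.
by ring.
Qed.

Lemma dPsi_lip : exists c, forall i, lip c (dPsi i : E -> R).
Proof.
pose W := \int[mu]_(t in setT) wt (nu - 1) t.
have nu1 : 0 < nu - 1 by rewrite subr_gt0.
pose C : R := d%:R * (3 * d%:R + 2).
have C0 : 0 <= C by rewrite mulr_ge0// addr_ge0// mulr_ge0.
exists (`|matern_cst / 2| * (C * lin_cst ^+ 2 * W)) => i z z'.
rewrite /dPsi -mulrBr normrM normrN -[leRHS]mulrA ler_wpM2l//.
set a := lin z; set b := lin z'; set e := lin (evec i).
have iz w := wgt_int w nu1.
rewrite /wint -(RintegralZl (dotp a e) measurableT (iz a)).
rewrite -(RintegralZl (dotp b e) measurableT (iz b)).
rewrite -RintegralB//; last 2 first.
- apply: (@wint_integrable _ (nu - 1) `|dotp a e|) => // [t|t].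
    by apply: cvgM; [exact: cvg_cst|exact: continuous_wgt].
  by rewrite normrM ler_wpM2l// -[leRHS]mul1r; apply: wgt_le; exact: dotp_ge0.
- apply: (@wint_integrable _ (nu - 1) `|dotp b e|) => // [t|t].
    by apply: cvgM; [exact: cvg_cst|exact: continuous_wgt].
  by rewrite normrM ler_wpM2l// -[leRHS]mul1r; apply: wgt_le; exact: dotp_ge0.
rewrite mulrAC; apply: wint_le => // [t|t].
  by apply: cvgB; apply: cvgM; [exact: cvg_cst|exact: continuous_wgt|exact: cvg_cst|exact:
    continuous_wgt].
rewrite mulrCA [X in _ - X]mulrCA -mulrBr normrM (ger0_norm (wt_ge0 _ _)) [leRHS]mulrC.
rewrite ler_wpM2l ?wt_ge0// !gfacE.
rewrite (_ : _ - _ = dotp (gauss (sc t *: a) *: a - gauss (sc t *: b) *: b) e); last first.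
  by rewrite -(scaleN1r (_ *: b)) dotpDl !dotpZl; ring.
rewrite (le_trans (norm_dotp _ _))// -!mulrA ler_wpM2l//.
rewrite (_ : _ * (_ * _) = (3 * d%:R + 2) * (lin_cst * `|z - z'|) * lin_cst); last by ring.
have ne : `|e| <= lin_cst := norm_lin_evec i.
have nab : `|a - b| <= lin_cst * `|z - z'| by rewrite -linB norm_lin.
clearbody a b; rewrite ler_pM//.
apply: norm_le_coord => [|j].
  by rewrite mulr_ge0 ?addr_ge0 ?mulr_ge0// lin_cst_ge0.
have s0 : 0 < sc t by rewrite divr_gt0// expR_gt0.
(* Multiplying by [sc t] makes the vector outside the Gaussian the same as its argument, which is
   the situation of [coord_gauss_lip]. *)
rewrite -(ler_pM2l s0) -{1}(gtr0_norm s0) -normrM !mxE mulrBr.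
have := coord_gauss_lip j (sc t *: a) (sc t *: b).
rewrite !mxE -scalerBr normrZ (gtr0_norm s0) => h.
rewrite (_ : _ - _ = sc t * a 0 j * gauss (sc t *: a) - sc t * b 0 j * gauss (sc t *: b)).
  by rewrite (le_trans h)// mulrCA ler_wpM2l ?(ltW s0)// ler_wpM2l// addr_ge0 ?mulr_ge0.
by ring.
Qed.

Lemma dPsi0 i : dPsi i 0 = 0.
Proof. by rewrite /dPsi -[in lin 0](scale0r (0 : E)) linZ scale0r /dotp big1 ?mul0r
    ?mulr0// => j _; rewrite mxE mul0r. Qed.

End matern.

(** * Sewing *)

Section geometric_limit.
Context {R : realType} {d : nat}.

(** Each coordinate of the limit is the supremum of the lower bounds u_j - 2C / 2^j, all of which
    lie below every upper bound u_k + 2C / 2^k. *)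
Lemma geom_limit (u : nat -> 'rV[R]_d) (C : R) : 0 <= C ->
  (forall j, `|u j.+1 - u j| <= C / 2 ^+ j) ->
  exists x, forall j, `|x - u j| <= 2 * C / 2 ^+ j.
Proof.
move=> C0 h.
have p2 j : 0 < 2 ^+ j :> R by rewrite exprn_gt0.
have step j k : `|u (j + k)%N - u j| <= 2 * C / 2 ^+ j.
  suff : `|u (j + k)%N - u j| <= 2 * C / 2 ^+ j - 2 * C / 2 ^+ (j + k).
    by move=> /le_trans; apply; rewrite gerBl divr_ge0 ?mulr_ge0// ltW.
  elim: k => [|k IH]; first by rewrite addn0 !subrr normr0.
  rewrite -(subrK (u (j + k)%N) (u (j + k.+1)%N)) -addrA.
  rewrite (le_trans (ler_normD _ _))// addnS.
  rewrite (le_trans (lerD (h _) IH))// exprS invfM.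
  by move: ((2 ^+ (j + k))^-1) (_ / 2 ^+ j) => Q a; lra.
have both j k : `|u k - u j| <= 2 * C / 2 ^+ j + 2 * C / 2 ^+ k.
  have q n : 0 <= 2 * C / 2 ^+ n by rewrite divr_ge0 ?mulr_ge0// ltW.
  have [jk|kj] := leqP j k.
    by rewrite -(subnKC jk) (le_trans (step _ _))// lerDl.
  by rewrite distrC -(subnKC (ltnW kj)) (le_trans (step _ _))// lerDr.
pose S i := [set u j 0 i - 2 * C / 2 ^+ j | j in [set: nat]].
have Sub i j : ubound (S i) (u j 0 i + 2 * C / 2 ^+ j).
  move=> _ [k _ <-]; have := le_trans (norm_coord (u k - u j) i) (both j k).
  by rewrite !mxE => /ler_normlW; lra.
exists (\row_i sup (S i)) => j.
apply: norm_le_coord => [|i]; first by rewrite divr_ge0 ?mulr_ge0// ltW.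
rewrite !mxE ler_norml; apply/andP; split.
  rewrite lerBrDl; apply: ub_le_sup; last by exists j.
  by exists (u 0%N 0 i + 2 * C / 2 ^+ 0); exact: Sub.
rewrite lerBlDl; apply: ge_sup; last exact: Sub.
by exists (u 0%N 0 i - 2 * C / 2 ^+ 0); exists 0%N.
Qed.

End geometric_limit.

Section sewing.
Context {R : realType} {d : nat}.
Local Notation E := 'rV[R]_d.
Variables (F : R -> R -> E -> E) (M c K : R).
Hypotheses (c_ge0 : 0 <= c) (K_ge0 : 0 <= K).
Hypothesis F_lip : forall s t, 0 <= s -> s <= t -> t <= M ->
  lip (expR (c * (t - s))) (F s t).
Hypothesis F_growth : forall s t, 0 <= s -> s <= t -> t <= M ->
  forall x, 1 + `|F s t x| <= expR (c * (t - s)) * (1 + `|x|).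
Hypothesis F_defect : forall s r t, 0 <= s -> s <= r -> r <= t -> t <= M ->
  forall x, `|F r t (F s r x) - F s t x| <= K * (1 + `|x|) * (t - s) ^+ 2.

Fixpoint dyadic (j : nat) (s t : R) : E -> E :=
  if j is j'.+1 then dyadic j' ((s + t) / 2) t \o dyadic j' s ((s + t) / 2)
  else F s t.

Lemma dyadic_lip j s t : 0 <= s -> s <= t -> t <= M ->
  lip (expR (c * (t - s))) (dyadic j s t).
Proof.
elim: j s t => [|j IH] s t s0 st tM /=; first exact: F_lip.
move=> x y /=; set m := (s + t) / 2.
apply: (le_trans (IH m t _ _ _ _ _)); rewrite /m; try lra.
rewrite (_ : c * (t - s) = c * (t - m) + c * (m - s)); last by ring.
rewrite expRD -mulrA ler_wpM2l ?expR_ge0//.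
by apply: IH => //; rewrite /m; lra.
Qed.

Lemma dyadic_growth j s t : 0 <= s -> s <= t -> t <= M ->
  forall x, 1 + `|dyadic j s t x| <= expR (c * (t - s)) * (1 + `|x|).
Proof.
elim: j s t => [|j IH] s t s0 st tM x /=; first exact: F_growth.
set m := (s + t) / 2.
apply: (le_trans (IH m t _ _ _ _)); rewrite /m; try lra.
rewrite (_ : c * (t - s) = c * (t - m) + c * (m - s)); last by ring.
rewrite expRD -mulrA ler_wpM2l ?expR_ge0//.
by apply: IH => //; rewrite /m; lra.
Qed.

(** Refining both halves of [s, t] makes two errors, each four times smaller because the defect is
    quadratic: the total is halved at each level. The error of the first half is transported through
    the second by its Lipschitz bound, and the growth bound controls the point from which the second
    half starts. *)
Lemma dyadic_diff j s t : 0 <= s -> s <= t -> t <= M -> forall x,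
  `|dyadic j.+1 s t x - dyadic j s t x|
    <= K * expR (c * (t - s)) * (t - s) ^+ 2 * (1 + `|x|) / 2 ^+ j.
Proof.
elim: j s t => [|j IH] s t s0 st tM x.
  rewrite /= expr0 divr1 (le_trans (F_defect _ _ _ _ _))//; try lra.
  rewrite mulrAC ler_wpM2r ?addr_ge0// ler_wpM2r ?sqr_ge0// ler_peMr//.
  by rewrite -expR0 ler_expR mulr_ge0// subr_ge0.
set m := (s + t) / 2.
have sm : s <= m by rewrite /m; lra.
have mt : m <= t by rewrite /m; lra.
have m0 : 0 <= m by exact: le_trans sm.
have mM : m <= M by exact: le_trans tM.
have ms : m - s = (t - s) / 2 by rewrite /m; field.
have tm : t - m = (t - s) / 2 by rewrite /m; field.
set e := expR (c * ((t - s) / 2)).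
have e0 : 0 <= e by exact: expR_ge0.
have ee : expR (c * (t - s)) = e * e.
  by rewrite -expRD; congr expR; field.
rewrite -[dyadic j.+2 s t x]/(dyadic j.+1 m t (dyadic j.+1 s m x)).
rewrite -[dyadic j.+1 s t x]/(dyadic j m t (dyadic j s m x)).
set y := dyadic j.+1 s m x; set z := dyadic j s m x.
have h1 := IH m t m0 mt tM y; rewrite tm -/e in h1.
have h2 := IH s m s0 sm mM x; rewrite ms -/e -/y -/z in h2.
have h3 := dyadic_lip j m0 mt tM y z; rewrite tm -/e in h3.
have h4 := dyadic_growth j.+1 s0 sm mM x; rewrite ms -/e -/y in h4.
rewrite -(subrK (dyadic j m t y) (dyadic j.+1 m t y)) -addrA.
rewrite (le_trans (ler_normD _ _))// (le_trans (lerD h1 h3))//.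
have p2 : 0 < 2 ^+ j :> R by rewrite exprn_gt0.
pose A := K * e * ((t - s) / 2) ^+ 2 / 2 ^+ j.
have A0 : 0 <= A.
  by rewrite /A divr_ge0 ?(ltW p2)// mulr_ge0 ?sqr_ge0// mulr_ge0.
have h5 : A * (1 + `|y|) <= A * (e * (1 + `|x|)) by rewrite ler_wpM2l.
have h6 := ler_wpM2l e0 h2.
rewrite (_ : K * e * ((t - s) / 2) ^+ 2 * (1 + `|y|) / 2 ^+ j = A * (1 + `|y|)); last first.
  by rewrite /A; field; rewrite gt_eqF.
rewrite (_ : K * e * _ * _ / _ = A * (1 + `|x|)) in h6; last first.
  by rewrite /A; field; rewrite gt_eqF.
rewrite (le_trans (lerD h5 h6))// ee [2 ^+ j.+1]exprS /A.
by apply: le_of_eq; field; rewrite gt_eqF.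
Qed.

Lemma sewing s t : 0 <= s -> s <= t -> t <= M ->
  exists X : E -> E, [/\ lip (expR (c * (t - s))) X &
    forall j x, `|X x - dyadic j s t x|
      <= 2 * (K * expR (c * (t - s)) * (t - s) ^+ 2 * (1 + `|x|)) / 2 ^+ j].
Proof.
move=> s0 st tM; pose C (x : E) := K * expR (c * (t - s)) * (t - s) ^+ 2 * (1 + `|x|).
have C0 x : 0 <= C x.
  rewrite /C; apply: mulr_ge0; last by rewrite addr_ge0.
  by rewrite mulr_ge0 ?sqr_ge0// mulr_ge0 ?expR_ge0.
have ex x := geom_limit (C0 x) (fun j => dyadic_diff j s0 st tM x).
have [X XP] := choice ex.
exists X; split => // x y; apply/ler_addgt0Pr => e e0.
pose B := 2 * C x + 2 * C y.
have [j jB] : exists j, B / 2 ^+ j <= e.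
  exists (Num.bound (B / e)).
  have p2 : 0 < 2 ^+ (Num.bound (B / e)) :> R by rewrite exprn_gt0.
  rewrite ler_pdivrMr// mulrC -ler_pdivrMr//.
  have B0 : 0 <= B by apply: addr_ge0; apply: mulr_ge0.
  rewrite (le_trans (ltW (archi_boundP _)))//; first by rewrite divr_ge0// ltW.
  by rewrite -natrX ler_nat ltnW// ltn_expl.
have := XP x j; have := XP y j; rewrite -/(C x) -/(C y) => hy hx.
have hl := dyadic_lip j s0 st tM x y.
rewrite (_ : X x - X y = (X x - dyadic j s t x) + (dyadic j s t x - dyadic j s t y)
   - (X y - dyadic j s t y)); last first.
  by apply/rowP => i; rewrite !mxE; ring.
rewrite (le_trans (ler_normB _ _))// (le_trans (lerD (ler_normD _ _) (lexx _)))//.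
have : B / 2 ^+ j = 2 * C x / 2 ^+ j + 2 * C y / 2 ^+ j by rewrite /B mulrDl.
by lra.
Qed.

End sewing.

(** * Weak solutions *)

Section probability_kernel.
Context d d' (X : measurableType d) (Y : measurableType d') (R : realType).
Variable P : X -> probability Y R.
Hypothesis mP : forall U, measurable U -> measurable_fun [set: X] (fun x => P x U).

(** The measurability proof is an argument so that the kernel structure can be attached to this
    alias. *)
Definition prob_family (_ : forall U, measurable U ->
  measurable_fun [set: X] (fun x => P x U)) : X -> {measure set Y -> \bar R} := P.

HB.instance Definition _ := @isKernel.Build _ _ X Y R (prob_family mP) mP.

Let prob_family_setT x : prob_family mP x [set: Y] = 1%E.
Proof. exact: probability_setT. Qed.

HB.instance Definition _ :=
  @Kernel_isProbability.Build _ _ X Y R (prob_family mP) prob_family_setT.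

Lemma measurable_prob_integral (f : X * Y -> \bar R) :
  (forall z, (0 <= f z)%E) -> measurable_fun [set: X * Y] f ->
  measurable_fun [set: X] (fun x => \int[P x]_y f (x, y))%E.
Proof.
move=> f0 mf.
exact: (@measurable_fun_integral_finite_kernel _ _ X Y R f (prob_family mP) f0 mf).
Qed.

Lemma measurable_prob_Rintegral (f : X * Y -> R) : measurable_fun [set: X * Y] f ->
  measurable_fun [set: X] (fun x => \int[P x]_y f (x, y)).
Proof.
move=> mf; rewrite /Rintegral.
apply: (measurableT_comp (fine_measurable measurableT)) => //.
rewrite (_ : (fun _ => _) = (fun x => \int[P x]_y (maxe (f (x, y))%:E 0) -
   \int[P x]_y (maxe (- (f (x, y))%:E) 0)))%E; last first.
  apply/funext => x; rewrite integralE; congr (_ - _)%E; apply: eq_integral => y _.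
    by rewrite funeposE.
  by rewrite funenegE.
apply: emeasurable_funB.
- apply: (@measurable_prob_integral (fun z => maxe (f z)%:E 0%E)).
    by move=> z; rewrite le_max lexx orbT.
  by apply: measurable_maxe => //; exact/measurable_EFinP.
- apply: (@measurable_prob_integral (fun z => maxe (- (f z)%:E)%E 0%E)).
    by move=> z; rewrite le_max lexx orbT.
  by apply: measurable_maxe => //; apply: measurableT_comp => //; exact/measurable_EFinP.
Qed.

End probability_kernel.

(** * The weak equation for a general field *)

Section weak_equation.
Context {R : realType} {d : nat}.
Local Notation E := 'rV[R]_d.
Local Notation lam := (@lebesgue_measure R).
Variable F : 'I_d -> E -> E -> R.
Implicit Types rho : probability E R.

Definition drift rho (x : E) : E := \row_i \int[rho]_y F i x y.

(** [weak_solution] with the kernel of the field left abstract; for [svgd_field] the two are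
    convertible. *)
Definition weak_eq (mu : R -> probability E R) : Prop :=
  forall phi : E -> R, Cc1 phi -> forall t : R, 0 <= t ->
  let flux s := \int[mu s]_x dotp (grad phi x) (drift (mu s) x) in
  lam.-integrable `[0, t] (EFin \o flux) /\
  \int[mu t]_x phi x =
  \int[mu 0]_x phi x + \int[lam]_(s in `[0, t]) flux s.

Variable mu : R -> probability E R.
Hypothesis mu_weak : weak_eq mu.
(** Freezing the curve before time 0 allows measurability in time to be stated on the whole line. It
    is arranged at the end by evaluating the solution at [Num.max 0 t]. *)
Hypothesis mu_neg : forall t, t <= 0 -> mu t = mu 0.

(** On each [0, n] the weak equation writes the integral as a constant plus a primitive of the flux,
    which is continuous; before 0 it is constant. *)
Lemma measurable_weak_Cc1 phi : Cc1 phi ->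
  measurable_fun [set: R] (fun t => \int[mu t]_x phi x).
Proof.
move=> cphi.
rewrite (_ : [set: R] = `]-oo, 0]%classic `|` \bigcup_(n : nat) `[0, n%:R]%classic).
  apply/measurable_funU => //.
    by apply: bigcupT_measurable => n.
  split.
    apply: (@eq_measurable_fun _ _ (measurableTypeR R) (measurableTypeR R) _ (cst (\int[mu
        0]_x phi x))) => // t.
    by rewrite inE/= in_itv/= => /mu_neg ->.
  apply/measurable_fun_bigcup => // n.
  have [iflux _] := mu_weak cphi (ler0n R n).
  set flux := fun s => \int[mu s]_x dotp (grad phi x) (drift (mu s) x).
  apply: (@eq_measurable_fun _ _ (measurableTypeR R) (measurableTypeR R) _ (fun t =>
     \int[mu 0]_x phi x + \int[lam]_(s in `[0, t]) flux s)) => [t|].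
    by rewrite inE/= in_itv/= => /andP[t0 _]; have [_ ->] := mu_weak cphi t0.
  apply: measurable_funD => //.
  apply: subspace_continuous_measurable_fun => //.
  exact: parameterized_integral_continuous.
apply/esym/seteqP; split => // t _; have [t0|t0] := leP t 0; first by left; rewrite /= in_itv.
right; exists (Num.bound t) => //=; rewrite in_itv/= (ltW t0)/= ltW//.
exact: archi_boundP (ltW t0).
Qed.

(** The averages at scale 1/(n+1) are admissible C^1 tests and converge uniformly. *)
Lemma measurable_weak_lipc (L r : R) phi : lipc L r phi ->
  measurable_fun [set: R] (fun t => \int[mu t]_x phi x).
Proof.
move=> Lphi.
have {}Lphi : lipc `|L| r phi.
  split; last exact: Lphi.2.
  by move=> x y; rewrite (le_trans (Lphi.1 x y))// ler_wpM2r// ler_norm.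
pose w n := avgs n.+1%:R^-1 (enum 'I_d) phi.
have e0 n : 0 < n.+1%:R^-1 :> R by rewrite invr_gt0.
have iphi t := lipc_integrable (mu t) Lphi.
have lw n : lipc `|L| (r + (size (enum 'I_d))%:R * n.+1%:R^-1) (w n).
  by apply: lipc_avgs.
have close t n : `|\int[mu t]_x phi x - \int[mu t]_x w n x| <= `|L| * d%:R / n.+1%:R.
  rewrite -RintegralB//; [|exact: iphi|exact: (lipc_integrable _ (lw n))].
  apply: ler_norm_Rintegral_prob.
    by apply: measurable_funB; [exact: lip_measurable Lphi.1|exact: lip_measurable (lw n).1].
  move=> x; rewrite distrC; have := avgs_near (e0 n) (enum 'I_d) x (normr_ge0 L) Lphi.1.
  by rewrite size_enum_ord mulrA.
apply: (@measurable_fun_cvg _ _ _ setT (fun n t => \int[mu t]_x w n x)) => [n|t _].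
  apply: measurable_weak_Cc1.
  by have [p []] := Cc1_avgs (e0 n) (normr_ge0 L) Lphi.
apply/cvgrPdist_le => /= e e1; near=> n; rewrite (le_trans (close t n))//.
have C0 : 0 <= `|L| * d%:R by rewrite mulr_ge0.
rewrite ler_pdivrMr// -ler_pdivrMl// mulrC.
rewrite (@le_trans _ _ n%:R) ?ler_nat//.
by near: n; exact: nbhs_infty_ger.
Unshelve. all: by end_near. Qed.

Lemma measurable_weak U : measurable U -> measurable_fun [set: R] (fun t => mu t U).
Proof.
move=> mU; apply: (@measurable_family_lipc R d _ (measurableTypeR R) mu) => //.
exact: measurable_weak_lipc.
Qed.

End weak_equation.

(** * Second moments *)

Section second_moment.
Context {R : realType} {d : nat}.
Local Notation E := 'rV[R]_d.

Lemma measurable_norm_rV : measurable_fun [set: E] (fun x : E => `|x|).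
Proof. by apply: continuous_measurable_rV => x; exact: norm_continuous. Qed.

Lemma measurable_dotp d' (T : measurableType d') (f g : T -> E) :
  (forall i, measurable_fun [set: T] (fun t => f t 0 i)) ->
  (forall i, measurable_fun [set: T] (fun t => g t 0 i)) ->
  measurable_fun [set: T] (fun t => dotp (f t) (g t)).
Proof.
by move=> mf mg; apply: measurable_sum => i; exact: measurable_funM.
Qed.

Lemma enorm_sqr (x : E) : enorm x ^+ 2 = dotp x x.
Proof. by rewrite sqr_sqrtr// dotp_ge0. Qed.

Lemma dotp_le_norm (x : E) : dotp x x <= d%:R * `|x| ^+ 2.
Proof. by rewrite (le_trans (ler_norm _))// (le_trans (norm_dotp _ _))// expr2 mulrA. Qed.

Lemma measurable_enorm2 : measurable_fun [set: E] (fun x : E => enorm x ^+ 2).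
Proof.
rewrite (_ : (fun _ => _) = (fun x : E => dotp x x)); last first.
  by apply/funext => x; rewrite enorm_sqr.
by apply: measurable_dotp => i; exact: measurable_coord.
Qed.

Lemma measurable_m2 (mu : R -> probability E R) :
  (forall U, measurable U -> measurable_fun [set: R] (fun t => mu t U)) ->
  measurable_fun [set: R] (fun t => m2 (mu t)).
Proof.
move=> mmu; apply: (measurable_prob_integral mmu (f := fun z => (enorm z.2 ^+ 2)%:E)).
  by move=> z; rewrite lee_fin sqr_ge0.
apply/measurable_EFinP.
exact: (measurableT_comp measurable_enorm2 measurable_snd).
Qed.

Lemma integrable_m2 (rho : probability E R) (c : R) : (1 + m2 rho <= c%:E)%E ->
  rho.-integrable [set: E] (EFin \o (fun y => 1 + `|y| ^+ 2)) /\
  \int[rho]_y (1 + `|y| ^+ 2) <= c.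
Proof.
move=> hc; have m20 : (0 <= m2 rho)%E by apply: integral_ge0 => x _; rewrite lee_fin sqr_ge0.
have nn : measurable_fun [set: E] (fun y : E => 1 + `|y| ^+ 2).
  by apply: measurable_funD => //; apply: measurable_funX; exact: measurable_norm_rV.
have le1 : (\int[rho]_y (1 + `|y| ^+ 2)%:E <= 1 + m2 rho)%E.
  have e1 : (\int[rho]_y (1 + (enorm y ^+ 2)%:E) = 1 + m2 rho)%E.
    rewrite ge0_integralD//.
    - rewrite integral_cst// mul1e; congr (_ + _)%E; exact: probability_setT.
    - by move=> y _; rewrite lee_fin sqr_ge0.
    - by apply/measurable_EFinP; exact: measurable_enorm2.
  rewrite -e1; apply: ge0_le_integral => //.
  - exact/measurable_EFinP.
  - apply: emeasurable_funD => //; apply/measurable_EFinP; exact: measurable_enorm2.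
  - by move=> y _; rewrite -EFinD lee_fin lerD2l enorm_sqr sqr_norm_le_dotp.
have iN : rho.-integrable [set: E] (EFin \o (fun y => 1 + `|y| ^+ 2)).
  apply/integrableP; split; first exact/measurable_EFinP.
  have e2 : (\int[rho]_x `|(EFin \o (fun y : E => (1 + `|y| ^+ 2)%R)) x| =
             \int[rho]_x (1 + `|x| ^+ 2)%:E)%E.
    by apply: eq_integral => y _; rewrite /= ger0_norm// addr_ge0// sqr_ge0.
  by rewrite e2 (le_lt_trans le1)// (le_lt_trans hc)// ltry.
by split => //; rewrite -lee_fin EFin_Rintegral// (le_trans le1).
Qed.

End second_moment.

(** * Images of probabilities and change of variables *)

Section image.
Context d1 d2 (T : measurableType d1) (T' : measurableType d2) (R : realType).

Lemma prob_image (P : probability T R) (f : T -> T') :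
  measurable_fun [set: T] f -> exists Q : probability T' R,
  [/\ forall A, Q A = P (f @^-1` A),
      forall g : T' -> \bar R, measurable_fun setT g -> (forall y, 0 <= g y)%E ->
        (\int[Q]_y g y = \int[P]_x g (f x))%E &
      forall g : T' -> R, measurable_fun setT g ->
        P.-integrable setT (EFin \o (g \o f)) ->
        \int[Q]_y g y = \int[P]_x g (f x)].
Proof.
move=> mf; pose X : {mfun T >-> T'} := HB.pack f (isMeasurableFun.Build _ _ _ _ _ mf).
exists (distribution P X : probability T' R); split => // [g mg g0|g mg ig].
- by rewrite (@ge0_integral_pushforward _ _ _ _ R f mf P setT g).
- rewrite /Rintegral (@integral_pushforward _ _ _ _ R f mf P setT (EFin \o g))//.
  exact/measurable_EFinP.
Qed.

End image.

Section image_integral.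
Context d1 d2 (T : measurableType d1) (T' : measurableType d2) (R : realType).
Variables (P : probability T R) (Q : probability T' R) (f : T -> T').
Hypothesis mf : measurable_fun [set: T] f.
Hypothesis QP : forall A, measurable A -> Q A = P (f @^-1` A).

Lemma image_ge0_integral (g : T' -> \bar R) : measurable_fun setT g ->
  (forall y, 0 <= g y)%E -> (\int[Q]_y g y = \int[P]_x g (f x))%E.
Proof.
move=> mg g0; have [Q' [Q'E Q'int _]] := prob_image P mf.
rewrite -Q'int//; apply: eq_measure_integral => A mA _.
exact: etrans (QP mA) (esym (Q'E A)).
Qed.

Lemma image_integrable (g : T' -> R) : measurable_fun setT g ->
  Q.-integrable setT (EFin \o g) <-> P.-integrable setT (EFin \o (g \o f)).
Proof.
move=> mg; have e : (\int[Q]_y `|(EFin \o g) y| = \int[P]_x `|(EFin \o (g \o f)) x|)%E.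
  rewrite (image_ge0_integral (g := fun y => `|(EFin \o g) y|%E))//.
  by apply: measurableT_comp => //; exact/measurable_EFinP.
split=> /integrableP[_ ig]; apply/integrableP; split.
- by apply/measurable_EFinP; exact: measurableT_comp.
- by rewrite -e.
- exact/measurable_EFinP.
- by rewrite e.
Qed.

Lemma image_Rintegral (g : T' -> R) : measurable_fun setT g ->
  Q.-integrable setT (EFin \o g) -> \int[Q]_y g y = \int[P]_x g (f x).
Proof.
move=> mg /(image_integrable mg) ig; have [Q' [Q'E _ Q'int]] := prob_image P mf.
rewrite -Q'int//; congr fine; apply: eq_measure_integral => A mA _.
exact: etrans (QP mA) (esym (Q'E A)).
Qed.

End image_integral.

Section Rintegral_le.
Context d (T : measurableType d) (R : realType) (P : probability T R).

(** Three terms match the cost of a coupling, bounded by the squared distance and one moment for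
    each marginal; shorter bounds are padded with coefficients 0. *)
Lemma Rintegral_le_comb (f g1 g2 g3 : T -> R) (a1 a2 a3 : R) :
  measurable_fun setT f -> (forall x, 0 <= f x) ->
  P.-integrable setT (EFin \o g1) -> P.-integrable setT (EFin \o g2) ->
  P.-integrable setT (EFin \o g3) ->
  (forall x, f x <= a1 * g1 x + a2 * g2 x + a3 * g3 x) ->
  P.-integrable setT (EFin \o f) /\
  \int[P]_x f x <= a1 * \int[P]_x g1 x + a2 * \int[P]_x g2 x + a3 * \int[P]_x g3 x.
Proof.
move=> mf f0 i1 i2 i3 fg.
have iZ g a : P.-integrable setT (EFin \o g) -> P.-integrable setT (EFin \o (fun x => a * g x)).
  move=> ig; exact: integrable_scale.
have iD g g' : P.-integrable setT (EFin \o g) -> P.-integrable setT (EFin \o g') ->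
    P.-integrable setT (EFin \o (fun x => g x + g' x)).
  move=> ig ig'; rewrite (_ : EFin \o _ = (EFin \o g) \+ (EFin \o g'))%E//; exact: integrableD.
have i12 := iD _ _ (iZ _ a1 i1) (iZ _ a2 i2); have i123 := iD _ _ i12 (iZ _ a3 i3).
have ifn : P.-integrable setT (EFin \o f).
  apply: (@integrable_le _ _ R P setT f (fun x => a1 * g1 x + a2 * g2 x + a3 * g3 x)) => //.
  by move=> x _; rewrite ger0_norm.
split => //; rewrite -!RintegralZl// -!RintegralD//; [|exact: iZ..].
by apply: le_Rintegral => // x _; exact: fg.
Qed.

End Rintegral_le.

(** * The clock and its inverse *)

Section clock.
Context {R : realType}.
Local Notation lam := (@lebesgue_measure R).
Variables (T : R) (h : R -> R).
Hypothesis T_gt0 : 0 < T.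
Hypothesis h_ge1 : forall t, 1 <= h t.
Hypothesis h_int : lam.-integrable `[0, T] (EFin \o h).

Lemma h_ge0 t : 0 <= h t. Proof. exact: le_trans (h_ge1 t). Qed.

Lemma subint s t : 0 <= s -> t <= T -> `]s, t] `<=` `[0, T]%classic.
Proof.
move=> s0 tT x /=; rewrite !in_itv/= => /andP[h1 h2]; apply/andP; split; lra.
Qed.

Lemma h_int_sub s t : 0 <= s -> t <= T -> lam.-integrable `]s, t] (EFin \o h).
Proof. by move=> s0 tT; apply: (@integrableS _ _ _ lam `[0, T]%classic) => //;
    exact: subint. Qed.

Definition clock t : R := \int[lam]_(q in `[0, t]) h q.

Lemma Rintegral_itv_cat (f : R -> R) r s t : r <= s -> s <= t ->
  lam.-integrable `]r, t] (EFin \o f) ->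
  \int[lam]_(q in `]r, t]) f q = \int[lam]_(q in `]r, s]) f q + \int[lam]_(q in `]s, t]) f q.
Proof.
move=> rs st fi.
have e : `]r, t]%classic = `]r, s] `|` `]s, t].
  by rewrite -itv_bndbnd_setU ?bnd_simp.
rewrite e Rintegral_setU// -?e//.
apply/disj_setPS => x [] /=; rewrite !in_itv/= => /andP[_ h1] /andP[h2 _].
by move: h2; rewrite ltNge h1.
Qed.

Lemma Rintegral0t (f : R -> R) t : 0 <= t -> lam.-integrable `[0, t] (EFin \o f) ->
  \int[lam]_(q in `[0, t]) f q = \int[lam]_(q in `]0, t]) f q.
Proof.
move=> t0 fi; rewrite Rintegral_itv_obnd_cbnd//.
by apply: (@integrableS _ _ _ lam `[0, t]%classic) => // x /=;
    rewrite !in_itv/= => /andP[/ltW-> ->].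
Qed.

Lemma clockB s t : 0 <= s -> s <= t -> t <= T ->
  clock t - clock s = \int[lam]_(q in `]s, t]) h q.
Proof.
move=> s0 st tT.
have sub u : u <= T -> lam.-integrable `[0, u] (EFin \o h).
  move=> uT; apply: (@integrableS _ _ _ lam `[0, T]%classic) => // x /=; rewrite !in_itv/=.
  by move=> /andP[-> /le_trans->].
have sT : s <= T by exact: le_trans tT.
have t0 : 0 <= t by exact: le_trans st.
rewrite /clock (Rintegral0t t0 (sub _ tT)) (Rintegral0t s0 (sub _ sT)).
rewrite (@Rintegral_itv_cat h 0 s t)//; first by rewrite addrAC subrr add0r.
exact: h_int_sub.
Qed.

(** Since h >= 1 the clock stretches durations, hence is injective; with its continuity this
    provides the inverse. *)
Lemma clock_ge s t : 0 <= s -> s <= t -> t <= T -> t - s <= clock t - clock s.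
Proof.
move=> s0 st tT; rewrite clockB//.
have -> : t - s = \int[lam]_(q in `]s, t]) (1 : R).
  rewrite Rintegral_cst//= lebesgue_measure_itv/= mul1r lte_fin.
  case: ltP => [_|ts]; first by rewrite -EFinB.
  by rewrite (le_anti (introT andP (conj st ts))) subrr.
apply: le_Rintegral => //; last exact: h_int_sub.
apply: (@integrableS _ _ _ lam `[0, T]%classic) => //; first exact: subint.
by apply: continuous_integrable_itv => ?; exact: cvg_cst.
Qed.

Lemma clock0 : clock 0 = 0.
Proof. by rewrite /clock set_itv1 Rintegral_set1. Qed.

Lemma clock_inv s : 0 <= s <= clock T -> exists t, 0 <= t <= T /\ clock t = s.
Proof.
move=> s01; have c0 := clock0.
have cT : 0 <= clock T by case/andP: s01 => /le_trans/[apply].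
have sv : Num.min (clock 0) (clock T) <= s <= Num.max (clock 0) (clock T).
  by rewrite c0 min_l// max_r.
have [t] := @IVT R clock 0 T s (ltW T_gt0)
  (parameterized_integral_continuous (ltW T_gt0) h_int) sv.
by rewrite in_itv/= => t01 <-; exists t.
Qed.

(* The inverse of the clock; the default value 0 is never used on [0, clock T]. *)
Definition time s : R := xget 0 [set t | 0 <= t <= T /\ clock t = s].

Lemma timeP s : 0 <= s <= clock T -> 0 <= time s <= T /\ clock (time s) = s.
Proof. by move=> /clock_inv[t tP]; rewrite /time; case: xgetP => [x _ //|/(_ t)]. Qed.

Lemma timeK s : 0 <= s -> s <= clock T -> clock (time s) = s.
Proof. by move=> s0 sT; have [|//] := @timeP s; rewrite s0 sT. Qed.

Lemma time_itv s : 0 <= time s <= T.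
Proof.
by rewrite /time; case: xgetP => [x _ []//|_]; rewrite lexx ltW.
Qed.

Lemma clock_mono s t : 0 <= s -> t <= T -> s < t -> clock s < clock t.
Proof.
move=> s0 tT st; rewrite -subr_gt0 (lt_le_trans _ (clock_ge s0 (ltW st) tT))//.
by rewrite subr_gt0.
Qed.

Lemma time_mono s t : 0 <= s -> s <= t -> t <= clock T -> time s <= time t.
Proof.
move=> s0 st tT; rewrite leNgt; apply/negP => ts.
have /andP[_ h1] := time_itv s; have /andP[h2 _] := time_itv t.
have := clock_mono h2 h1 ts; rewrite !timeK//; first by rewrite ltNge st.
- exact: le_trans tT.
- exact: le_trans st.
Qed.

Lemma clockK t : 0 <= t -> t <= T -> time (clock t) = t.
Proof.
move=> t0 tT.
have ct0 : 0 <= clock t by apply: Rintegral_ge0 => q _; exact: h_ge0.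
have ctT : clock t <= clock T.
  by rewrite -subr_ge0 (le_trans _ (clock_ge t0 tT (lexx _)))// subr_ge0.
have := timeK ct0 ctT; have /andP[h1 h2] := time_itv (clock t).
case: (ltgtP (time (clock t)) t) => // tt.
- by have := clock_mono h1 tT tt => + e; rewrite e ltxx.
- by have := clock_mono t0 h2 tt => + e; rewrite e ltxx.
Qed.

End clock.

(** * Finite sums and Fubini for real-valued integrals *)

Section Rintegral_extra.
Context d (T : measurableType d) (R : realType).
Local Notation lam := (@lebesgue_measure R).

Lemma Rintegral_sum (mu : {measure set T -> \bar R}) (D : set T) n
    (f : 'I_n -> T -> R) : measurable D ->
  (forall i, mu.-integrable D (EFin \o f i)) ->
  mu.-integrable D (EFin \o (fun x => \sum_i f i x)) /\
  \int[mu]_(x in D) (\sum_i f i x) = \sum_i \int[mu]_(x in D) f i x.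
Proof.
move=> mD fi.
pose S (l : seq 'I_n) x := \sum_(i <- l) f i x.
suff key l : mu.-integrable D (EFin \o S l) /\
    \int[mu]_(x in D) S l x = \sum_(i <- l) \int[mu]_(x in D) f i x.
  exact: key.
elim: l => [|i l [IH1 IH2]].
  rewrite big_nil (_ : S [::] = cst 0); last by apply/funext => x; rewrite /S big_nil.
  split; first by rewrite (_ : EFin \o _ = cst 0%E)//; exact: integrable0.
  by rewrite Rintegral_cst// mul0r.
have e : S (i :: l) = (fun x => f i x + S l x).
  by apply/funext => x; rewrite /S big_cons.
rewrite e big_cons RintegralD// IH2; split => //.
rewrite (_ : EFin \o _ = (EFin \o f i) \+ (EFin \o S l))%E//.
exact: integrableD.
Qed.

(** Multiplying by the indicator of D moves the problem to the product with the whole line, where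
    domination by a function of time alone gives integrability because P has mass 1. *)
Lemma RFubini (P : probability T R) (D : set R) (f : T -> R -> R) (g : R -> R) :
  measurable D -> measurable_fun [set: T * R] (fun z => f z.1 z.2) ->
  lam.-integrable D (EFin \o g) -> (forall x q, D q -> `|f x q| <= g q) ->
  \int[P]_x \int[lam]_(q in D) f x q = \int[lam]_(q in D) \int[P]_x f x q.
Proof.
move=> mD mf ig fg.
have fi x : lam.-integrable D (EFin \o f x).
  apply: (@integrable_le _ _ R lam D (f x) g) => //; last by move=> q; exact: fg.
  by apply: measurable_funTS; exact: (measurable_fun_pair2 x mf).
have fP q : D q -> P.-integrable setT (EFin \o (fun x => f x q)).
  move=> Dq; apply: (@integrable_prob _ _ _ _ _ (g q)); last by move=> x; exact: fg.
  exact: (measurable_fun_pair1 q mf).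
pose f' (z : T * R) : \bar R := (f z.1 z.2 * \1_D z.2)%:E.
have mf' : measurable_fun setT f'.
  apply/measurable_EFinP; apply: measurable_funM => //.
  by apply: measurableT_comp => //; exact: measurable_snd.
have e1 (h : R -> R) : (\int[lam]_(q in D) (h q)%:E = \int[lam]_q (h q * \1_D q)%:E)%E.
  rewrite integral_mkcond; apply: eq_integral => q _.
  rewrite patchE indicE; case: ifPn => _; first by rewrite mulr1.
  by rewrite mulr0.
have if' : (P \x lam)%E.-integrable setT f'.
  apply/(integrable12ltyP P lam mf').
  pose G : \bar R := (\int[lam]_(q in D) (EFin \o g) q)%E.
  have GE : G \is a fin_num by exact: integrable_fin_num.
  have g0 q : D q -> 0 <= g q by move=> /(fg point); exact: le_trans.
  apply: (@le_lt_trans _ _ (\int[P]_x G)%E); last first.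
    by rewrite integral_cst//= probability_setT mule1 ltey_eq GE.
  apply: ge0_le_integral => //.
  - by move=> x _; apply: integral_ge0.
  - have mabs : measurable_fun setT (fun z => `|f' z|)%E by exact: measurableT_comp.
    have mF := @measurable_fun_fubini_tonelli_F _ _ T _ R lam (fun z =>
        `|f' z|%E) mabs (fun z => abse_ge0 _).
    rewrite /fubini_F in mF.
    exact: mF.
  - move=> x _; rewrite /G [leRHS]integral_mkcond.
    apply: (@ge0_le_integral _ _ R lam setT measurableT (fun q => `|f' (x, q)|%E)) => //.
    + apply: measurableT_comp => //; exact: (measurable_fun_pair2 x mf').
    + by apply/(measurable_restrictT _ mD); exact: measurable_int ig.
    + move=> q _; rewrite /f'/= patchE indicE -abse_EFin.
      case: (boolP (q \in D)) => [|_]; last by rewrite mulr0 abse0.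
      by rewrite inE => Dq; rewrite mulr1 /= lee_fin fg.
have F := Fubini if'.
rewrite /Rintegral; congr fine.
transitivity (\int[P]_x \int[lam]_q f' (x, q))%E.
  by apply: eq_integral => x _; rewrite -/(Rintegral _ _ _) EFin_Rintegral.
rewrite F integral_mkcond; apply: eq_integral => q _.
rewrite patchE; case: ifPn => [|/negbTE] Dq.
  rewrite -/(Rintegral _ _ _) EFin_Rintegral//; last by apply: fP; rewrite -inE.
  by apply: eq_integral => x _; rewrite /f'/= indicE Dq mulr1.
rewrite (eq_integral (cst 0%E)) ?integral0// => x _.
by rewrite /f'/= indicE Dq mulr0.
Qed.

End Rintegral_extra.

Section vector_extra.
Context {R : realType} {d : nat}.

Lemma addl_subl (V : zmodType) (x a b : V) : (x + a) - (x + b) = a - b.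
Proof. by rewrite opprD addrACA subrr add0r. Qed.

Lemma lip_coord (K : R) (G : 'rV[R]_d -> 'rV[R]_d) i : lip K G ->
  lip K (fun x => G x 0 i).
Proof.
move=> GK x y; rewrite (le_trans _ (GK x y))//.
by have := norm_coord (G x - G y) i; rewrite !mxE.
Qed.

Lemma lip_measurable_rV (K : R) (G : 'rV[R]_d -> 'rV[R]_d) : lip K G ->
  measurable_fun [set: 'rV[R]_d] G.
Proof.
by move=> GK; apply: measurable_fun_rVP => i; exact: lip_measurable (lip_coord i GK).
Qed.

End vector_extra.

(** * Euler steps and flow maps of one solution *)

Section flow.
Context {R : realType} {d : nat}.
Local Notation E := 'rV[R]_d.
Local Notation lam := (@lebesgue_measure R).
Variables (F : 'I_d -> E -> E -> R) (c : R).
Hypothesis c_ge0 : 0 <= c.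
Hypothesis F_bound : forall i x y,
  `|F i x y| <= c * (1 + `|x|) * (1 + `|y| ^+ 2).
Hypothesis F_lip1 : forall i x x' y,
  `|F i x y - F i x' y| <= c * (1 + `|y| ^+ 2) * `|x - x'|.
Hypothesis F_lip2 : forall i x y y',
  `|F i x y - F i x y'| <= c * (1 + `|x|) * (1 + `|y| + `|y'|) * `|y - y'|.

Lemma F_measurable1 i x : measurable_fun [set: E] (F i x).
Proof.
apply: continuous_measurable_rV => y.
apply/(@cvgrPdist_le _ _ _ (nbhs y)) => /= e e0.
pose K := c * (1 + `|x|) * (2 + `|y| + `|y|).
have K0 : 0 <= K by rewrite !mulr_ge0// addr_ge0// addr_ge0.
have K1 : 0 < K + 1 by rewrite ltr_wpDl.
near=> z.
have yz1 : `|y - z| <= 1 by near: z; exact: cvgr_dist_le.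
have yz2 : `|y - z| <= e / (K + 1).
  by near: z; apply: cvgr_dist_le => //; rewrite divr_gt0.
have z1 : `|z| <= `|y| + 1.
  rewrite -(subrK y z) addrC (le_trans (ler_normD _ _))// lerD2l.
  by rewrite distrC.
rewrite (le_trans (F_lip2 _ _ _ _))// (@le_trans _ _ (K * `|y - z|))//.
  rewrite ler_wpM2r// ler_wpM2l ?mulr_ge0 ?addr_ge0//; lra.
rewrite (@le_trans _ _ ((K + 1) * `|y - z|))//; first by rewrite ler_wpM2r// lerDl.
by rewrite mulrC -ler_pdivlMr.
Unshelve. all: by end_near. Qed.

Lemma F_measurable i : measurable_fun [set: E * E] (fun z => F i z.1 z.2).
Proof.
rewrite (_ : (fun _ => _) = (fun p => (fun y x => F i x y) p.1 p.2) \o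
  (fun z : E * E => (z.2, z.1))); last exact/funext.
apply: measurableT_comp; last first.
  by apply: measurable_fun_pair; [exact: measurable_snd|exact: measurable_fst].
apply: (@caratheodory _ _ _ E (fun y x => F i x y)) => [x|y]; first exact: F_measurable1.
by apply: (@lip_continuous _ _ _ (c * (1 + `|y| ^+ 2))) => x x'; exact: F_lip1.
Qed.

Section estimates.
Variables (rho : probability E R) (h : R).
Hypothesis irho : rho.-integrable [set: E] (EFin \o (fun y => 1 + `|y| ^+ 2)).
Hypothesis rho_h : \int[rho]_y (1 + `|y| ^+ 2) <= h.

Lemma F_integrable i x : rho.-integrable [set: E] (EFin \o F i x).
Proof.
apply: (@integrable_le _ _ R rho setT (F i x)
  (fun y => c * (1 + `|x|) * (1 + `|y| ^+ 2))) => //.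
- exact: F_measurable1.
- exact: integrable_scale.
Qed.

Lemma drift_bound i x : `|drift F rho x 0 i| <= c * (1 + `|x|) * h.
Proof.
rewrite mxE (@le_trans _ _ (\int[rho]_y (c * (1 + `|x|) * (1 + `|y| ^+ 2))))//.
  apply: ler_norm_Rintegral => //; first exact: F_measurable1.
  exact: integrable_scale.
by rewrite RintegralZl// ler_wpM2l// mulr_ge0// addr_ge0.
Qed.

Lemma drift_lip i x x' : `|drift F rho x 0 i - drift F rho x' 0 i| <= c * h * `|x - x'|.
Proof.
rewrite !mxE -RintegralB//; [|exact: F_integrable..].
rewrite (@le_trans _ _ (\int[rho]_y ((c * `|x - x'|) * (1 + `|y| ^+ 2))))//.
  apply: ler_norm_Rintegral => //.
  - by apply: measurable_funB; exact: F_measurable1.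
  - exact: integrable_scale.
  - by move=> y _; rewrite (le_trans (F_lip1 _ _ _ _))// mulrAC.
by rewrite RintegralZl// [leRHS]mulrAC ler_wpM2l// mulr_ge0.
Qed.

End estimates.

Variables (mu : R -> probability E R) (T : R) (h : R -> R) (good : set R).
Hypothesis mu_weak : weak_eq F mu.
Hypothesis mu_neg : forall t, t <= 0 -> mu t = mu 0.
Hypothesis T_gt0 : 0 < T.
Hypothesis h_ge1 : forall t, 1 <= h t.
Hypothesis h_int : lam.-integrable `[0, T] (EFin \o h).
Hypothesis measurable_good : measurable good.
Hypothesis ae_good : {ae lam, forall t, `[0, T]%classic t -> good t}.
Hypothesis mu_moment : forall t, good t ->
  (mu t).-integrable [set: E] (EFin \o (fun y => 1 + `|y| ^+ 2)) /\
  \int[mu t]_y (1 + `|y| ^+ 2) <= h t.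

Let mmu U : measurable U -> measurable_fun [set: R] (fun t => mu t U).
Proof. exact: measurable_weak mu_weak mu_neg U. Qed.

(* The drift is discarded at the null set of times where the moment bound fails. *)
Definition vel i (z : R * E) : R := \1_good z.1 * drift F (mu z.1) z.2 0 i.

Lemma vel_good i t x : good t -> vel i (t, x) = drift F (mu t) x 0 i.
Proof. by move=> gt; rewrite /vel/= indicE mem_set// mul1r. Qed.

Lemma measurable_vel i : measurable_fun [set: R * E] (vel i).
Proof.
apply: measurable_funM.
  apply: measurableT_comp; last exact: measurable_fst.
  exact: measurable_indic.
rewrite (_ : (fun _ => _) = (fun z => \int[mu z.1]_y F i z.2 y)); last first.
  by apply/funext => z; rewrite mxE.
apply: (@measurable_prob_Rintegral _ _ (R * E)%type E R (fun z => mu z.1) _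
  (fun z : (R * E) * E => F i z.1.2 z.2)).
  move=> U mU; apply: (measurableT_comp (mmu mU)); exact: measurable_fst.
rewrite (_ : (fun _ => _) = (fun z => F i z.1 z.2) \o
  (fun z : (R * E) * E => (z.1.2, z.2)))//.
apply: (measurableT_comp (F_measurable i)).
apply: measurable_fun_pair; last exact: measurable_snd.
by apply: measurableT_comp; [exact: measurable_snd|exact: measurable_fst].
Qed.

Lemma vel_bound i t x : `|vel i (t, x)| <= c * (1 + `|x|) * h t.
Proof.
have [gt|gt] := pselect (good t); last first.
  by rewrite /vel indicE memNset// mul0r normr0 !mulr_ge0 ?addr_ge0// (h_ge0 h_ge1).
rewrite vel_good//; have [h1 h2] := mu_moment gt; exact: drift_bound.
Qed.

Lemma vel_lip i t x x' : `|vel i (t, x) - vel i (t, x')| <= c * h t * `|x - x'|.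
Proof.
have [gt|gt] := pselect (good t); last first.
  by rewrite /vel indicE memNset// !mul0r subrr normr0 !mulr_ge0// (h_ge0 h_ge1).
rewrite !vel_good//; have [h1 h2] := mu_moment gt; exact: drift_lip.
Qed.

Lemma vel_int i s t x : 0 <= s -> t <= T ->
  lam.-integrable `]s, t] (EFin \o (fun q => vel i (q, x))).
Proof.
move=> s0 tT; apply: (@integrable_le _ _ R lam `]s, t]%classic (fun q => vel i (q, x))
  (fun q => c * (1 + `|x|) * h q)) => //.
- apply: measurable_funTS; apply: measurableT_comp; first exact: measurable_vel.
  exact: pair2_measurable.
- apply: integrable_scale => //; exact: (h_int_sub h_int).
- by move=> q _; exact: vel_bound.
Qed.

Lemma measurable_vel_time i x (D : set R) :
  measurable_fun D (fun q => vel i (q, x)).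
Proof. exact: measurable_funTS (measurable_fun_pair1 x (measurable_vel i)). Qed.

(** Euler displacement: the position is frozen but the velocity is integrated exactly in time.
    Displacements from one and the same point are therefore additive over consecutive intervals,
    although the velocity has no regularity in time. *)
Definition disp (s t : R) (x : E) : E :=
  \row_i \int[lam]_(q in `]s, t]) vel i (q, x).

Local Notation m := (clock h).

Lemma disp_bound s t x : 0 <= s -> s <= t -> t <= T ->
  `|disp s t x| <= c * (1 + `|x|) * (m t - m s).
Proof.
move=> s0 st tT; rewrite (clockB h_int s0 st tT).
have ih := h_int_sub h_int s0 tT.
have e : \int[lam]_(q in `]s, t]) (c * (1 + `|x|) * h q) =
  c * (1 + `|x|) * \int[lam]_(q in `]s, t]) h q by rewrite RintegralZl.
have hi : lam.-integrable `]s, t] (EFin \o (fun q => c * (1 + `|x|) * h q)).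
  exact: integrable_scale.
rewrite -e; apply: norm_le_coord => [|i].
  by apply: Rintegral_ge0 => q _; rewrite !mulr_ge0 ?addr_ge0// (h_ge0 h_ge1).
rewrite mxE; apply: ler_norm_Rintegral => //; last by move=> q _; exact: vel_bound.
exact: measurable_vel_time.
Qed.

Lemma disp_lip s t : 0 <= s -> s <= t -> t <= T ->
  lip (c * (m t - m s)) (disp s t).
Proof.
move=> s0 st tT x x'; rewrite (clockB h_int s0 st tT).
have ih := h_int_sub h_int s0 tT.
have e : \int[lam]_(q in `]s, t]) (c * `|x - x'| * h q) =
  c * `|x - x'| * \int[lam]_(q in `]s, t]) h q by rewrite RintegralZl.
have hi : lam.-integrable `]s, t] (EFin \o (fun q => c * `|x - x'| * h q)).
  exact: integrable_scale.
rewrite mulrAC -e; apply: norm_le_coord => [|i].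
  by apply: Rintegral_ge0 => q _; rewrite !mulr_ge0// (h_ge0 h_ge1).
have mv y : measurable_fun `]s, t] (fun q => vel i (q, y)).
  exact: measurable_vel_time.
rewrite !mxE -RintegralB//; [|exact: vel_int..].
apply: ler_norm_Rintegral => //; first by apply: measurable_funB; exact: mv.
by move=> q _; rewrite (le_trans (vel_lip _ _ _ _))// mulrAC.
Qed.

Lemma disp_cat s r t x : 0 <= s -> s <= r -> r <= t -> t <= T ->
  disp s t x = disp s r x + disp r t x.
Proof.
move=> s0 sr rt tT; apply/rowP => i; rewrite !mxE.
by apply: Rintegral_itv_cat => //; exact: vel_int.
Qed.

(** One unit beyond the support of u, a step k <= 1 stays outside it, so the Taylor bound reads |k
    p| <= K k^2; k is then taken small. *)
Lemma taylor_supp i (u p : E -> R) (K r : R) : taylor i u p K ->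
  (forall x, r <= `|x| -> u x = 0) -> forall x, r + 1 <= `|x| -> p x = 0.
Proof.
move=> tu u0 x xr; apply/eqP; rewrite -normr_le0; apply/ler_addgt0Pr => e e0.
have K1 : 0 < `|K| + 1 by rewrite ltr_wpDl.
pose k := Num.min 1 (e / (`|K| + 1)).
have k0 : 0 < k by rewrite lt_min ltr01/= divr_gt0.
have := tu x k; rewrite !u0; last 2 first.
- by rewrite (le_trans _ xr)// lerDl.
- rewrite -(lerD2r `|k *: evec i : E|) (@le_trans _ _ (r + 1))//.
    by rewrite lerD2l (le_trans (norm_Zevec _ _))// gtr0_norm// ge_min lexx.
  by rewrite (le_trans xr)// -{1}(addrK (k *: evec i) x) (le_trans (ler_normB _ _)).
rewrite subrr sub0r normrN normrM gtr0_norm// expr2 mulrA mulrC.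
rewrite ler_pM2r// add0r => /le_trans; apply.
rewrite (@le_trans _ _ ((`|K| + 1) * k))//.
  by rewrite ler_wpM2r ?(ltW k0)// (le_trans (ler_norm K))// lerDl.
by rewrite mulrC -ler_pdivlMr// /k ge_min lexx orbT.
Qed.

Definition pairing (p : 'I_d -> E -> R) q x := \sum_i p i x * vel i (q, x).

Section pairing.
Variables (p : 'I_d -> E -> R) (L L' r : R).
Hypotheses (L_ge0 : 0 <= L) (L'_ge0 : 0 <= L') (r_ge0 : 0 <= r).
Hypothesis p_bound : forall i x, `|p i x| <= L.
Hypothesis p_lip : forall i, lip L' (p i).
Hypothesis p_supp : forall i x, r <= `|x| -> p i x = 0.

Lemma pairing_bound q x : `|pairing p q x| <= d%:R * L * c * (1 + r) * h q.
Proof.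
have hq := h_ge0 h_ge1 q.
rewrite (le_trans (ler_norm_sum _ _ _))//.
rewrite (@le_trans _ _ (\sum_(i < d) (L * (c * (1 + r) * h q))))//; last first.
  rewrite sumr_const card_ord -mulr_natl; apply: le_of_eq; ring.
apply: ler_sum => i _; rewrite normrM.
have [rx|xr] := leP r `|x|.
  by rewrite p_supp// normr0 mul0r !mulr_ge0 ?addr_ge0.
rewrite ler_pM// (le_trans (vel_bound _ _ _))// ler_wpM2r//.
by rewrite ler_wpM2l// lerD2l ltW.
Qed.

Lemma pairing_lip q :
  lip (d%:R * c * (L' * (1 + r) + L) * h q) (pairing p q).
Proof.
have hq := h_ge0 h_ge1 q.
move=> x y; rewrite /pairing -sumrB (le_trans (ler_norm_sum _ _ _))//.
rewrite (@le_trans _ _ (\sum_(i < d) (c * (L' * (1 + r) + L) * h q * `|x - y|)))//; last first.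
  rewrite sumr_const card_ord -mulr_natl; apply: le_of_eq; ring.
apply: ler_sum => i _.
(* If neither point is in the ball, both values vanish. Otherwise the velocity, which grows with the
   position, is estimated at the point that is inside. *)
wlog xr : x y / `|x| < r.
  move=> H; have [|rx] := ltP `|x| r; first exact: H.
  have [yr|ry] := ltP `|y| r; first by rewrite distrC (distrC x); exact: H.
  by rewrite !p_supp// !mul0r subrr normr0 !mulr_ge0 ?addr_ge0 ?mulr_ge0 ?addr_ge0.
rewrite (_ : _ - _ = (p i x - p i y) * vel i (q, x) + p i y * (vel i (q, x) - vel i (q, y)));
  last by ring.
rewrite (le_trans (ler_normD _ _))// (normrM (_ - _)) (normrM (p i y)).
have h1 : `|p i x - p i y| * `|vel i (q, x)| <= L' * `|x - y| * (c * (1 + r) * h q).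
  rewrite ler_pM ?p_lip// (le_trans (vel_bound _ _ _))// ler_wpM2r//.
  by rewrite ler_wpM2l// lerD2l ltW.
have h2 : `|p i y| * `|vel i (q, x) - vel i (q, y)| <= L * (c * h q * `|x - y|).
  by rewrite ler_pM// vel_lip.
by rewrite (le_trans (lerD h1 h2))//; apply: le_of_eq; ring.
Qed.

Lemma pairing_supp q x : r <= `|x| -> pairing p q x = 0.
Proof. by move=> rx; rewrite /pairing big1// => i _; rewrite p_supp// mul0r. Qed.

Lemma measurable_pairing : measurable_fun [set: R * E] (fun z => pairing p z.1 z.2).
Proof.
apply: measurable_sum => i; apply: measurable_funM.
  apply: measurableT_comp; last exact: measurable_snd.
  exact: lip_measurable (p_lip i).
rewrite (_ : (fun _ => _) = vel i); first exact: measurable_vel.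
by apply/funext => -[].
Qed.

Lemma measurable_int_pairing : measurable_fun [set: R] (fun q => \int[mu q]_x pairing p q x).
Proof.
exact: (@measurable_prob_Rintegral _ _ (measurableTypeR R) E R mu mmu
  (fun z => pairing p z.1 z.2) measurable_pairing).
Qed.

End pairing.

(** The flux and its version written with [vel] agree at every good time, hence almost
    everywhere. *)
Lemma weak_increment (w : E -> R) (p : 'I_d -> E -> R) (L' : R) s t :
  Cc1 w -> (forall i x, 'D_(evec i) w x = p i x) -> (forall i, lip L' (p i)) ->
  0 <= s -> s <= t -> t <= T ->
  \int[mu t]_x w x - \int[mu s]_x w x =
  \int[lam]_(q in `]s, t]) \int[mu q]_x pairing p q x.
Proof.
move=> cw wp Lp s0 st tT; have t0 : 0 <= t by exact: le_trans st.
have [it ->] := mu_weak cw t0; have [is_ ->] := mu_weak cw s0.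
set flux := fun q => \int[mu q]_x dotp (grad w x) (drift F (mu q) x).
rewrite -/flux in it is_ *.
rewrite opprD addrACA subrr add0r !Rintegral0t//.
have it' u : 0 <= u -> lam.-integrable `]u, t] (EFin \o flux).
  move=> u0; apply: (@integrableS _ _ _ lam `[0, t]%classic) => // x /=.
  by rewrite !in_itv/= => /andP[/ltW/(le_trans u0)-> ->].
rewrite (@Rintegral_itv_cat _ flux 0 s t)//; last exact: it'.
rewrite addrAC subrr add0r /Rintegral; congr fine.
apply: ae_eq_integral => //.
- by have /measurable_int := it' s s0.
- apply/measurable_EFinP; apply: measurable_funTS; exact: measurable_int_pairing Lp.
- case: ae_good => N [mN N0 sub]; exists N; split => //.
  apply: subset_trans sub => q /= nq gq; apply: nq => qst.
  have {}gq : good q by apply: gq; exact: (subint s0 tT).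
  congr EFin; apply: eq_Rintegral => x _; apply: eq_bigr => i _.
  by rewrite vel_good// mxE wp.
Qed.

Lemma int_pairing_le p (L L' r s t : R) : 0 <= L -> 0 <= r ->
  (forall i x, `|p i x| <= L) -> (forall i, lip L' (p i)) ->
  (forall i x, r <= `|x| -> p i x = 0) -> 0 <= s -> s <= t -> t <= T ->
  `|\int[lam]_(q in `]s, t]) \int[mu q]_x pairing p q x|
    <= d%:R * L * c * (1 + r) * (m t - m s).
Proof.
move=> L0 r0 pL Lp p0 s0 st tT.
have ih := h_int_sub h_int s0 tT.
rewrite (clockB h_int s0 st tT) -RintegralZl//.
apply: ler_norm_Rintegral => //.
- by apply: measurable_funTS; exact: measurable_int_pairing Lp.
- exact: integrable_scale.
- move=> q _; apply: ler_norm_Rintegral_prob.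
    exact: (measurable_fun_pair2 q (measurable_pairing Lp)).
  by move=> x; exact: pairing_bound pL p0 q x.
Qed.

(** Integrals of a fixed test function are Lipschitz in clock time. The bound passes from the
    averaged function to psi because the gradient bound of the averages does not depend on eps. *)
Lemma lipc_time (L r s t : R) psi : 0 <= L -> 0 <= r -> lipc L r psi ->
  0 <= s -> s <= t -> t <= T ->
  `|\int[mu t]_x psi x - \int[mu s]_x psi x| <= d%:R * L * c * (r + 3) * (m t - m s).
Proof.
move=> L0 r0 Lpsi s0 st tT; apply/ler_addgt0Pr => e e0.
have d0 : 0 <= d%:R :> R by [].
pose A := 2 * L * d%:R + d%:R + 1.
have A0 : 0 < A by rewrite ltr_wpDl ?addr_ge0 ?mulr_ge0.
pose eps := Num.min (A^-1) (e / A).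
have eps0 : 0 < eps by rewrite lt_min invr_gt0 A0 divr_gt0.
have e1 : A * eps <= 1 by rewrite -ler_pdivlMl// mulr1 /eps ge_min lexx.
have e2 : A * eps <= e by rewrite -ler_pdivlMl// mulrC /eps ge_min lexx orbT.
have AL : 2 * L * d%:R <= A by rewrite /A -addrA lerDl addr_ge0.
have Ad : d%:R <= A by rewrite /A -addrA addrCA lerDl addr_ge0// !mulr_ge0.
have epsd : d%:R * eps <= 1.
  by rewrite (le_trans _ e1)// ler_wpM2r// ltW.
have epse : 2 * (L * (d%:R * eps)) <= e.
  by rewrite (le_trans _ e2)// !mulrA ler_wpM2r// ltW.
have [p [cw wp tp Lp pL]] := Cc1_avgs eps0 L0 Lpsi.
set w := avgs _ _ _ in cw wp tp *.
have Lw := lipc_avgs eps0 (enum 'I_d) L0 Lpsi; rewrite size_enum_ord -/w in Lw.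
have p0 i x : r + 2 <= `|x| -> p i x = 0.
  move=> rx; apply: (taylor_supp (tp i) (r := r + d%:R * eps)); first exact: Lw.2.
  by rewrite (le_trans _ rx)//; lra.
have close u : `|\int[mu u]_x psi x - \int[mu u]_x w x| <= L * (d%:R * eps).
  rewrite -RintegralB//; [|exact: lipc_integrable Lpsi|exact: lipc_integrable Lw].
  apply: ler_norm_Rintegral_prob.
    by apply: measurable_funB; [exact: lip_measurable Lpsi.1|exact: lip_measurable Lw.1].
  move=> x; rewrite distrC; have := avgs_near eps0 (enum 'I_d) x L0 Lpsi.1.
  by rewrite size_enum_ord.
have r2 : 0 <= r + 2 by rewrite addr_ge0.
have := int_pairing_le L0 r2 pL Lp p0 s0 st tT.
rewrite -(weak_increment cw wp Lp s0 st tT).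
rewrite (_ : 1 + (r + 2) = r + 3); last by ring.
have := close t; have := close s.
rewrite !ler_norml => /andP[? ?] /andP[? ?] /andP[? ?].
by apply/andP; split; lra.
Qed.

Local Notation M := (clock h T).
Local Notation tau := (time T h).

Definition step (s t : R) (x : E) : E := x + disp (tau s) (tau t) x.

Lemma tau_facts s t : 0 <= s -> s <= t -> t <= M ->
  [/\ 0 <= tau s, tau s <= tau t, tau t <= T & m (tau t) - m (tau s) = t - s].
Proof.
move=> s0 st tM.
have /andP[a1 a2] := time_itv h T_gt0 s.
have /andP[b1 b2] := time_itv h T_gt0 t.
have sM : s <= M by exact: le_trans tM.
have t0 : 0 <= t by exact: le_trans st.
split => //; first exact: (time_mono T_gt0 h_ge1 h_int s0 st tM).
by rewrite !timeK.
Qed.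

Lemma step_disp s t x : 0 <= s -> s <= t -> t <= M ->
  `|step s t x - x| <= c * (1 + `|x|) * (t - s).
Proof.
move=> s0 st tM; have [a b b' <-] := tau_facts s0 st tM.
by rewrite /step addrAC subrr add0r disp_bound.
Qed.

Lemma step_lip s t : 0 <= s -> s <= t -> t <= M ->
  lip (expR (c * (t - s))) (step s t).
Proof.
move=> s0 st tM x y; have [a b b' <-] := tau_facts s0 st tM.
rewrite /step opprD addrACA (le_trans (ler_normD _ _))//.
rewrite (le_trans (lerD (lexx _) (disp_lip a b b' _ _)))//.
rewrite -{1}(mul1r `|x - y|) -mulrDl ler_wpM2r//; exact: expR_ge1Dx.
Qed.

Lemma step_growth s t : 0 <= s -> s <= t -> t <= M ->
  forall x, 1 + `|step s t x| <= expR (c * (t - s)) * (1 + `|x|).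
Proof.
move=> s0 st tM x; have h1 := step_disp x s0 st tM.
have h2 : `|step s t x| <= `|step s t x - x| + `|x|.
  by rewrite (le_trans _ (ler_normD _ _))// subrK.
have h3 := expR_ge1Dx (c * (t - s)); have x0 : 0 <= 1 + `|x| by rewrite addr_ge0.
by have := ler_wpM2r x0 h3; lra.
Qed.

(** With u = c (t - s), the displacement is at most u (1 + |x|), and (1 - u)(1 + 2u) >= 1 as u <=
    1/2. Such lower bounds are what keeps supports of composed test functions bounded. *)
Lemma step_low s t : 0 <= s -> s <= t -> t <= M -> c * (t - s) <= 1 / 2 ->
  forall x, 1 + `|x| <= expR (2 * c * (t - s)) * (1 + `|step s t x|).
Proof.
move=> s0 st tM ct x; have h1 := step_disp x s0 st tM.
have h2 : `|x| <= `|step s t x - x| + `|step s t x|.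
  by rewrite distrC (le_trans _ (ler_normD _ _))// subrK.
have x0 : 0 <= `|x| by [].
have u0 : 0 <= c * (t - s) by rewrite mulr_ge0// subr_ge0.
have h3 : 1 + 2 * (c * (t - s)) <= expR (2 * c * (t - s)).
  by rewrite (mulrA 2) expR_ge1Dx.
set u := c * (t - s) in ct u0 h3.
have h4 : (1 + `|x|) * (1 - u) <= 1 + `|step s t x|.
  by rewrite -/(c * (1 + `|x|)) mulrAC -/u in h1; lra.
have h5 : 0 <= (1 + `|x|) * (1 - u) by apply: mulr_ge0; lra.
apply: (@le_trans _ _ ((1 + 2 * u) * ((1 + `|x|) * (1 - u)))); last by apply: ler_pM => //; lra.
have : 0 <= (1 + `|x|) * (u * (1 - 2 * u)) by rewrite !mulr_ge0//; lra.
by lra.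
Qed.

(** By additivity of [disp], the defect is the variation of the second displacement between x and
    [step s r x]: a Lipschitz constant c (t - r) times a distance of order r - s. *)
Lemma step_defect s r t : 0 <= s -> s <= r -> r <= t -> t <= M ->
  forall x, `|step r t (step s r x) - step s t x| <= c ^+ 2 * (1 + `|x|) * (t - s) ^+ 2.
Proof.
move=> s0 sr rt tM x; have rM : r <= M by exact: le_trans tM.
have r0 : 0 <= r by exact: le_trans sr.
have [a1 a2 a3 a4] := tau_facts s0 sr rM.
have [b1 b2 b3 b4] := tau_facts r0 rt tM.
rewrite {1 3}/step (disp_cat x a1 a2 b2 b3).
rewrite addrA -[x + disp (tau s) (tau r) x]/(step s r x) addl_subl.
rewrite (le_trans (disp_lip b1 b2 b3 _ _))// b4.
have h1 := step_disp x s0 sr rM.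
rewrite (@le_trans _ _ (c * (t - r) * (c * (1 + `|x|) * (r - s))))//.
  by rewrite ler_wpM2l// mulr_ge0// subr_ge0.
have x0 : 0 <= c ^+ 2 * (1 + `|x|) by rewrite mulr_ge0 ?sqr_ge0 ?addr_ge0.
rewrite (_ : _ * _ = c ^+ 2 * (1 + `|x|) * ((t - r) * (r - s))); last by ring.
by rewrite ler_wpM2l//; nra.
Qed.

Lemma lipc_comp (G : E -> E) (phi : E -> R) (L r K A r' : R) : 0 <= L ->
  lip K G -> (forall x, 1 + `|x| <= A * (1 + `|G x|)) -> 0 <= A ->
  A * (1 + r) <= 1 + r' ->
  lipc L r phi -> lipc (L * K) r' (phi \o G).
Proof.
move=> L0 GK Gl A0 Ar [Lphi phi0]; split => [x y|x xr] /=.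
  by rewrite (le_trans (Lphi _ _))// -mulrA ler_wpM2l.
have [rG|Gr] := leP r `|G x|; first exact: phi0.
exfalso; have h1 := Gl x; move: xr; apply/negP; rewrite -ltNge.
have x0 := normr_ge0 x; have [A1|A1] := ltP 0 A; last first.
  have A00 : A = 0 by lra.
  by move: h1; rewrite A00 mul0r; lra.
have : A * (1 + `|G x|) < A * (1 + r) by rewrite ltr_pM2l// ltrD2l.
by lra.
Qed.

Local Notation S eps phi := (avgs eps (enum 'I_d) phi).

(** In [step_base], 16 c^2 d^2 comes from the Taylor remainder, 2 c^2 d^2 from freezing the measure
    in time, and c d from commuting the average with the step. *)
Definition kap : R := 18 * c ^+ 2 * d%:R ^+ 2 + c * d%:R.

(** With D = t - s, moving the average through the Euler step costs eps D. Expanding the averaged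
    test along the displacement costs D^2 / eps. The first-order term is the right side of the weak
    equation with the measure frozen at the initial time, and unfreezing it costs D^2 / eps
    again. *)
Lemma step_base s t phi (L r eps : R) : 0 <= s -> s <= t -> t <= M ->
  c * (t - s) <= 1 / 2 -> 0 < eps -> eps <= 1 -> d%:R * eps <= 1 ->
  0 <= L -> 0 <= r -> lipc L r phi ->
  `|\int[mu (tau t)]_x S eps phi x - \int[mu (tau s)]_x S eps (phi \o step s t) x|
    <= L * kap * (r + 6) ^+ 2 * ((t - s) ^+ 2 / eps + eps * (t - s)).
Proof.
move=> s0 st tM ct e0 e1 de1 L0 r0 Lphi.
have [a1 a2 a3 a4] := tau_facts s0 st tM.
have d0 : 0 <= d%:R :> R by [].
set D := t - s in ct a4 *; have D0 : 0 <= D by rewrite subr_ge0.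
set dd : R := d%:R in de1 d0 *.
have [p [cw wp tp Lp pL]] := Cc1_avgs e0 L0 Lphi.
set w := S eps phi in cw wp tp *.
have Lw := lipc_avgs e0 (enum 'I_d) L0 Lphi; rewrite size_enum_ord -/w -/dd in Lw.
have w0 x : r + 1 <= `|x| -> w x = 0.
  by move=> xr; apply: Lw.2; rewrite (le_trans _ xr)// lerD2l.
have p0 i x : r + 2 <= `|x| -> p i x = 0.
  move=> rx; apply: (taylor_supp (tp i) (r := r + 1)) => //.
  by rewrite (le_trans _ rx)//; lra.
pose L' := 2 * L / eps.
have L'0 : 0 <= L' by rewrite divr_ge0 ?mulr_ge0// ltW.
have mG : measurable_fun setT (step s t).
  apply: measurable_fun_rVP => i.
  exact: lip_measurable (lip_coord i (step_lip s0 st tM)).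
set P := mu (tau s).
(* Averaging commutes with the Euler step up to the oscillation of the drift. *)
have A2 : `|\int[P]_x S eps (phi \o step s t) x - \int[P]_x w (step s t x)|
    <= L * (c * D * (dd * eps)).
  have LG : lip (L * expR (c * D)) (phi \o step s t).
    by move=> x y; rewrite (le_trans (Lphi.1 _ _))// -mulrA ler_wpM2l// step_lip.
  have LK0 : 0 <= L * expR (c * D) by rewrite mulr_ge0// expR_ge0.
  have [b wb] := lipc_bounded Lw; have [b' phib] := lipc_bounded Lphi.
  rewrite -RintegralB//; last 2 first.
  - apply: (@integrable_prob _ _ _ _ _ b'); first exact: lip_measurable (lip_avgs _ _ LK0 LG).
    move=> x; rewrite -[S _ _ x]subr0; apply: (avgs_dist e0 LK0 LG) => z _.
    by rewrite subr0 /= phib.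
  - by apply: (@integrable_prob _ _ _ _ _ b) => //; apply: measurableT_comp mG;
    exact: lip_measurable Lw.1.
  apply: ler_norm_Rintegral_prob.
    apply: measurable_funB; first exact: lip_measurable (lip_avgs _ _ LK0 LG).
    by apply: measurableT_comp mG; exact: lip_measurable Lw.1.
  move=> x; apply: (avgs_close e0 LK0 L0 LG Lphi.1) => z zl /=.
  rewrite (le_trans (Lphi.1 _ _))// ler_wpM2l// /step.
  rewrite (_ : _ - _ = disp (tau s) (tau t) (x + z) - disp (tau s) (tau t) x); last first.
    by move: (disp _ _ (x + z)) (disp _ _ x) => u v; rewrite (addrAC x v) addl_subl.
  rewrite (le_trans (disp_lip a1 a2 a3 _ _))// a4 addrAC subrr add0r.
  by rewrite ler_wpM2l ?mulr_ge0//; move: zl; rewrite size_enum_ord.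
pose lin x := \sum_i disp (tau s) (tau t) x 0 i * p i x.
have mdisp i : measurable_fun setT (fun x => disp (tau s) (tau t) x 0 i).
  exact: lip_measurable (lip_coord i (disp_lip a1 a2 a3)).
have mlin : measurable_fun setT lin.
  by apply: measurable_sum => i; apply: measurable_funM => //; exact: lip_measurable (Lp i).
have linb x : `|lin x| <= dd * (c * (1 + (r + 2)) * D * L).
  rewrite (le_trans (ler_norm_sum _ _ _))//.
  rewrite (@le_trans _ _ (\sum_(i < d) c * (1 + (r + 2)) * D * L))//; last first.
    by rewrite sumr_const card_ord mulr_natl.
  apply: ler_sum => i _; rewrite normrM.
  have [rx|xr] := leP (r + 2) `|x|.
    by rewrite p0// normr0 mulr0 !mulr_ge0//; lra.
  rewrite ler_pM// (le_trans (norm_coord _ _))// (le_trans (disp_bound _ a1 a2 a3))//.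
  by rewrite a4 ler_wpM2r// ler_wpM2l// lerD2l ltW.
have A3 : `|\int[P]_x w (step s t x) - \int[P]_x w x - \int[P]_x lin x|
    <= 16 * c ^+ 2 * dd ^+ 2 * L * (r + 6) ^+ 2 * (D ^+ 2 / eps).
  have iw := lipc_integrable P Lw; have [b wb] := lipc_bounded Lw.
  have mwG : measurable_fun setT (fun x => w (step s t x)).
    by apply: measurableT_comp mG; exact: lip_measurable Lw.1.
  have iwG : P.-integrable setT (EFin \o (fun x => w (step s t x))).
    by apply: (@integrable_prob _ _ _ _ _ b).
  have ilin : P.-integrable setT (EFin \o lin) by exact: (integrable_prob P mlin linb).
  have mw : measurable_fun setT w by exact: lip_measurable Lw.1.
  rewrite -RintegralB// -RintegralB//; last first.
    apply: (@integrable_prob _ _ _ _ _ (b + b)); first exact: measurable_funB.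
    by move=> x; rewrite (le_trans (ler_normB _ _))// lerD.
  apply: ler_norm_Rintegral_prob; first by do 2 apply: measurable_funB => //.
  (* Beyond 2r + 3 a half-step bound gives |step x| >= (|x| - 1) / 2 >= r + 1, so the averaged test
     vanishes at both ends. *)
  move=> x; have [rx|xr] := leP (2 * r + 3) `|x|.
    have h1 := step_disp x s0 st tM; rewrite -/D in h1.
    have h2 : `|x| <= `|step s t x - x| + `|step s t x|.
      by rewrite distrC (le_trans _ (ler_normD _ _))// subrK.
    have h3 : c * D * (1 + `|x|) <= 1 / 2 * (1 + `|x|) by rewrite ler_wpM2r// addr_ge0.
    rewrite !w0 ?subrr ?sub0r ?normrN; [|lra|lra].
    rewrite /lin big1 ?normr0; last by move=> i _; rewrite p0 ?mulr0//; lra.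
    have DE : 0 <= D ^+ 2 / eps by rewrite divr_ge0 ?sqr_ge0// ltW.
    by rewrite mulr_ge0// !mulr_ge0// addr_ge0.
  have tt := taylor_sum L'0 tp Lp x (disp (tau s) (tau t) x).
  rewrite -/(step s t x) -/(lin x) -/dd in tt.
  apply: (le_trans tt).
  have db := disp_bound x a1 a2 a3; rewrite a4 in db.
  have db2 : `|disp (tau s) (tau t) x| ^+ 2 <= (c * (2 * (r + 6)) * D) ^+ 2.
    have B0 : 0 <= c * (2 * (r + 6)) * D by rewrite !mulr_ge0// addr_ge0.
    rewrite lerXn2r ?nnegrE//; apply: le_trans db _.
    by rewrite ler_wpM2r// ler_wpM2l//; lra.
  rewrite (@le_trans _ _ (L' * (2 * dd ^+ 2) * (c * (2 * (r + 6)) * D) ^+ 2))//.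
    have C0 : 0 <= L' * (2 * dd ^+ 2) by rewrite mulr_ge0// mulr_ge0// sqr_ge0.
    exact: ler_wpM2l C0 _ _ db2.
  by apply: le_of_eq; rewrite /L'; field; rewrite gt_eqF.
have r2 : 0 <= r + 2 by rewrite addr_ge0.
have mpair := measurable_pairing Lp.
have ih := h_int_sub h_int a1 a3.
have ihZ K : lam.-integrable `]tau s, tau t] (EFin \o (fun q => K * h q)).
  exact: integrable_scale.
have pairb q x := pairing_bound L0 r2 pL p0 q x.
(* Exchanging space and time identifies the first-order Taylor term with the flux of the weak
   equation, the measure being frozen at [tau s]. *)
have A4 : \int[P]_x lin x = \int[lam]_(q in `]tau s, tau t]) \int[P]_x pairing p q x.
  have mswap : measurable_fun [set: E * R] (fun z => pairing p z.2 z.1).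
    rewrite (_ : (fun _ => _) = (fun z : R * E => pairing p z.1 z.2) \o (fun z : E * R =>
        (z.2, z.1)))//.
    apply: measurableT_comp => //.
    by apply: measurable_fun_pair; [exact: measurable_snd|exact: measurable_fst].
  rewrite -(@RFubini _ _ R P `]tau s, tau t]%classic (fun x q => pairing p q x) _
    (measurable_itv _) mswap (ihZ (dd * L * c * (1 + (r + 2)))) (fun x q _ => pairb q x)).
  apply: eq_Rintegral => x _; rewrite /pairing /lin.
  have ip i : lam.-integrable `]tau s, tau t] (EFin \o (fun q => p i x * vel i (q, x))).
    apply: integrable_scale => //; exact: vel_int.
  have [_ ->] := @Rintegral_sum _ _ R lam `]tau s, tau t]%classic _
    (fun i q => p i x * vel i (q, x)) (measurable_itv _) ip.
  apply: eq_bigr => i _; rewrite mxE mulrC RintegralZl//; exact: vel_int.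
have mmup (Q : probability E R) : measurable_fun `]tau s, tau t] (fun q =>
    \int[Q]_x pairing p q x).
  apply: measurable_funTS.
  exact: (@measurable_prob_Rintegral _ _ (measurableTypeR R) E R (fun=> Q)
    (fun U _ => measurable_cst _) (fun z => pairing p z.1 z.2) mpair).
have mmu2 : measurable_fun `]tau s, tau t] (fun q => \int[mu q]_x pairing p q x).
  by apply: measurable_funTS; exact: measurable_int_pairing Lp.
have iQ (Q : R -> probability E R) : measurable_fun `]tau s, tau t] (fun q =>
    \int[Q q]_x pairing p q x) ->
    lam.-integrable `]tau s, tau t] (EFin \o (fun q => \int[Q q]_x pairing p q x)).
  move=> mQ; apply: (@integrable_le _ _ R lam _ _ (fun q =>
    dd * L * c * (1 + (r + 2)) * h q)) => //.
  move=> q _; apply: ler_norm_Rintegral_prob; last by move=> x; exact: pairb.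
  exact: (measurable_fun_pair2 q mpair).
pose Kf := 2 * c ^+ 2 * dd ^+ 2 * L * (r + 6) ^+ 2 * (D / eps).
have A5 : `|\int[lam]_(q in `]tau s, tau t]) \int[mu q]_x pairing p q x -
    \int[lam]_(q in `]tau s, tau t]) \int[P]_x pairing p q x| <= Kf * D.
  rewrite -RintegralB//; [|exact: iQ|exact: iQ].
  rewrite -a4 (clockB h_int a1 a2 a3) -RintegralZl//.
  apply: ler_norm_Rintegral.
  - by [].
  - by apply: measurable_funB; [exact: mmu2|exact: mmup].
  - exact: ihZ.
  move=> q; rewrite /= in_itv/= => /andP[/ltW sq qt].
  have qT : q <= T by exact: le_trans a3.
  have hq := h_ge0 h_ge1 q.
  pose Lq := dd * c * (L' * (1 + (r + 2)) + L) * h q.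
  have Lr0 : 0 <= L' * (1 + (r + 2)) + L by rewrite addr_ge0// mulr_ge0// !addr_ge0.
  have Lq0 : 0 <= Lq by rewrite /Lq mulr_ge0// mulr_ge0// mulr_ge0.
  (* The integrand of the flux at time q is itself a compactly supported Lipschitz function of x,
     with constant of order h q / eps, so its integral varies in time as in [lipc_time]. *)
  have Lpq : lipc Lq (r + 2) (pairing p q).
    by split; [exact: pairing_lip|exact: pairing_supp].
  have := lipc_time Lq0 r2 Lpq a1 sq qT => /le_trans; apply.
  have mq : m q - m (tau s) <= D.
    have q0 : 0 <= q by exact: le_trans sq.
    by rewrite -a4 lerD2r -subr_ge0 (le_trans _ (clock_ge h_ge1 h_int q0 qt a3))// subr_ge0.
  have C0 : 0 <= dd * Lq * c by rewrite mulr_ge0// mulr_ge0.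
  have C1 : 0 <= dd * Lq * c * (r + 2 + 3) by rewrite mulr_ge0// addr_ge0.
  rewrite (@le_trans _ _ (dd * Lq * c * (r + 2 + 3) * D))//; first exact: ler_wpM2l C1 _ _ mq.
  have LL : L' * (1 + (r + 2)) + L <= L / eps * (2 * (r + 6)).
    have Le : L <= L / eps by rewrite ler_peMr// invf_ge1.
    have Le0 : 0 <= L / eps by rewrite divr_ge0// ltW.
    rewrite /L' (_ : 2 * L / eps = 2 * (L / eps)); last by ring.
    by nra.
  rewrite (@le_trans _ _ (dd * (dd * c * (L / eps * (2 * (r + 6))) * h q) * c * (r + 6) * D))//.
    apply: ler_wpM2r => //; apply: ler_pM => //; [by rewrite addr_ge0| |by lra].
    apply: ler_wpM2r => //; apply: ler_wpM2l => //; apply: ler_wpM2r => //.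
    by apply: ler_wpM2l => //; rewrite mulr_ge0.
  by apply: le_of_eq; rewrite /Kf; ring.
have A1 := weak_increment cw wp Lp a1 a2 a3.
rewrite -/P -A4 in A1 A5; rewrite -A1 in A5.
have De : D ^+ 2 / eps = D / eps * D by ring.
have KfE : Kf * D = 2 * c ^+ 2 * dd ^+ 2 * L * (r + 6) ^+ 2 * (D ^+ 2 / eps).
  by rewrite De /Kf; ring.
rewrite KfE in A5.
pose Q2 := c ^+ 2 * dd ^+ 2 * L * (r + 6) ^+ 2 * (D ^+ 2 / eps).
pose Q1 := L * (c * dd) * (eps * D).
have Q10 : 0 <= Q1 by rewrite !mulr_ge0// ltW.
have r6 : 1 <= (r + 6) ^+ 2 by nra.
have Q3 : Q1 <= Q1 * (r + 6) ^+ 2 by rewrite ler_peMr.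
have Q4 : 0 <= Q1 * (r + 6) ^+ 2 by rewrite mulr_ge0// (le_trans _ r6).
have X0 : 0 <= D ^+ 2 / eps by rewrite divr_ge0 ?sqr_ge0// ltW.
have [c2 d2 r20] : [/\ 0 <= c ^+ 2, 0 <= dd ^+ 2 & 0 <= (r + 6) ^+ 2] by rewrite !sqr_ge0.
have eD : 0 <= eps * D by rewrite mulr_ge0// ltW.
have Q5 : 0 <= L * (18 * c ^+ 2 * dd ^+ 2) * (r + 6) ^+ 2 * (eps * D).
  by rewrite mulr_ge0// mulr_ge0// mulr_ge0// mulr_ge0// mulr_ge0.
have Q6 : 0 <= L * (c * dd) * (r + 6) ^+ 2 * (D ^+ 2 / eps).
  by rewrite mulr_ge0// mulr_ge0// mulr_ge0// mulr_ge0.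
have -> : L * kap * (r + 6) ^+ 2 * (D ^+ 2 / eps + eps * D) =
    18 * Q2 + L * (18 * c ^+ 2 * dd ^+ 2) * (r + 6) ^+ 2 * (eps * D)
    + L * (c * dd) * (r + 6) ^+ 2 * (D ^+ 2 / eps) + Q1 * (r + 6) ^+ 2.
  by rewrite /kap /Q2 /Q1 -/dd; ring.
have A2' : L * (c * D * (dd * eps)) = Q1 by rewrite /Q1; ring.
rewrite A2' in A2.
have A3' : 16 * c ^+ 2 * dd ^+ 2 * L * (r + 6) ^+ 2 * (D ^+ 2 / eps) = 16 * Q2.
  by rewrite /Q2; ring.
rewrite A3' in A3.
have A5' : 2 * c ^+ 2 * dd ^+ 2 * L * (r + 6) ^+ 2 * (D ^+ 2 / eps) = 2 * Q2.
  by rewrite /Q2; ring.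
rewrite A5' in A5.
move: A2 A3 A5 Q3 Q4 Q5 Q6.
clear A2' A3' A5' KfE Q10.
move: (Q1 * _) => q3; move: (Q1) (Q2) => q1 q2.
move: (L * _ * _ * (eps * D)) (L * _ * _ * (D ^+ 2 / eps)) => q5 q6.
move: (\int[P]_x S _ _ x) (\int[P]_x w (step s t x)) (\int[P]_x w x) (\int[P]_x lin x)
  (\int[mu (tau t)]_x w x) => i1 i2 i3 i4 i5; clear.
rewrite !ler_norml => /andP[? ?] /andP[? ?] /andP[? ?] ? ? ? ?.
by apply/andP; split; lra.
Qed.

Lemma pow2_small (B e : R) : 0 < e -> exists j0, forall j, (j0 <= j)%N -> B / 2 ^+ j <= e.
Proof.
move=> e0; exists (Num.bound (`|B| / e)) => j jj.
have p2 : 0 < 2 ^+ j :> R by rewrite exprn_gt0.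
rewrite ler_pdivrMr// (le_trans (ler_norm B))// mulrC -ler_pdivrMr//.
rewrite (le_trans (ltW (archi_boundP _)))//; first by rewrite divr_ge0// ltW.
by rewrite -natrX ler_nat (leq_trans jj)// ltnW// ltn_expl.
Qed.

Local Notation DD := (dyadic step).

Lemma dyadic_step_lip j s t : 0 <= s -> s <= t -> t <= M ->
  lip (expR (c * (t - s))) (DD j s t).
Proof. by move=> s0 st tM; apply: (dyadic_lip (M := M)) => //; exact: step_lip. Qed.

Lemma dyadic_low j s t : 0 <= s -> s <= t -> t <= M ->
  c * (t - s) <= 2 ^+ j / 2 ->
  forall x, 1 + `|x| <= expR (2 * c * (t - s)) * (1 + `|DD j s t x|).
Proof.
elim: j s t => [|j IH] s t s0 st tM ct x.
  by apply: step_low => //; rewrite expr0 in ct.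
rewrite [dyadic _ _ _ _]/=; set m' := (s + t) / 2.
have sm : s <= m' by rewrite /m'; lra.
have mt : m' <= t by rewrite /m'; lra.
have m0 : 0 <= m' by exact: le_trans sm.
have mM : m' <= M by exact: le_trans tM.
have ms : m' - s = (t - s) / 2 by rewrite /m'; field.
have tm : t - m' = (t - s) / 2 by rewrite /m'; field.
have ct2 : c * ((t - s) / 2) <= 2 ^+ j / 2.
  by move: ct; rewrite exprS; lra.
have h1 := IH s m' s0 sm mM; rewrite ms in h1.
have h2 := IH m' t m0 mt tM; rewrite tm in h2.
apply: (le_trans (h1 ct2 x)).
rewrite (_ : 2 * c * (t - s) = 2 * c * ((t - s) / 2) + 2 * c * ((t - s) / 2)); last by field.
by rewrite expRD -[leRHS]mulrA ler_wpM2l ?expR_ge0// h2.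
Qed.

Lemma lipc_dyadic j s t phi (L r : R) : 0 <= s -> s <= t -> t <= M ->
  c * (t - s) <= 2 ^+ j / 2 -> 0 <= L -> lipc L r phi ->
  lipc (L * expR (c * (t - s))) (expR (2 * c * (t - s)) * (1 + r) - 1) (phi \o DD j s t).
Proof.
move=> s0 st tM ct L0 Lphi.
apply: (lipc_comp (A := expR (2 * c * (t - s))) (r := r)) => //.
- exact: dyadic_step_lip.
- exact: dyadic_low.
- by rewrite [leRHS]addrC subrK.
Qed.

(** Induction from the right: the half [m', t] is treated with phi, and [s, m'] with phi composed
    with the dyadic map of the right half. Lipschitz constants and supports grow by exponentials
    independent of j, and the 2^j substeps add up to D^2 / (2^j eps) + eps D. *)
Lemma dyadic_base j s t phi (L r eps : R) : 0 <= s -> s <= t -> t <= M ->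
  c * (t - s) <= 2 ^+ j / 2 -> 0 < eps -> eps <= 1 -> d%:R * eps <= 1 ->
  0 <= L -> 0 <= r -> lipc L r phi ->
  `|\int[mu (tau t)]_x S eps phi x - \int[mu (tau s)]_x S eps (phi \o DD j s t) x|
    <= L * expR (c * (t - s)) * kap * (expR (2 * c * (t - s)) * (1 + r) + 5) ^+ 2
       * ((t - s) ^+ 2 / (2 ^+ j * eps) + eps * (t - s)).
Proof.
have kap0 : 0 <= kap.
  by rewrite /kap; apply: addr_ge0; apply: mulr_ge0 => //; rewrite mulr_ge0 ?sqr_ge0.
move=> + + + + e0 e1 de1.
elim: j s t phi L r => [|j IH] s t phi L r s0 st tM ct L0 r0 Lphi.
  rewrite expr0 mul1r; have D0 : 0 <= t - s by rewrite subr_ge0.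
  have ct' : c * (t - s) <= 1 / 2 by rewrite expr0 in ct.
  apply: (le_trans (step_base s0 st tM ct' e0 e1 de1 L0 r0 Lphi)).
  have W0 : 0 <= (t - s) ^+ 2 / eps + eps * (t - s).
    by rewrite addr_ge0// ?divr_ge0 ?sqr_ge0 ?mulr_ge0// ltW.
  apply: ler_wpM2r => //; apply: ler_pM.
  - by rewrite mulr_ge0.
  - exact: sqr_ge0.
  - apply: ler_wpM2r => //; rewrite ler_peMr// -expR0 ler_expR mulr_ge0//.
  - have h1 : 1 <= expR (2 * c * (t - s)) by rewrite -expR0 ler_expR !mulr_ge0.
    have h2 : 1 + r <= expR (2 * c * (t - s)) * (1 + r) by rewrite ler_peMl// addr_ge0.
    have h3 : 0 <= r + 6 by rewrite addr_ge0.
    by rewrite lerXn2r ?nnegrE; lra.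
rewrite [dyadic _ _ _]/=; set m' := (s + t) / 2.
have sm : s <= m' by rewrite /m'; lra.
have mt : m' <= t by rewrite /m'; lra.
have m0 : 0 <= m' by exact: le_trans sm.
have mM : m' <= M by exact: le_trans tM.
have ms : m' - s = (t - s) / 2 by rewrite /m'; field.
have tm : t - m' = (t - s) / 2 by rewrite /m'; field.
have ct2 : c * ((t - s) / 2) <= 2 ^+ j / 2.
  by move: ct; rewrite exprS; lra.
have D0 : 0 <= t - s by rewrite subr_ge0.
have h1 := IH m' t phi L r m0 mt tM; rewrite tm in h1.
have {}h1 := h1 ct2 L0 r0 Lphi.
have := @lipc_dyadic j m' t phi L r m0 mt tM; rewrite tm => Lc.
have {}Lc := Lc ct2 L0 Lphi.
have L'0 : 0 <= L * expR (c * ((t - s) / 2)) by rewrite mulr_ge0 ?expR_ge0.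
set z := expR (2 * c * ((t - s) / 2)) in h1 Lc.
have z1 : 1 <= z by rewrite /z -expR0 ler_expR !mulr_ge0// divr_ge0.
have r'0 : 0 <= z * (1 + r) - 1 by rewrite subr_ge0 (le_trans z1)// ler_peMr ?lerDl//; lra.
have h2 := IH s m' _ _ _ s0 sm mM; rewrite ms in h2.
have {}h2 := h2 _ _ _ ct2 L'0 r'0 Lc.
rewrite -/z in h2.
rewrite [phi \o _]/((phi \o DD j m' t) \o DD j s m').
set I2 := \int[mu (tau m')]_x S eps (phi \o DD j m' t) x in h1 h2.
set I1 := \int[mu (tau t)]_x _ in h1 *.
set I3 := \int[mu (tau s)]_x S eps ((phi \o DD j m' t) \o DD j s m') x in h2.
have zz : expR (2 * c * (t - s)) = z * z by rewrite -expRD; congr expR; field.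
set y := expR (c * ((t - s) / 2)) in h1 h2 L'0.
have yy : expR (c * (t - s)) = y * y by rewrite -expRD; congr expR; field.
have y1 : 1 <= y by rewrite /y -expR0 ler_expR !mulr_ge0// divr_ge0.
rewrite zz yy.
have p2 : 0 < 2 ^+ j :> R by rewrite exprn_gt0.
set W := ((t - s) / 2) ^+ 2 / (2 ^+ j * eps) + eps * ((t - s) / 2) in h1 h2.
have W0 : 0 <= W.
  have ? : 0 <= (t - s) / 2 by rewrite divr_ge0.
  by rewrite /W addr_ge0// ?mulr_ge0 ?invr_ge0 ?mulr_ge0 ?(ltW p2) ?(ltW e0).
have WW : (t - s) ^+ 2 / (2 ^+ j.+1 * eps) + eps * (t - s) = 2 * W.
  rewrite /W [2 ^+ j.+1]exprS; have := p2; move: (2 ^+ j) => P P0; field.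
  by rewrite !gt_eqF.
rewrite WW.
have zr : z * (1 + (z * (1 + r) - 1)) = z * z * (1 + r) by ring.
rewrite zr in h2.
have h3 : `|I1 - I3| <= `|I1 - I2| + `|I2 - I3|.
  by rewrite (le_trans _ (ler_normD _ _))// addrA subrK.
apply: (le_trans h3); apply: (le_trans (lerD h1 h2)).
have zr1 : 0 <= z * (1 + r) by rewrite mulr_ge0// ?addr_ge0//; lra.
have zr2 : z * (1 + r) <= z * z * (1 + r).
  by rewrite -mulrA ler_peMl.
set Z1 := (z * (1 + r) + 5) ^+ 2; set Z2 := (_ + 5) ^+ 2.
have ZZ : Z1 <= Z2 by rewrite lerXn2r ?nnegrE//; lra.
have Z10 : 0 <= Z1 by exact: sqr_ge0.
rewrite (_ : L * (y * y) * kap * Z2 * (2 * W) =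
  L * y * y * kap * Z2 * W + L * y * y * kap * Z2 * W); last by ring.
rewrite lerD2r; apply: ler_wpM2r => //; apply: ler_pM => //.
  by rewrite mulr_ge0.
by apply: ler_wpM2r => //; rewrite ler_peMr.
Qed.

(* The parameters are chosen in the order eps, then j. *)
Lemma small_zero (I A1 A2 A3 e0 : R) j0 : 0 < e0 -> 0 <= A1 ->
  (forall eps j, 0 < eps -> eps <= e0 -> (j0 <= j)%N ->
     `|I| <= A1 * eps + A2 / (2 ^+ j * eps) + A3 / 2 ^+ j) -> I = 0.
Proof.
move=> e00 A10 IA; apply/eqP; rewrite -normr_le0; apply/ler_addgt0Pr => e e_gt0.
have A1' : 0 < A1 + 1 by rewrite ltr_wpDl.
pose eps := Num.min e0 (e / 2 / (A1 + 1)).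
have eps0 : 0 < eps by rewrite lt_min e00/= divr_gt0// divr_gt0.
have epse : A1 * eps <= e / 2.
  rewrite (@le_trans _ _ ((A1 + 1) * eps))//; first by rewrite ler_wpM2r ?(ltW eps0)// lerDl.
  by rewrite mulrC -ler_pdivlMr// /eps ge_min lexx orbT.
have e2 : 0 < e / 2 by rewrite divr_gt0.
have [j1 j1P] := pow2_small (A2 / eps + A3) e2.
have := IA eps (maxn j0 j1) eps0; rewrite /eps ge_min lexx leq_maxl -/eps => /(_ isT isT).
have := j1P _ (leq_maxr j0 j1); rewrite add0r.
have -> : A2 / (2 ^+ maxn j0 j1 * eps) = A2 / eps / 2 ^+ maxn j0 j1.
  by rewrite [2 ^+ _ * _]mulrC invfM mulrA.
by rewrite [(A2 / eps + A3) / _]mulrDl; lra.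
Qed.

(** The lower bound on |X x| survives the limit, so phi composed with X is again a compactly
    supported Lipschitz test, and comparing integrals of such tests identifies the image of the
    measure. The distance to the Euler step is the level 0 of the sewing estimate. *)
Lemma flow_map s t : 0 <= s -> s <= t -> t <= M -> exists X : E -> E,
  [/\ lip (expR (c * (t - s))) X,
      forall A, measurable A -> mu (tau t) A = mu (tau s) (X @^-1` A),
      forall x, `|X x - step s t x|
        <= 2 * (c ^+ 2 * expR (c * (t - s)) * (t - s) ^+ 2 * (1 + `|x|)) &
      forall x, 1 + `|x| <= expR (2 * c * (t - s)) * (1 + `|X x|)].
Proof.
move=> s0 st tM.
have [X [XL XD]] := sewing c_ge0 (sqr_ge0 c) step_lip step_growth step_defect s0 st tM.
set D := t - s in XL XD *; have D0 : 0 <= D by rewrite subr_ge0.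
set y := expR (c * D) in XL XD *; set z := expR (2 * c * D).
have y0 : 0 <= y by exact: expR_ge0.
have z0 : 0 <= z by exact: expR_ge0.
set B := c ^+ 2 * y * D ^+ 2 in XD *.
have B0 : 0 <= B by rewrite mulr_ge0 ?sqr_ge0// mulr_ge0 ?sqr_ge0.
have [j0 j0P] := pow2_small (2 * (c * D)) ltr01.
have jP j : (j0 <= j)%N -> c * D <= 2 ^+ j / 2.
  move=> /j0P; rewrite ler_pdivrMr ?exprn_gt0// mul1r; lra.
have Xlow x : 1 + `|x| <= z * (1 + `|X x|).
  apply/ler_addgt0Pr => e e0.
  have [j1 j1P] := pow2_small (z * (2 * (B * (1 + `|x|)))) e0.
  have {}j1P := j1P _ (leq_maxr j0 j1).
  have h1 := dyadic_low s0 st tM (jP _ (leq_maxl j0 j1)) x; rewrite -/D -/z in h1.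
  have h2 := XD (maxn j0 j1) x.
  set w := dyadic _ _ _ _ _ in h1 h2.
  have h3 : `|w| <= `|X x - w| + `|X x|.
    by rewrite distrC (le_trans _ (ler_normD _ _))// subrK.
  apply: (le_trans h1).
  have h4 : 1 + `|w| <= 1 + `|X x| + 2 * (B * (1 + `|x|)) / 2 ^+ maxn j0 j1 by lra.
  rewrite (le_trans (ler_wpM2l z0 h4))// mulrDr lerD2l.
  by rewrite [leLHS]mulrA.
exists X; split => //; last first.
  by move=> x; have := XD 0%N x; rewrite expr0 divr1.
have mX := lip_measurable_rV XL.
have [Q [QA _ Qint]] := prob_image (mu (tau s)) mX.
suff QE : forall A, measurable A -> mu (tau t) A = Q A.
  by move=> A mA; rewrite QE// QA.
apply: eq_prob_lipc => L r phi Lphi'.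
wlog [L0 r0] : L r Lphi' / 0 <= L /\ 0 <= r.
  move=> H; apply: (H `|L| `|r|) => //; case: Lphi' => h1 h2; split.
    by move=> a b; rewrite (le_trans (h1 a b))// ler_wpM2r// ler_norm.
  by move=> a ra; apply: h2; rewrite (le_trans _ ra)// ler_norm.
have Lphi := Lphi'.
have lcX : lipc (L * y) (z * (1 + r) - 1) (phi \o X).
  by apply: (lipc_comp (A := z) (r := r)) => //; rewrite [leRHS]addrC subrK.
rewrite Qint; [|exact: lip_measurable Lphi.1|exact: lipc_integrable lcX].
set I1 := \int[_]_x phi x; set I2 := \int[_]_x phi (X x).
apply/eqP; rewrite -subr_eq0; apply/eqP.
pose P := mu (tau s).
(* [A1] gathers the two averaging errors and the part of order eps of the Euler error, [A2] the rest
   of the Euler error, and [A3] the distance from the dyadic map to X on the common support. *)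
pose A1 := L * d%:R + L * y * d%:R + L * y * kap * (z * (1 + r) + 5) ^+ 2 * D.
pose A2 := L * y * kap * (z * (1 + r) + 5) ^+ 2 * D ^+ 2.
pose A3 := L * (2 * (B * (z * (1 + r)))).
have kap0 : 0 <= kap.
  by rewrite /kap; apply: addr_ge0; apply: mulr_ge0 => //; rewrite mulr_ge0 ?sqr_ge0.
have Ly0 : 0 <= L * y by rewrite mulr_ge0.
have A10 : 0 <= A1.
  apply: addr_ge0; first by rewrite addr_ge0// mulr_ge0.
  by rewrite mulr_ge0// mulr_ge0 ?sqr_ge0// mulr_ge0.
have d1 : 0 < d%:R + 1 :> R by rewrite ltr_wpDl.
apply: (@small_zero _ A1 A2 A3 (d%:R + 1)^-1 j0) => //.
move=> eps j e0 ee jj.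
have e1 : eps <= 1 by rewrite (le_trans ee)// invf_le1// lerDr.
have de1 : d%:R * eps <= 1.
  rewrite (@le_trans _ _ ((d%:R + 1) * eps))//; first by rewrite ler_wpM2r ?(ltW e0)// lerDl.
  by rewrite mulrC -ler_pdivlMr// mul1r.
have cj := jP j jj.
have b1 := dyadic_base s0 st tM cj e0 e1 de1 L0 r0 Lphi; rewrite -/D -/y -/z in b1.
have lcD := lipc_dyadic s0 st tM cj L0 Lphi; rewrite -/D -/y -/z in lcD.
pose J1 := \int[mu (tau t)]_x S eps phi x.
pose J2 := \int[P]_x S eps (phi \o DD j s t) x.
pose J3 := \int[P]_x (phi \o DD j s t) x.
have close (Pr : probability E R) (K rr : R) psi : 0 <= K -> lipc K rr psi ->
    `|\int[Pr]_x psi x - \int[Pr]_x S eps psi x| <= K * (d%:R * eps).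
  move=> K0 Kpsi; have Kw := lipc_avgs e0 (enum 'I_d) K0 Kpsi.
  rewrite -RintegralB//; [|exact: lipc_integrable Kpsi|exact: lipc_integrable Kw].
  apply: ler_norm_Rintegral_prob.
    by apply: measurable_funB; [exact: lip_measurable Kpsi.1|exact: lip_measurable Kw.1].
  move=> x; rewrite distrC; have := avgs_near e0 (enum 'I_d) x K0 Kpsi.1.
  by rewrite size_enum_ord.
have c1 := close (mu (tau t)) _ _ _ L0 Lphi; rewrite -/I1 -/J1 in c1.
have c3 := close P _ _ _ Ly0 lcD; rewrite -/J3 -/J2 in c3.
have c4 : `|J3 - I2| <= A3 / 2 ^+ j.
  rewrite /J3 /I2 -RintegralB//; [|exact: lipc_integrable lcD|exact: lipc_integrable lcX].
  apply: ler_norm_Rintegral_prob.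
    by apply: measurable_funB; [exact: lip_measurable lcD.1|exact: lip_measurable lcX.1].
  move=> x; have p2 : 0 < 2 ^+ j :> R by rewrite exprn_gt0.
  have zr0 : 0 <= z * (1 + r) by rewrite mulr_ge0// addr_ge0.
  have [xr|rx] := ltP `|x| (z * (1 + r) - 1); last first.
    rewrite -[phi (X x)]/((phi \o X) x) (lcD.2 _ rx) (lcX.2 _ rx) subrr normr0.
    by rewrite divr_ge0 ?(ltW p2)// mulr_ge0// mulr_ge0// mulr_ge0.
  rewrite (le_trans (Lphi.1 _ _))// /A3 -mulrA ler_wpM2l// distrC.
  rewrite (le_trans (XD j x))// ler_pM2r ?invr_gt0// ler_wpM2l// ler_wpM2l//.
  by lra.
have b1' : `|J1 - J2| <= L * y * kap * (z * (1 + r) + 5) ^+ 2 * D * eps + A2 / (2 ^+ j * eps).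
  by rewrite (le_trans b1)//; apply: le_of_eq; rewrite /A2; ring.
have c5 : `|I1 - I2| <= `|I1 - J1| + `|J1 - J2| + `|J3 - J2| + `|J3 - I2|.
  clear; rewrite [`|J3 - J2|]distrC.
  rewrite (_ : I1 - I2 = (I1 - J1) + (J1 - J2) + (J2 - J3) + (J3 - I2)); last by ring.
  by do 3 (rewrite (le_trans (ler_normD _ _))// lerD2r).
apply: (le_trans c5); rewrite /A1 !(mulrDl _ _ eps).
have := lerD (lerD (lerD c1 b1') c3) c4; rewrite !mulrA.
move: (L * d%:R * eps) (L * y * d%:R * eps) (L * y * kap * _ * _ * D * eps) (A2 / _) (A3 / _).
by clear; move=> *; lra.
Qed.

(** The complement of the good times in [0, T] is null, whereas [0, T] has positive length. *)
Lemma good_time : exists t, [/\ 0 <= t, t <= T & good t].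
Proof.
have [//|ng] := pselect (exists t, [/\ 0 <= t, t <= T & good t]).
have [N [mN N0 sub]] := ae_good.
have : (lam `[0%R, T] <= lam N)%E.
  apply: le_measure; rewrite ?inE//.
  apply: subset_trans sub => t /= t01 /(_ t01) gt; apply: ng; exists t.
  by move: t01; rewrite in_itv/= => /andP[].
rewrite [X in (_ <= X)%E]N0 lebesgue_measure_itv/= lte_fin T_gt0 -EFinB lee_fin subr0.
by rewrite leNgt T_gt0.
Qed.

Lemma measurable_sqD1 : measurable_fun [set: E] (fun y : E => (1 + `|y|) ^+ 2).
Proof.
by apply: measurable_funX; apply: measurable_funD => //; exact: measurable_norm_rV.
Qed.

Lemma flow_disp X s t : 0 <= s -> s <= t -> t <= M ->
  (forall x, `|X x - step s t x|
     <= 2 * (c ^+ 2 * expR (c * (t - s)) * (t - s) ^+ 2 * (1 + `|x|))) ->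
  forall x, `|X x - x| <= (c + 2 * c ^+ 2 * expR (c * (t - s)) * (t - s)) * (t - s) * (1 +
    `|x|).
Proof.
move=> s0 st tM XD x; have h1 := XD x; have h2 := step_disp x s0 st tM.
have h3 : `|X x - x| <= `|X x - step s t x| + `|step s t x - x|.
  by rewrite (le_trans _ (ler_normD _ _))// addrA subrK.
apply: (le_trans h3); apply: (le_trans (lerD h1 h2)).
by apply: le_of_eq; ring.
Qed.

Lemma flow_moment s t X (K : R) : 0 <= s -> s <= t -> t <= M -> 0 <= K ->
  measurable_fun setT X ->
  (forall A, measurable A -> mu (tau t) A = mu (tau s) (X @^-1` A)) ->
  (forall x, 1 + `|X x| <= K * (1 + `|x|)) ->
  (mu (tau s)).-integrable setT (EFin \o (fun y => (1 + `|y|) ^+ 2)) ->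
  (mu (tau t)).-integrable setT (EFin \o (fun y => (1 + `|y|) ^+ 2)) /\
  \int[mu (tau t)]_y (1 + `|y|) ^+ 2 <= K ^+ 2 * \int[mu (tau s)]_y (1 + `|y|) ^+ 2.
Proof.
move=> s0 st tM K0 mX muX XK is_.
have b x : (1 + `|X x|) ^+ 2 <= K ^+ 2 * (1 + `|x|) ^+ 2 + 0 * (1 + `|x|) ^+ 2 + 0 * (1 +
    `|x|) ^+ 2.
  rewrite !mul0r !addr0 -exprMn lerXn2r ?nnegrE//.
  by rewrite mulr_ge0// addr_ge0.
have mXX : measurable_fun setT (fun x => (1 + `|X x|) ^+ 2).
  exact: (measurableT_comp measurable_sqD1 mX).
have [h1 h2] := Rintegral_le_comb mXX (fun x => sqr_ge0 _) is_ is_ is_ b.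
have it := (image_integrable mX muX measurable_sqD1).2 h1.
split => //; rewrite (image_Rintegral mX muX measurable_sqD1 it).
by rewrite !mul0r !addr0 in h2.
Qed.

(* Moments are bounded backwards in time because the flow map is proper:
   1 + |x| is at most exp(2 c (t - s)) (1 + |X x|). *)
Lemma back_moment s t : 0 <= s -> s <= t -> t <= M -> good (tau t) ->
  (mu (tau s)).-integrable setT (EFin \o (fun y => (1 + `|y|) ^+ 2)) /\
  \int[mu (tau s)]_y (1 + `|y|) ^+ 2 <= 2 * expR (4 * c * (t - s)) * h (tau t).
Proof.
move=> s0 st tM gt; have [it ht] := mu_moment gt.
have [X [XL muX _ Xlow]] := flow_map s0 st tM.
have mX := lip_measurable_rV XL.
have mq : measurable_fun [set: E] (fun y : E => 1 + `|y| ^+ 2).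
  by apply: measurable_funD => //; apply: measurable_funX; exact: measurable_norm_rV.
have itX := (image_integrable mX muX mq).1 it.
rewrite (image_Rintegral mX muX mq it) in ht.
set z := expR (2 * c * (t - s)) in Xlow.
have z0 : 0 <= z by exact: expR_ge0.
have zz : expR (4 * c * (t - s)) = z ^+ 2 by rewrite /z -expRM_natl; congr expR; ring.
have b x : (1 + `|x|) ^+ 2 <= 2 * z ^+ 2 * (1 + `|X x| ^+ 2) + 0 * (1 + `|X x| ^+ 2) + 0 *
    (1 + `|X x| ^+ 2).
  rewrite !mul0r !addr0 (@le_trans _ _ ((z * (1 + `|X x|)) ^+ 2))//.
    by rewrite lerXn2r ?nnegrE// ?mulr_ge0 ?addr_ge0.
  rewrite exprMn (_ : 2 * z ^+ 2 * _ = z ^+ 2 * (2 * (1 + `|X x| ^+ 2))); last by ring.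
  rewrite ler_wpM2l ?sqr_ge0//.
  by have := sqr_ge0 (1 - `|X x|); rewrite sqrrB sqrrD; lra.
have [h1 h2] := Rintegral_le_comb measurable_sqD1 (fun x => sqr_ge0 _) itX itX itX b.
split => //; apply: (le_trans h2); rewrite !mul0r !addr0 zz.
by rewrite ler_wpM2l// mulr_ge0// sqr_ge0.
Qed.

(** One good time is enough: its moment bound is carried back to time 0 by [back_moment], then
    forward to all times by the displacement bound of the flow maps. *)
Lemma moment_bounded : exists B, 1 <= B /\ forall s, 0 <= s -> s <= M ->
  (mu (tau s)).-integrable setT (EFin \o (fun y => (1 + `|y|) ^+ 2)) /\
  \int[mu (tau s)]_y (1 + `|y|) ^+ 2 <= B.
Proof.
have [q [q0 qT gq]] := good_time.
have mq0 : 0 <= m q by apply: Rintegral_ge0 => r _; exact: h_ge0.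
have mqM : m q <= M.
  by rewrite -subr_ge0 (le_trans _ (clock_ge h_ge1 h_int q0 qT (lexx _)))// subr_ge0.
have M0 : 0 <= M by exact: le_trans mqM.
have gq' : good (tau (m q)) by rewrite (clockK T_gt0 h_ge1 h_int).
have [i0 b0] := back_moment (lexx 0) mq0 mqM gq'.
set B0 := \int[mu (tau 0)]_y _ in b0.
pose K := 1 + (c + 2 * c ^+ 2 * expR (c * M) * M) * M.
have K0 : 0 <= K.
  apply: addr_ge0 => //; apply: mulr_ge0 => //; apply: addr_ge0 => //.
  by rewrite mulr_ge0// mulr_ge0 ?expR_ge0// mulr_ge0 ?sqr_ge0.
exists (Num.max 1 (K ^+ 2 * B0)); split => [|s s0 sM]; first by rewrite le_max lexx.
have [X [XL muX XD _]] := flow_map (lexx 0) s0 sM.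
have mX := lip_measurable_rV XL.
have XK x : 1 + `|X x| <= K * (1 + `|x|).
  have h1 := flow_disp (lexx 0) s0 sM XD x; rewrite subr0 in h1.
  have h2 : `|X x| <= `|X x - x| + `|x| by rewrite (le_trans _ (ler_normD _ _))// subrK.
  have h3 : (c + 2 * c ^+ 2 * expR (c * s) * s) * s <= (c + 2 * c ^+ 2 * expR (c * M) * M) * M.
    apply: ler_pM => //.
      by rewrite addr_ge0// mulr_ge0// mulr_ge0 ?expR_ge0// mulr_ge0 ?sqr_ge0.
    rewrite lerD2l; apply: ler_pM => //.
      by rewrite mulr_ge0 ?expR_ge0// mulr_ge0 ?sqr_ge0.
    by rewrite ler_wpM2l ?mulr_ge0 ?sqr_ge0// ler_expR ler_wpM2l.
  have x0 : 0 <= 1 + `|x| by rewrite addr_ge0.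
  by have := ler_wpM2r x0 h3; rewrite /K; lra.
have [h1 h2] := flow_moment (lexx 0) s0 sM K0 mX muX XK i0.
by split => //; rewrite (le_trans h2)// le_max lexx orbT.
Qed.

End flow.

(** * Coupling two solutions *)

Section drift_difference.
Context {R : realType} {d : nat}.
Local Notation E := 'rV[R]_d.
Variables (F : 'I_d -> E -> E -> R) (c : R).
Hypothesis c_ge0 : 0 <= c.
Hypothesis F_bound : forall i x y,
  `|F i x y| <= c * (1 + `|x|) * (1 + `|y| ^+ 2).
Hypothesis F_lip1 : forall i x x' y,
  `|F i x y - F i x' y| <= c * (1 + `|y| ^+ 2) * `|x - x'|.
Hypothesis F_lip2 : forall i x y y',
  `|F i x y - F i x y'| <= c * (1 + `|x|) * (1 + `|y| + `|y'|) * `|y - y'|.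

Lemma measurable_normB d1 (T : measurableType d1) (U W : T -> E) :
  measurable_fun setT U -> measurable_fun setT W ->
  measurable_fun setT (fun z => `|U z - W z|).
Proof.
move=> mU mW; apply: (measurableT_comp (f := fun v : E => `|v|)).
  exact: measurable_norm_rV.
apply: measurable_fun_rVP => i; under eq_fun do rewrite !mxE.
by apply: measurable_funB; apply: (measurableT_comp (measurable_coord i)).
Qed.

(** Young's inequality with weights N and S replaces Cauchy-Schwarz: N (1 + |U| + |W|) |U - W| is at
    most 3/2 S times the two moment integrands, plus N^2 / (2S) |U - W|^2. After integration N^2 <=
    A H makes every term linear in H, the density of the clock. *)
Lemma drift_diff d1 (T : measurableType d1) (g : probability T R)
    (mu nu : probability E R) (U W : T -> E) (H S N A : R) :
  measurable_fun setT U -> measurable_fun setT W ->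
  (forall B, measurable B -> mu B = g (U @^-1` B)) ->
  (forall B, measurable B -> nu B = g (W @^-1` B)) ->
  mu.-integrable setT (EFin \o (fun y => 1 + `|y| ^+ 2)) ->
  nu.-integrable setT (EFin \o (fun y => 1 + `|y| ^+ 2)) ->
  \int[mu]_y (1 + `|y| ^+ 2) <= H -> \int[nu]_y (1 + `|y| ^+ 2) <= H ->
  g.-integrable setT (EFin \o (fun z => `|U z - W z| ^+ 2)) ->
  \int[g]_z `|U z - W z| ^+ 2 <= S ^+ 2 -> 0 < S -> 0 < N -> N ^+ 2 <= A * H ->
  forall i x y, N * `|drift F mu x 0 i - drift F nu y 0 i|
    <= (N * c * `|x - y| + c * (1 + `|y|) * ((6 + A) / 2) * S) * H.
Proof.
move=> mU mW muU nuW imu inu muH nuH iUW UWS S0 N0 NA i x y.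
have mq : measurable_fun [set: E] (fun y : E => 1 + `|y| ^+ 2).
  by apply: measurable_funD => //; apply: measurable_funX; exact: measurable_norm_rV.
have iU := (image_integrable mU muU mq).1 imu.
have iW := (image_integrable mW nuW mq).1 inu.
have eU := image_Rintegral mU muU mq imu.
have eW := image_Rintegral mW nuW mq inu.
have mF x' : measurable_fun setT (F i x') by exact: F_measurable1 F_lip2 i x'.
have iF1 := F_integrable c_ge0 F_bound F_lip2 imu i x.
have iF2 := F_integrable c_ge0 F_bound F_lip2 inu i y.
have iF1U := (image_integrable mU muU (mF x)).1 iF1.
have iF2W := (image_integrable mW nuW (mF y)).1 iF2.
rewrite !mxE (image_Rintegral mU muU (mF x) iF1) (image_Rintegral mW nuW (mF y) iF2).
rewrite -RintegralB//.
pose D z := `|F i x (U z) - F i y (W z)|.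
have mD : measurable_fun setT D.
  apply: measurableT_comp => //; apply: measurable_funB.
    exact: (measurableT_comp (mF x)).
  exact: (measurableT_comp (mF y)).
have N0' := ltW N0; have y0 : 0 <= 1 + `|y| by rewrite addr_ge0.
have cy0 : 0 <= c * (1 + `|y|) by rewrite mulr_ge0.
pose a1 := N * c * `|x - y| + c * (1 + `|y|) * (3 / 2 * S).
pose a2 := c * (1 + `|y|) * (3 / 2 * S).
pose a3 := c * (1 + `|y|) * (N ^+ 2 / (2 * S)).
have key z : N * D z <= a1 * (1 + `|U z| ^+ 2) + a2 * (1 + `|W z| ^+ 2) + a3 * `|U z - W z|
    ^+ 2.
  have h1 := F_lip1 i x y (U z); have h2 := F_lip2 i y (U z) (W z).
  have h3 : D z <= `|F i x (U z) - F i y (U z)| + `|F i y (U z) - F i y (W z)|.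
    by rewrite /D (le_trans _ (ler_normD _ _))// addrA subrK.
  have {h1 h2}h4 : D z <= c * `|x - y| * (1 + `|U z| ^+ 2) +
      c * (1 + `|y|) * ((1 + `|U z| + `|W z|) * `|U z - W z|) by lra.
  have h5 := ler_wpM2l N0' h4.
  set u := `|U z| in h5 *; set w := `|W z| in h5 *; set dl := `|U z - W z| in h5 *.
  have h6 : N * ((1 + u + w) * dl) <= 3 / 2 * S * ((1 + u ^+ 2) + (1 + w ^+ 2))
      + N ^+ 2 / (2 * S) * dl ^+ 2.
    have i1 : N ^+ 2 / (2 * S) * dl ^+ 2 = (N * dl / S) ^+ 2 * (S / 2).
      by field; rewrite gt_eqF.
    have i2 : N * ((1 + u + w) * dl) = S * ((1 + u + w) * (N * dl / S)).
      by field; rewrite gt_eqF.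
    rewrite i1 i2; move: (N * dl / S) => v.
    rewrite (_ : 3 / 2 * S * _ + _ = S * (3 / 2 * (1 + u ^+ 2 + (1 + w ^+ 2)) + v ^+ 2 /
        2)); last by ring.
    rewrite ler_pM2l//.
    have := sqr_ge0 (1 + u + w - v); have := sqr_ge0 (1 - u); have := sqr_ge0 (u - w).
    have := sqr_ge0 (1 - w); rewrite !sqrrB !sqrrD; lra.
  have h7 := ler_wpM2l cy0 h6; apply: (le_trans h5).
  have -> : N * (c * `|x - y| * (1 + u ^+ 2) + c * (1 + `|y|) * ((1 + u + w) * dl)) =
    N * c * `|x - y| * (1 + u ^+ 2) + c * (1 + `|y|) * (N * ((1 + u + w) * dl)) by ring.
  have -> : a1 * (1 + u ^+ 2) + a2 * (1 + w ^+ 2) + a3 * dl ^+ 2 =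
    N * c * `|x - y| * (1 + u ^+ 2) + c * (1 + `|y|) *
      (3 / 2 * S * (1 + u ^+ 2 + (1 + w ^+ 2)) + N ^+ 2 / (2 * S) * dl ^+ 2).
    by rewrite /a1 /a2 /a3; ring.
  by rewrite lerD2l.
have iD : g.-integrable setT (EFin \o D).
  have -> : EFin \o D = (abse \o (EFin \o (fun z => F i x (U z) - F i y (W z)))) by [].
  apply: integrable_abse.
  rewrite (_ : EFin \o _ = (EFin \o (F i x \o U)) \- (EFin \o (F i y \o W)))%E//.
  exact: integrableB.
have mND : measurable_fun setT (fun z => N * D z) by exact: measurable_funM.
have ND0 z : 0 <= N * D z by rewrite mulr_ge0// /D.
have [_ le1] := Rintegral_le_comb mND ND0 iU iW iUW key.
have le2 : N * `|\int[g]_z (F i x (U z) - F i y (W z))| <= \int[g]_z (N * D z).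
  rewrite RintegralZl// ler_wpM2l//; apply: ler_norm_Rintegral => //.
  apply: measurable_funB; first exact: (measurableT_comp (mF x)).
  exact: (measurableT_comp (mF y)).
apply: (le_trans le2); apply: (le_trans le1).
have sA : 0 <= 3 / 2 * S by rewrite mulr_ge0// ltW.
have a20 : 0 <= a2 by rewrite mulr_ge0.
have a10 : 0 <= a1 by rewrite addr_ge0// mulr_ge0// mulr_ge0.
have a30 : 0 <= a3 by rewrite mulr_ge0// divr_ge0 ?sqr_ge0// mulr_ge0// ltW.
rewrite eU in muH; rewrite eW in nuH.
have l1 := ler_wpM2l a10 muH; have l2 := ler_wpM2l a20 nuH; have l3 := ler_wpM2l a30 UWS.
have l4 : a3 * S ^+ 2 <= c * (1 + `|y|) * (A * H * (S / 2)).
  rewrite (_ : a3 * S ^+ 2 = c * (1 + `|y|) * (N ^+ 2 * (S / 2))); last first.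
    by rewrite /a3; field; rewrite gt_eqF.
  by apply: ler_wpM2l => //; apply: ler_wpM2r => //; rewrite divr_ge0// ltW.
apply: (le_trans (lerD (lerD l1 l2) (le_trans l3 l4))).
by apply: le_of_eq; rewrite /a1 /a2; field.
Qed.

End drift_difference.

(** With weight D, the main square is inflated by 1 + D only, while perturbations a and b of size
    O(D) cost O(D) in spite of the factor 4 / D. The condition D <= 1 bounds 1 + 1 / D by 2 / D. *)
Lemma young3 (R : realType) (u a b D p q : R) : 0 < D -> D <= 1 ->
  `|a| <= p -> `|b| <= q ->
  (u + a + b) * (u + a + b) <= (1 + D) * (u * u) + 4 / D * (p ^+ 2 + q ^+ 2).
Proof.
move=> D0 D1 ap bq.
have ap2 : a ^+ 2 <= p ^+ 2.
  by rewrite -real_normK ?num_real// lerXn2r ?nnegrE// (le_trans _ ap).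
have bq2 : b ^+ 2 <= q ^+ 2.
  by rewrite -real_normK ?num_real// lerXn2r ?nnegrE// (le_trans _ bq).
have k1 : 1 <= D^-1 by rewrite invf_ge1.
have kD : D^-1 * D = 1 by rewrite mulVf// gt_eqF.
move: (D^-1) k1 kD => k k1 kD; have k0 : 0 <= k by lra.
have h1 : 0 <= D * (u - k * (a + b)) ^+ 2 by rewrite mulr_ge0 ?sqr_ge0// ltW.
have h2 : D * (u - k * (a + b)) ^+ 2 =
    D * (u * u) - 2 * (k * D) * (u * (a + b)) + k * D * (k * (a + b) ^+ 2) by ring.
rewrite kD in h2.
have h3 : (a + b) ^+ 2 <= k * (a + b) ^+ 2 by rewrite ler_peMl// sqr_ge0.
have h4 : k * (a + b) ^+ 2 <= k * (2 * (p ^+ 2 + q ^+ 2)).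
  apply: ler_wpM2l => //; have := sqr_ge0 (a - b); rewrite sqrrB sqrrD; lra.
have -> : (u + a + b) * (u + a + b) = u * u + 2 * (u * (a + b)) + (a + b) ^+ 2 by ring.
by lra.
Qed.

(** * Evolution of the cost of a coupling *)

Section two_flows.
Context {R : realType} {d : nat}.
Local Notation E := 'rV[R]_d.
Local Notation lam := (@lebesgue_measure R).
Variables (F : 'I_d -> E -> E -> R) (c : R).
Hypothesis c_ge0 : 0 <= c.
Hypothesis F_bound : forall i x y,
  `|F i x y| <= c * (1 + `|x|) * (1 + `|y| ^+ 2).
Hypothesis F_lip1 : forall i x x' y,
  `|F i x y - F i x' y| <= c * (1 + `|y| ^+ 2) * `|x - x'|.
Hypothesis F_lip2 : forall i x y y',
  `|F i x y - F i x y'| <= c * (1 + `|x|) * (1 + `|y| + `|y'|) * `|y - y'|.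
Variables (mu nu : R -> probability E R) (T : R) (h : R -> R) (good : set R).
Hypotheses (mu_weak : weak_eq F mu) (nu_weak : weak_eq F nu).
Hypothesis mu_neg : forall t, t <= 0 -> mu t = mu 0.
Hypothesis nu_neg : forall t, t <= 0 -> nu t = nu 0.
Hypothesis T_gt0 : 0 < T.
Hypothesis h_ge1 : forall t, 1 <= h t.
Hypothesis h_int : lam.-integrable `[0, T] (EFin \o h).
Hypothesis measurable_good : measurable good.
Hypothesis ae_good : {ae lam, forall t, `[0, T]%classic t -> good t}.
Hypothesis mu_moment : forall t, good t ->
  (mu t).-integrable [set: E] (EFin \o (fun y => 1 + `|y| ^+ 2)) /\
  \int[mu t]_y (1 + `|y| ^+ 2) <= h t.
Hypothesis nu_moment : forall t, good t ->
  (nu t).-integrable [set: E] (EFin \o (fun y => 1 + `|y| ^+ 2)) /\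
  \int[nu t]_y (1 + `|y| ^+ 2) <= h t.

Local Notation m := (clock h).
Local Notation M := (clock h T).
Local Notation tau := (time T h).
Local Notation sq := (fun y : E => (1 + `|y|) ^+ 2).
Local Notation dist2 := (fun z : E * E => enorm (z.1 - z.2) ^+ 2).

Let flow_mu := flow_map c_ge0 F_bound F_lip1 F_lip2 mu_weak mu_neg T_gt0 h_ge1
  h_int measurable_good ae_good mu_moment.
Let flow_nu := flow_map c_ge0 F_bound F_lip1 F_lip2 nu_weak nu_neg T_gt0 h_ge1
  h_int measurable_good ae_good nu_moment.

(** Constants for clock steps of length at most 1: [A] compares an initial moment with h at a later
    time, [A'] is the resulting coefficient in [drift_diff], [K0] controls the displacement of a
    flow map, and [Ke] its distance to the Euler step. *)
Let A : R := 2 * expR (4 * c).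
Let A' : R := (6 + A) / 2.
Let K0 : R := c + 2 * c ^+ 2 * expR c.
Let Ke : R := 2 * (c ^+ 2 * expR c).

Let A_ge0 : 0 <= A. Proof. by rewrite mulr_ge0// expR_ge0. Qed.
Let A'_ge0 : 0 <= A'. Proof. by rewrite divr_ge0// addr_ge0. Qed.
Let K0_ge0 : 0 <= K0.
Proof. by rewrite addr_ge0// mulr_ge0 ?expR_ge0// mulr_ge0// sqr_ge0. Qed.
Let Ke_ge0 : 0 <= Ke.
Proof. by rewrite mulr_ge0// mulr_ge0 ?expR_ge0// sqr_ge0. Qed.

(** The term 1 is the price of Young's inequality, 8 d c^2 comes from the Lipschitz dependence on
    the position, and the last term from the dependence on the measure; its 24 is 8 times the 3 of
    [S2]. *)
Definition rate : R := 1 + 8 * d%:R * c ^+ 2 + 24 * d%:R * c ^+ 2 * A' ^+ 2.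

Lemma rate_gt0 : 0 < rate.
Proof.
rewrite /rate -addrA ltr_pwDl// addr_ge0//.
  by rewrite mulr_ge0 ?sqr_ge0// mulr_ge0.
by rewrite mulr_ge0 ?sqr_ge0// mulr_ge0 ?sqr_ge0// mulr_ge0.
Qed.

Section one_step.
Variables (B s t : R) (g : probability (E * E)%type R).
Hypotheses (s_ge0 : 0 <= s) (st : s < t) (tM : t <= M) (st1 : t - s <= 1).
Hypothesis B_ge0 : 0 <= B.
Hypothesis mu_B : (mu (tau s)).-integrable setT (EFin \o sq) /\
  \int[mu (tau s)]_y sq y <= B.
Hypothesis nu_B : (nu (tau s)).-integrable setT (EFin \o sq) /\
  \int[nu (tau s)]_y sq y <= B.
Hypothesis g_coupling : coupling (mu (tau s)) (nu (tau s)) g.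

Let g1 A0 : measurable A0 -> mu (tau s) A0 = g (fst @^-1` A0).
Proof. by move=> /g_coupling[]. Qed.
Let g2 A0 : measurable A0 -> nu (tau s) A0 = g (snd @^-1` A0).
Proof. by move=> /g_coupling[]. Qed.

Let m_s : R := \int[nu (tau s)]_y sq y.
Let f : R := \int[g]_z dist2 z.
Let Del : R := t - s.
(** [S2] dominates the squared distance of the transported pair at all intermediate times: a factor
    3 for the square of a sum of three terms, and 6 K0^2 B for the two displacements. The added 1
    keeps [S2] positive when the cost f vanishes, since S is a divisor. *)
Let KB : R := 6 * (K0 ^+ 2 * B + 1).
Let S2 : R := 3 * f + KB * Del ^+ 2.
Let S : R := Num.sqrt S2.
Let N : R := Num.sqrt m_s.

Let Del_gt0 : 0 < Del. Proof. by rewrite subr_gt0. Qed.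

Lemma coupling_moment1 : g.-integrable setT (EFin \o (fun z : E * E => sq z.1)) /\
  \int[g]_z sq z.1 <= B.
Proof.
have [i1 b1] := mu_B; split.
  exact: (image_integrable measurable_fst g1 measurable_sqD1).1 i1.
by rewrite -(image_Rintegral measurable_fst g1 measurable_sqD1 i1).
Qed.

Lemma coupling_moment2 : g.-integrable setT (EFin \o (fun z : E * E => sq z.2)) /\
  \int[g]_z sq z.2 = m_s.
Proof.
have [i2 b2] := nu_B; split.
  exact: (image_integrable measurable_snd g2 measurable_sqD1).1 i2.
by rewrite -(image_Rintegral measurable_snd g2 measurable_sqD1 i2).
Qed.

Lemma m_s_ge1 : 1 <= m_s.
Proof.
have [i2 _] := nu_B.
rewrite -(Rintegral_prob_cst (nu (tau s)) 1); apply: le_Rintegral => //.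
  by apply: (@integrable_prob _ _ _ _ _ 1) => // x; rewrite normr1.
by move=> x _; rewrite exprn_ege1// lerDl.
Qed.

Let N_gt0 : 0 < N. Proof. by rewrite sqrtr_gt0 (lt_le_trans ltr01 m_s_ge1). Qed.
Let N_sqr : N ^+ 2 = m_s.
Proof. by rewrite sqr_sqrtr// (le_trans ler01 m_s_ge1). Qed.
Let f_ge0 : 0 <= f. Proof. by apply: Rintegral_ge0 => z _; exact: sqr_ge0. Qed.
Let KB_gt0 : 0 < KB.
Proof. by rewrite mulr_gt0// ltr_wpDl// mulr_ge0// sqr_ge0. Qed.
Let S2_gt0 : 0 < S2.
Proof. by rewrite ltr_wpDl ?mulr_ge0// mulr_gt0// exprn_gt0. Qed.
Let S_gt0 : 0 < S. Proof. by rewrite sqrtr_gt0. Qed.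
Let S_sqr : S ^+ 2 = S2. Proof. by rewrite sqr_sqrtr// ltW. Qed.

Lemma measurable_dist2 : measurable_fun setT (fun z : E * E => dist2 z).
Proof.
rewrite (_ : (fun _ => _) = (fun v : E => enorm v ^+ 2) \o (fun z : E * E => z.1 - z.2))//.
apply: (measurableT_comp measurable_enorm2).
apply: measurable_fun_rVP => i; under eq_fun do rewrite !mxE.
apply: measurable_funB; apply: (measurableT_comp (measurable_coord i)).
  exact: measurable_fst.
exact: measurable_snd.
Qed.

Lemma integrable_dist2 : g.-integrable setT (EFin \o (fun z : E * E => dist2 z)).
Proof.
have [i1 _] := coupling_moment1; have [i2 _] := coupling_moment2.
have b z : dist2 z <= 2 * d%:R * sq z.1 + 2 * d%:R * sq z.2 + 0 * sq z.2.
  rewrite mul0r addr0 enorm_sqr (le_trans (dotp_le_norm _))//.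
  rewrite -mulrDr [2 * _]mulrC -mulrA ler_wpM2l//.
  have h1 : `|z.1 - z.2| <= (1 + `|z.1|) + (1 + `|z.2|).
    by rewrite (le_trans (ler_normB _ _))// lerD// lerDr.
  have h2 : `|z.1 - z.2| ^+ 2 <= ((1 + `|z.1|) + (1 + `|z.2|)) ^+ 2.
    by rewrite lerXn2r ?nnegrE// !addr_ge0.
  apply: (le_trans h2); move: (1 + `|z.1|) (1 + `|z.2|) => a b'.
  by have := sqr_ge0 (a - b'); rewrite sqrrB sqrrD; lra.
by have [] := Rintegral_le_comb measurable_dist2 (fun z => sqr_ge0 _) i1 i2 i2 b.
Qed.

(** The flow maps from the start of the step to time q push g to a coupling of the two measures at
    q, with distance at most S in L2, to which [drift_diff] applies. *)
Lemma vel_diff i q x y : tau s < q <= tau t ->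
  N * `|vel F mu good i (q, x) - vel F nu good i (q, y)|
    <= (N * c * `|x - y| + c * (1 + `|y|) * A' * S) * h q.
Proof.
have t0 : 0 <= t by rewrite (le_trans s_ge0)// ltW.
have sM : s <= M by rewrite (le_trans _ tM)// ltW.
move=> /andP[tsq qt].
have h0 : 0 <= h q by exact: h_ge0.
have [gq|ngq] := pselect (good q); last first.
  rewrite /vel/= indicE memNset// !mul0r subrr normr0 mulr0 mulr_ge0//.
  have y0 : 0 <= 1 + `|y| by rewrite addr_ge0.
  apply: addr_ge0; first by rewrite mulr_ge0// mulr_ge0// ltW.
  by rewrite mulr_ge0 ?(ltW S_gt0)// mulr_ge0// mulr_ge0.
rewrite !vel_good//.
have /andP[ts0 tsT] := time_itv h T_gt0 s; have /andP[tt0 ttT] := time_itv h T_gt0 t.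
have q0 : 0 <= q by rewrite (le_trans ts0)// ltW.
have qT : q <= T by exact: le_trans ttT.
have sm : s <= m q.
  by rewrite -{1}(timeK T_gt0 h_int s_ge0 sM) ltW// (clock_mono h_ge1 h_int).
have mt : m q <= t.
  rewrite -(timeK T_gt0 h_int t0 tM) -subr_ge0.
  by rewrite (le_trans _ (clock_ge h_ge1 h_int q0 qt ttT))// subr_ge0.
have mM : m q <= M by exact: le_trans tM.
have tmq : tau (m q) = q by rewrite (clockK T_gt0 h_ge1 h_int).
have [X [XL muX XD _]] := flow_mu s_ge0 sm mM.
have [Y [YL nuY YD _]] := flow_nu s_ge0 sm mM.
rewrite tmq in muX nuY.
have mX := lip_measurable_rV XL.
have mY := lip_measurable_rV YL.
have [imu hmu] := mu_moment gq; have [inu hnu] := nu_moment gq.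
have mqs1 : m q - s <= 1 by rewrite (le_trans _ st1)// lerD2r.
have mqs0 : 0 <= m q - s by rewrite subr_ge0.
have KK : (c + 2 * c ^+ 2 * expR (c * (m q - s)) * (m q - s)) * (m q - s) <= K0 * Del.
  have c20 : 0 <= 2 * c ^+ 2 by rewrite mulr_ge0 ?sqr_ge0.
  apply: ler_pM => //; last by rewrite /Del lerD2r.
    by rewrite addr_ge0// mulr_ge0// mulr_ge0 ?expR_ge0.
  rewrite lerD2l -[leRHS]mulr1; apply: ler_pM => //; first by rewrite mulr_ge0 ?expR_ge0.
  by rewrite ler_wpM2l// ler_expR ler_piMr.
have XK x' : `|X x' - x'| <= K0 * Del * (1 + `|x'|).
  have h1 := flow_disp c_ge0 F_bound F_lip1 F_lip2 mu_weak mu_neg T_gt0 h_ge1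
    h_int measurable_good mu_moment s_ge0 sm mM XD x'.
  by rewrite (le_trans h1)// ler_wpM2r ?addr_ge0.
have YK x' : `|Y x' - x'| <= K0 * Del * (1 + `|x'|).
  have h1 := flow_disp c_ge0 F_bound F_lip1 F_lip2 nu_weak nu_neg T_gt0 h_ge1
    h_int measurable_good nu_moment s_ge0 sm mM YD x'.
  by rewrite (le_trans h1)// ler_wpM2r ?addr_ge0.
pose U (z : E * E) := X z.1; pose W (z : E * E) := Y z.2.
have mU : measurable_fun setT U by exact: (measurableT_comp mX measurable_fst).
have mW : measurable_fun setT W by exact: (measurableT_comp mY measurable_snd).
have muU B0 : measurable B0 -> mu q B0 = g (U @^-1` B0).
  move=> mB; rewrite muX// g1//.
  by rewrite -[X in measurable X]setTI; exact: mX.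
have nuW B0 : measurable B0 -> nu q B0 = g (W @^-1` B0).
  move=> mB; rewrite nuY// g2//.
  by rewrite -[X in measurable X]setTI; exact: mY.
have [i1 b1] := coupling_moment1; have [i2 b2] := coupling_moment2.
have iD := integrable_dist2.
have mUW2 : measurable_fun setT (fun z => `|U z - W z| ^+ 2).
  by apply: measurable_funX; exact: measurable_normB.
pose kk := (K0 * Del) ^+ 2.
have kk0 : 0 <= kk by exact: sqr_ge0.
have UWb z : `|U z - W z| ^+ 2 <= 3 * dist2 z + 3 * kk * sq z.1 + 3 * kk * sq z.2.
  have h1 := XK z.1; have h2 := YK z.2.
  have h3 : `|U z - W z| <= `|z.1 - z.2| + K0 * Del * (1 + `|z.1|) + K0 * Del * (1 + `|z.2|).
    rewrite (_ : U z - W z = (z.1 - z.2) + (X z.1 - z.1) - (Y z.2 - z.2)); last first.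
      rewrite /U /W; move: (X z.1) (Y z.2) => a b; apply/rowP => j; rewrite !mxE; ring.
    rewrite (le_trans (ler_normB _ _))// lerD// (le_trans (ler_normD _ _))// lerD//.
  have h4 : `|z.1 - z.2| ^+ 2 <= dist2 z by rewrite enorm_sqr sqr_norm_le_dotp.
  have n0 := normr_ge0 (U z - W z).
  apply: (@le_trans _ _ ((`|z.1 - z.2| + K0 * Del * (1 + `|z.1|) + K0 * Del * (1 + `|z.2|))
    ^+ 2)).
    by rewrite lerXn2r ?nnegrE// (le_trans n0).
  rewrite /kk; move: (`|z.1 - z.2|) h4 => a h4; move: (dist2 z) h4 => D h4.
  rewrite (_ : 3 * D + _ + _ = 3 * (D + (K0 * Del * (1 + `|z.1|)) ^+ 2 +
    (K0 * Del * (1 + `|z.2|)) ^+ 2)); last by ring.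
  move: (K0 * Del * (1 + `|z.1|)) (K0 * Del * (1 + `|z.2|)) => a1 a2.
  have := sqr_ge0 (a - a1); have := sqr_ge0 (a - a2); have := sqr_ge0 (a1 - a2).
  by rewrite !sqrrB !sqrrD; lra.
have [iUW UWi] := Rintegral_le_comb mUW2 (fun z => sqr_ge0 _) iD i1 i2 UWb.
have UWS : \int[g]_z `|U z - W z| ^+ 2 <= S ^+ 2.
  rewrite S_sqr (le_trans UWi)// b2 -/f /S2 -addrA lerD2l.
  have h1 : 3 * kk * \int[g]_z sq z.1 <= 3 * kk * B by rewrite ler_wpM2l// mulr_ge0.
  have h2 : 3 * kk * m_s <= 3 * kk * B by apply: ler_wpM2l; [rewrite mulr_ge0|case: nu_B].
  rewrite (le_trans (lerD h1 h2))//.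
  rewrite (_ : KB * Del ^+ 2 = 3 * kk * B + 3 * kk * B + 6 * Del ^+ 2); last first.
    by rewrite /KB /kk; ring.
  by rewrite lerDl mulr_ge0// sqr_ge0.
(* This holds at q itself, however small h q may be, because the moment at the start is bounded
   backwards from q. *)
have NA : N ^+ 2 <= A * h q.
  rewrite N_sqr.
  have gq' : good (tau (m q)) by rewrite tmq.
  have [_ h1] := back_moment c_ge0 F_bound F_lip1 F_lip2 nu_weak nu_neg T_gt0 h_ge1
    h_int measurable_good ae_good nu_moment s_ge0 sm mM gq'.
  rewrite tmq in h1; rewrite (le_trans h1)// ler_wpM2r// ler_wpM2l// ler_expR.
  by rewrite ler_piMr// mulr_ge0.
exact: (drift_diff c_ge0 F_bound F_lip1 F_lip2 mU mW muU nuW imu inu hmu hnu iUW UWS).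
Qed.

Lemma disp_diff i x y :
  N * `|disp F mu good (tau s) (tau t) x 0 i - disp F nu good (tau s) (tau t) y 0 i|
    <= (N * c * `|x - y| + c * (1 + `|y|) * A' * S) * Del.
Proof.
have t0 : 0 <= t by rewrite (le_trans s_ge0)// ltW.
have [a1 a2 a3 a4] := tau_facts T_gt0 h_ge1 h_int s_ge0 (ltW st) tM.
have v1 := vel_int c_ge0 F_bound F_lip1 F_lip2 mu_weak mu_neg h_ge1 h_int
  measurable_good mu_moment i x a1 a3.
have v2 := vel_int c_ge0 F_bound F_lip1 F_lip2 nu_weak nu_neg h_ge1 h_int
  measurable_good nu_moment i y a1 a3.
have iv : lam.-integrable `]tau s, tau t]
    (EFin \o (fun q => vel F mu good i (q, x) - vel F nu good i (q, y))).
  rewrite (_ : EFin \o _ = (EFin \o (fun q => vel F mu good i (q, x))) \-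
    (EFin \o (fun q => vel F nu good i (q, y))))%E//.
  exact: integrableB.
have mv : measurable_fun `]tau s, tau t]
    (fun q => vel F mu good i (q, x) - vel F nu good i (q, y)).
  by have /measurable_int/measurable_EFinP := iv.
rewrite !mxE -RintegralB//.
have N0 := ltW N_gt0.
rewrite -{1}(ger0_norm N0) -normrM -RintegralZl//.
rewrite /Del -a4 (clockB h_int a1 a2 a3) -RintegralZl//; last exact: (h_int_sub h_int).
apply: ler_norm_Rintegral => //.
- exact: measurable_funM.
- apply: integrable_scale => //; exact: (h_int_sub h_int).
- move=> q; rewrite /= in_itv/= => qst; rewrite normrM (ger0_norm N0).
  exact: vel_diff.
Qed.

(** Young's factor 4 / Del, times d coordinates, times the squared flow-map error 2 Ke^2 Del^4. *)
Let C4 : R := 8 * d%:R * Ke ^+ 2 * Del ^+ 3.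

(** In each coordinate the new difference is (x - y)_i, plus a difference of displacements of size w
    Del, plus the two flow-map errors; [young3] applies with D = Del. *)
Lemma dist2_flow (X Y : E -> E) x y :
  (forall x, `|X x - step F mu T h good s t x| <= Ke * Del ^+ 2 * (1 + `|x|)) ->
  (forall y, `|Y y - step F nu T h good s t y| <= Ke * Del ^+ 2 * (1 + `|y|)) ->
  enorm (X x - Y y) ^+ 2 <= (1 + Del + 8 * d%:R * c ^+ 2 * Del) * enorm (x - y) ^+ 2
    + C4 * (1 + `|x|) ^+ 2
    + (8 * d%:R * c ^+ 2 * A' ^+ 2 * (S2 / m_s) * Del + C4) * (1 + `|y|) ^+ 2.
Proof.
move=> XD YD; rewrite enorm_sqr {1}/dotp.
have D0 := Del_gt0; have D0' := ltW Del_gt0.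
pose w := c * `|x - y| + c * (1 + `|y|) * A' * (S / N).
pose e := Ke * Del ^+ 2 * ((1 + `|x|) + (1 + `|y|)).
have bnd i : (X x - Y y) 0 i * (X x - Y y) 0 i <=
    (1 + Del) * ((x - y) 0 i * (x - y) 0 i) + 4 / Del * ((w * Del) ^+ 2 + e ^+ 2).
  have h1 := disp_diff i x y.
  set dl := _ - _ in h1.
  have {}h1 : `|dl| <= w * Del.
    rewrite -(ler_pM2l N_gt0) (le_trans h1)//; apply: le_of_eq.
    by rewrite /w; field; rewrite gt_eqF.
  pose e1 := X x - step F mu T h good s t x; pose e2 := Y y - step F nu T h good s t y.
  have h2 : `|e1 0 i - e2 0 i| <= e.
    rewrite (le_trans (ler_normB _ _))// /e mulrDr lerD//.
      exact: le_trans (norm_coord _ _) (XD x).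
    exact: le_trans (norm_coord _ _) (YD y).
  have h3 : (X x - Y y) 0 i = (x - y) 0 i + dl + (e1 0 i - e2 0 i).
    rewrite /dl /e1 /e2 /step.
    move: (disp F mu _ _ _ x) (disp F nu _ _ _ y) (X x) (Y y) => p1 p2 p3 p4.
    by rewrite !mxE; ring.
  by rewrite h3; exact: young3.
apply: (@le_trans _ _ (\sum_(i < d) ((1 + Del) * ((x - y) 0 i * (x - y) 0 i)
    + 4 / Del * ((w * Del) ^+ 2 + e ^+ 2)))); first by apply: ler_sum => i _; exact: bnd.
rewrite big_split/= -mulr_sumr -/(dotp (x - y) (x - y)) -enorm_sqr.
rewrite sumr_const card_ord -[_ *+ d]mulr_natl.
have n2 : `|x - y| ^+ 2 <= enorm (x - y) ^+ 2 by rewrite enorm_sqr sqr_norm_le_dotp.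
have d0 : 0 <= d%:R :> R by [].
have SN : (S / N) ^+ 2 = S2 / m_s by rewrite expr_div_n S_sqr N_sqr.
have w2 : w ^+ 2 <= 2 * c ^+ 2 * enorm (x - y) ^+ 2
    + 2 * c ^+ 2 * A' ^+ 2 * (S2 / m_s) * (1 + `|y|) ^+ 2.
  apply: (@le_trans _ _ (2 * c ^+ 2 * `|x - y| ^+ 2 +
      2 * c ^+ 2 * A' ^+ 2 * (S2 / m_s) * (1 + `|y|) ^+ 2)); last first.
    by rewrite lerD2r ler_wpM2l// mulr_ge0 ?sqr_ge0.
  rewrite -SN (_ : 2 * c ^+ 2 * `|x - y| ^+ 2 + _ = 2 * ((c * `|x - y|) ^+ 2 +
    (c * (1 + `|y|) * A' * (S / N)) ^+ 2)); last by ring.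
  rewrite /w; move: (c * `|x - y|) (c * _ * _ * _) => a b.
  by have := sqr_ge0 (a - b); rewrite sqrrB sqrrD; lra.
have e2 : e ^+ 2 <= 2 * Ke ^+ 2 * Del ^+ 4 * ((1 + `|x|) ^+ 2 + (1 + `|y|) ^+ 2).
  rewrite /e exprMn (_ : 2 * Ke ^+ 2 * Del ^+ 4 * _ = (Ke * Del ^+ 2) ^+ 2 *
    (2 * ((1 + `|x|) ^+ 2 + (1 + `|y|) ^+ 2))); last by ring.
  apply: ler_wpM2l; first exact: sqr_ge0.
  move: (1 + `|x|) (1 + `|y|) => a b.
  by have := sqr_ge0 (a - b); rewrite sqrrB sqrrD; lra.
have w2' := ler_wpM2r (sqr_ge0 Del) w2; rewrite -exprMn in w2'.
have k0 : 0 <= d%:R * (4 / Del) by rewrite mulr_ge0// divr_ge0.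
have := ler_wpM2l k0 (lerD w2' e2).
move: (enorm (x - y) ^+ 2) ((1 + `|x|) ^+ 2) ((1 + `|y|) ^+ 2) (S2 / m_s) ((w * Del) ^+ 2)
    (e ^+ 2).
move=> n x2 y2 r W2 E2 hh.
rewrite [d%:R * (4 / Del * (W2 + E2))]mulrA (le_trans (lerD (lexx _) hh))//.
apply: le_of_eq; rewrite /C4; field.
by rewrite gt_eqF.
Qed.

(** The coefficient S2 / m_s of (1 + |y|)^2 is integrated against nu at the start of the step, where
    the integral of (1 + |y|)^2 is m_s: the moment cancels and leaves none in the rate. *)
Lemma cost_step : exists g' : probability (E * E)%type R,
  coupling (mu (tau t)) (nu (tau t)) g' /\
  \int[g']_z dist2 z <= (1 + rate * Del) * f
    + (8 * d%:R * c ^+ 2 * A' ^+ 2 * KB + 16 * d%:R * Ke ^+ 2 * B) * Del ^+ 3.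
Proof.
have st' := ltW st.
have [X [XL muX XD _]] := flow_mu s_ge0 st' tM.
have [Y [YL nuY YD _]] := flow_nu s_ge0 st' tM.
have mX := lip_measurable_rV XL.
have mY := lip_measurable_rV YL.
have ee : 2 * (c ^+ 2 * expR (c * (t - s)) * (t - s) ^+ 2) <= Ke * Del ^+ 2.
  rewrite /Ke -[leRHS]mulrA ler_wpM2l// ler_wpM2r ?sqr_ge0// ler_wpM2l ?sqr_ge0//.
  by rewrite ler_expR ler_piMr.
have XD' x : `|X x - step F mu T h good s t x| <= Ke * Del ^+ 2 * (1 + `|x|).
  by rewrite (le_trans (XD x))// [leLHS]mulrA ler_wpM2r// addr_ge0.
have YD' y : `|Y y - step F nu T h good s t y| <= Ke * Del ^+ 2 * (1 + `|y|).
  by rewrite (le_trans (YD y))// [leLHS]mulrA ler_wpM2r// addr_ge0.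
pose G (z : E * E) := (X z.1, Y z.2).
have mG : measurable_fun setT G.
  apply: measurable_fun_pair; first exact: (measurableT_comp mX measurable_fst).
  exact: (measurableT_comp mY measurable_snd).
have [g' [g'E _ _]] := prob_image g mG.
exists g'; split.
  move=> U mU; rewrite !g'E.
  have mXU : measurable (X @^-1` U) by rewrite -[X in measurable X]setTI; exact: mX.
  have mYU : measurable (Y @^-1` U) by rewrite -[X in measurable X]setTI; exact: mY.
  split; apply: esym; first exact: etrans (muX _ mU) (g1 mXU).
  exact: etrans (nuY _ mU) (g2 mYU).
have [i1 b1] := coupling_moment1; have [i2 b2] := coupling_moment2.
have b z : dist2 (G z) <= (1 + Del + 8 * d%:R * c ^+ 2 * Del) * dist2 z
    + C4 * sq z.1 + (8 * d%:R * c ^+ 2 * A' ^+ 2 * (S2 / m_s) * Del + C4) * sq z.2.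
  exact: dist2_flow.
have mdG : measurable_fun setT (fun z => dist2 (G z)).
  exact: (measurableT_comp measurable_dist2 mG).
have [i3 b3] := Rintegral_le_comb mdG (fun z => sqr_ge0 _) integrable_dist2 i1 i2 b.
have i3' := (image_integrable mG (fun U _ => g'E U) measurable_dist2).2 i3.
rewrite (image_Rintegral mG (fun U _ => g'E U) measurable_dist2 i3') (le_trans b3)//.
rewrite b2 -/f.
have C40 : 0 <= C4.
  by rewrite /C4 mulr_ge0 ?exprn_ge0 ?(ltW Del_gt0)// mulr_ge0 ?sqr_ge0// mulr_ge0.
have h1 := ler_wpM2l C40 b1; have [_ b4] := nu_B; have h2 := ler_wpM2l C40 b4.
have ms0 : m_s != 0 by rewrite gt_eqF// (lt_le_trans ltr01 m_s_ge1).
rewrite -/m_s in h2.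
have e1 : (8 * d%:R * c ^+ 2 * A' ^+ 2 * (S2 / m_s) * Del + C4) * m_s =
    8 * d%:R * c ^+ 2 * A' ^+ 2 * (3 * f + KB * Del ^+ 2) * Del + C4 * m_s.
  by rewrite -/S2; field.
have e2 : (1 + rate * Del) * f
    + (8 * d%:R * c ^+ 2 * A' ^+ 2 * KB + 16 * d%:R * Ke ^+ 2 * B) * Del ^+ 3 =
  (1 + Del + 8 * d%:R * c ^+ 2 * Del) * f + C4 * B +
  (8 * d%:R * c ^+ 2 * A' ^+ 2 * (3 * f + KB * Del ^+ 2) * Del + C4 * B).
  by rewrite /rate /C4; ring.
rewrite e1 e2; apply: lerD; last by rewrite lerD2l.
by rewrite lerD2l.
Qed.

End one_step.
Lemma moment_bounded2 : exists B : R, 0 <= B /\ forall s, 0 <= s -> s <= M ->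
  ((mu (tau s)).-integrable setT (EFin \o sq) /\ \int[mu (tau s)]_y sq y <= B) /\
  ((nu (tau s)).-integrable setT (EFin \o sq) /\ \int[nu (tau s)]_y sq y <= B).
Proof.
have [B1 [B11 muB]] := moment_bounded c_ge0 F_bound F_lip1 F_lip2 mu_weak mu_neg
  T_gt0 h_ge1 h_int measurable_good ae_good mu_moment.
have [B2 [B21 nuB]] := moment_bounded c_ge0 F_bound F_lip1 F_lip2 nu_weak nu_neg
  T_gt0 h_ge1 h_int measurable_good ae_good nu_moment.
exists (Num.max B1 B2); split => [|s s0 sM]; first by rewrite le_max (le_trans ler01 B11).
have [i1 b1] := muB s s0 sM; have [i2 b2] := nuB s s0 sM.
by split; split => //; rewrite le_max ?b1// b2 orbT.
Qed.

(** K depends on the moment bound B, hence on the two solutions; it is uniform over the steps, and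
    its cubic order makes it harmless. *)
Lemma cost_bound : exists K : R, 0 <= K /\
  forall s t (g : probability (E * E)%type R), 0 <= s -> s < t -> t <= M -> t - s <= 1 ->
  coupling (mu (tau s)) (nu (tau s)) g ->
  exists g' : probability (E * E)%type R, coupling (mu (tau t)) (nu (tau t)) g' /\
  \int[g']_z dist2 z <= (1 + rate * (t - s)) * \int[g]_z dist2 z + K * (t - s) ^+ 3.
Proof.
have [B [B0 munuB]] := moment_bounded2.
exists (8 * d%:R * c ^+ 2 * A' ^+ 2 * (6 * (K0 ^+ 2 * B + 1)) + 16 * d%:R * Ke ^+ 2 * B).
split => [|s t g s0 st tM st1 gc].
  apply: addr_ge0.
    apply: mulr_ge0; first by rewrite mulr_ge0 ?sqr_ge0// mulr_ge0 ?sqr_ge0// mulr_ge0.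
    by rewrite mulr_ge0// addr_ge0// mulr_ge0// sqr_ge0.
  by rewrite mulr_ge0// mulr_ge0 ?sqr_ge0// mulr_ge0.
have sM : s <= M by rewrite (le_trans _ tM)// ltW.
have [mB nB] := munuB s s0 sM.
exact: cost_step s0 st tM st1 B0 mB nB gc.
Qed.

Lemma cost_limit (g : probability (E * E)%type R) s (e : R) : 0 <= s -> s <= M -> 0 < e ->
  coupling (mu (tau 0)) (nu (tau 0)) g ->
  exists g' : probability (E * E)%type R, coupling (mu (tau s)) (nu (tau s)) g' /\
  \int[g']_z dist2 z <= expR (rate * s) * \int[g]_z dist2 z + e.
Proof.
move=> s0 sM e0 gc; set f0 := \int[g]_z _.
have f00 : 0 <= f0 by apply: Rintegral_ge0 => z _; exact: sqr_ge0.
have [s_eq0|s_neq0] := eqVneq s 0.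
  exists g; split; first by rewrite s_eq0.
  by rewrite s_eq0 mulr0 expR0 mul1r lerDl ltW.
have s_gt0 : 0 < s by rewrite lt_neqAle eq_sym s_neq0.
have [K [K00 step]] := cost_bound.
have r0 := ltW rate_gt0.
pose Q := expR (rate * s) * (K * s ^+ 3).
have Q0 : 0 <= Q by rewrite mulr_ge0 ?expR_ge0// mulr_ge0// exprn_ge0.
(* n >= s makes each step s / n at most 1, and n >= Q / e makes the accumulated error Q / n^2 at
   most e. *)
pose n := (Num.bound (s + Q / e)).+1.
have n_gt0 : 0 < n%:R :> R by [].
have n_ge1 : 1 <= n%:R :> R by rewrite ler1n.
have nsQ : s + Q / e <= n%:R.
  have := archi_boundP (addr_ge0 s0 (divr_ge0 Q0 (ltW e0))) => /ltW/le_trans; apply.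
  by rewrite ler_nat.
have Qe0 : 0 <= Q / e by rewrite divr_ge0// ltW.
pose D := s / n%:R.
have D0 : 0 < D by rewrite divr_gt0.
have D1 : D <= 1 by rewrite ler_pdivrMr// mul1r; lra.
have nn : n%:R != 0 :> R by rewrite gt_eqF.
have nD : n%:R * D = s by rewrite /D mulrC divfK.
have iter k : (k <= n)%N -> exists g' : probability (E * E)%type R,
    coupling (mu (tau (k%:R * D))) (nu (tau (k%:R * D))) g' /\
    \int[g']_z dist2 z <= expR (rate * (k%:R * D)) * (f0 + k%:R * (K * D ^+ 3)).
  elim: k => [_|k IH kn].
    by exists g; rewrite !mul0r; split => //; rewrite mulr0 expR0 mul1r addr0.
  have [g1 [g1c g1b]] := IH (ltnW kn).
  have kD : k.+1%:R * D - k%:R * D = D by rewrite -mulrBl -natrB// subSnn mul1r.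
  have h0 : 0 <= k%:R * D by rewrite mulr_ge0// ltW.
  have h1 : k%:R * D < k.+1%:R * D by rewrite -subr_gt0 kD.
  have h2 : k.+1%:R * D <= M.
    by rewrite (le_trans _ sM)// -nD ler_wpM2r ?(ltW D0)// ler_nat.
  have h3 : k.+1%:R * D - k%:R * D <= 1 by rewrite kD.
  have [g2 [g2c g2b]] := step _ _ g1 h0 h1 h2 h3 g1c.
  exists g2; split => //; rewrite kD in g2b; apply: (le_trans g2b).
  have rD0 : 0 <= rate * D by rewrite mulr_ge0// ltW.
  have -> : rate * (k.+1%:R * D) = rate * D + rate * (k%:R * D).
    by rewrite -[k.+1%:R * D](subrK (k%:R * D)) kD mulrDr.
  rewrite expRD; set X := expR (rate * (k%:R * D)) in g1b *.
  have X1 : 1 <= X by rewrite /X -[leLHS]expR0 ler_expR mulr_ge0.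
  have Y1 : 1 + rate * D <= expR (rate * D) := expR_ge1Dx _.
  set Y := expR (rate * D) in Y1 *.
  have KD0 : 0 <= K * D ^+ 3 by rewrite mulr_ge0// exprn_ge0// ltW.
  have fk0 : 0 <= f0 + k%:R * (K * D ^+ 3) by rewrite addr_ge0// mulr_ge0.
  have X0 : 0 <= X by lra.
  have Y0 : 0 <= Y by lra.
  have h4 : (1 + rate * D) * \int[g1]_z dist2 z <= Y * (X * (f0 + k%:R * (K * D ^+ 3))).
    by apply: ler_pM => //; [lra|apply: Rintegral_ge0 => z _; exact: sqr_ge0].
  have h5 : K * D ^+ 3 <= Y * X * (K * D ^+ 3).
    by rewrite ler_peMl// mulr_ege1//; lra.
  have -> : Y * X * (f0 + k.+1%:R * (K * D ^+ 3)) =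
    Y * (X * (f0 + k%:R * (K * D ^+ 3))) + Y * X * (K * D ^+ 3) by rewrite -natr1; ring.
  exact: lerD.
have [g' [gc' gb']] := iter n (leqnn n).
rewrite nD in gc' gb'; exists g'; split => //; apply: (le_trans gb').
rewrite mulrDr lerD2l.
have -> : expR (rate * s) * (n%:R * (K * D ^+ 3)) = Q / n%:R / n%:R.
  by rewrite /Q /D; move: (n%:R) nn => a a0; field.
rewrite ler_pdivrMr// ler_pdivrMr//.
have h6 : Q <= e * n%:R by rewrite mulrC -ler_pdivrMr//; lra.
by rewrite (le_trans h6)// ler_peMr// mulr_ge0// ltW.
Qed.

Lemma wass_flow t : 0 <= t -> t <= T ->
  (wass 2 (mu t) (nu t) <= (expR (rate / 2 * m t))%:E * wass 2 (mu 0%R) (nu 0%R))%E.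
Proof.
move=> t0 tT.
have mt0 : 0 <= m t by apply: Rintegral_ge0 => r _; exact: h_ge0.
have mtM : m t <= M.
  by rewrite -subr_ge0 (le_trans _ (clock_ge h_ge1 h_int t0 tT (lexx _)))// subr_ge0.
have M0 : 0 <= M by exact: le_trans mtM.
have taut : tau (m t) = t by rewrite (clockK T_gt0 h_ge1 h_int).
have tau0 : tau 0 = 0.
  by rewrite -{1}(clock0 h) (clockK T_gt0 h_ge1 h_int (lexx 0) (ltW T_gt0)).
pose I s := ereal_inf [set (\int[g]_z (enorm (z.1 - z.2) ^+ 2)%:E)%E |
  g in coupling (mu s) (nu s)].
have I0 s : (0 <= I s)%E.
  apply: le_ereal_inf_tmp => _ [g _ <-].
  by apply: integral_ge0 => z _; rewrite lee_fin sqr_ge0.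
(* Moments being bounded, every coupling has a finite cost, so the real-valued estimates can be read
   in the extended reals. *)
have costE s (g : probability (E * E)%type R) : 0 <= s -> s <= M ->
    coupling (mu (tau s)) (nu (tau s)) g ->
    (\int[g]_z (enorm (z.1 - z.2) ^+ 2)%:E = (\int[g]_z dist2 z)%:E)%E.
  move=> s0 sM gc.
  have [B [_ munuB]] := moment_bounded2; have [mB nB] := munuB s s0 sM.
  by rewrite EFin_Rintegral//; exact: integrable_dist2 mB nB gc.
set e := expR (rate * m t).
have e0 : 0 < e by exact: expR_gt0.
have It : (I t <= e%:E * I 0%R)%E.
  rewrite -lee_pdivrMl//; apply: le_ereal_inf_tmp => _ [g gc <-].
  rewrite lee_pdivrMl//; have gc0 := gc; rewrite -tau0 in gc0.
  rewrite (costE 0 g (lexx 0) M0 gc0) -EFinM.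
  apply/lee_addgt0Pr => eps eps0; rewrite -EFinD.
  have [g' [gc' gb']] := cost_limit mt0 mtM eps0 gc0.
  apply: (@le_trans _ _ (\int[g']_z dist2 z)%:E); last by rewrite lee_fin.
  rewrite -(costE (m t) g' mt0 mtM gc'); apply: ereal_inf_lbound.
  by exists g' => //; rewrite -{1 2}taut.
rewrite /wass -/(I t) -/(I 0).
(* Taking the square root of the cost halves the rate. *)
have -> : (expR (rate / 2 * m t))%:E = poweR e%:E 2^-1.
  by rewrite poweR_EFin /e -expRM; congr (expR _)%:E; ring.
rewrite -poweRM ?lee_fin ?(ltW e0)//.
apply: gt0_ler_poweR => //.
- by rewrite in_itv/= I0 leey.
- by rewrite in_itv/= leey andbT mule_ge0// lee_fin ltW.
Qed.

End two_flows.

(** * The SVGD field *)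

Section lipschitz_partials.
Context {R : realType} {d : nat}.
Local Notation E := 'rV[R]_d.

Lemma partial_increment (u : E -> R) (j : 'I_d) (L : R) :
  (forall x, derivable u x (evec j)) -> (forall x, `|'D_(evec j) u x| <= L) ->
  forall x h, `|u (x + h *: evec j) - u x| <= L * `|h|.
Proof.
move=> du uL x0 h0.
have key x h : 0 < h -> `|u (x + h *: evec j) - u x| <= L * h.
  move=> hgt0; pose g (t : R) := u (x + t *: evec j).
  have dg t : is_derive t (1 : R) g ('D_(evec j) u (x + t *: evec j)).
    have e : (fun k : R => k^-1 *: (g (k *: 1 + t) - g t)) =
        (fun k => k^-1 *: (u (k *: evec j + (x + t *: evec j)) - u (x + t *: evec j))).
      apply/funext => k; have k1 : k *: (1 : R) = k by exact: mulr1.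
      by rewrite /g k1 scalerDl addrCA.
    apply: DeriveDef.
      by rewrite /derivable e; exact: du.
    by rewrite /derive e.
  have cg : {within `[0, h], continuous g}.
    by apply: derivable_within_continuous => t _; have [] := dg t.
  have [t _] := MVT hgt0 (fun t _ => dg t) cg.
  rewrite /g scale0r addr0 subr0 => ->.
  by rewrite normrM (gtr0_norm hgt0) ler_wpM2r// ltW.
have [h0_lt|h0_gt|->] := ltgtP h0 0; last by rewrite scale0r addr0 subrr normr0 mulr0.
- have := key (x0 + h0 *: evec j) (- h0).
  by rewrite oppr_gt0 scaleNr addrK distrC (ltr0_norm h0_lt) => /(_ h0_lt).
- by rewrite (gtr0_norm h0_gt); exact: key.
Qed.

Lemma lip_of_increments (u : E -> R) (L : R) : 0 <= L ->
  (forall j x h, `|u (x + h *: evec j) - u x| <= L * `|h|) -> lip (d%:R * L) u.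
Proof.
move=> L0 uL y x.
have key (l : seq 'I_d) (h : E) :
    `|u (x + \sum_(i <- l) h 0 i *: evec i) - u x| <= (size l)%:R * L * `|h|.
  elim: l => [|i l IH]; first by rewrite big_nil addr0 subrr normr0 !mul0r.
  rewrite big_cons addrCA addrC; set z := x + _ in IH *.
  rewrite (_ : _ - _ = (u (z + h 0 i *: evec i) - u z) + (u z - u x));
    last by rewrite addrA subrK.
  rewrite (le_trans (ler_normD _ _))// (le_trans (lerD (uL _ _ _) IH))//.
  have : L * `|h 0 i| <= L * `|h| by rewrite ler_wpM2l// norm_coord.
  by rewrite /= -natr1; lra.
have := key (enum 'I_d) (y - x); rewrite size_enum_ord !big_enum/=.
rewrite (_ : \sum_i (y - x) 0 i *: evec i = y - x); first by rewrite [x + _]addrC subrK.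
by rewrite [RHS]row_sum_delta.
Qed.

Lemma norm_le_enorm (x : E) : `|x| <= enorm x.
Proof.
rewrite -(@ler_pXn2r _ 2)// ?nnegrE ?sqrtr_ge0//.
by rewrite enorm_sqr sqr_norm_le_dotp.
Qed.

Lemma enorm_le_norm (x : E) : enorm x <= d%:R * `|x|.
Proof.
rewrite -(@ler_pXn2r _ 2)// ?nnegrE ?sqrtr_ge0 ?mulr_ge0//.
rewrite enorm_sqr (le_trans (dotp_le_norm _))// exprMn ler_wpM2r ?sqr_ge0//.
by rewrite -natrX ler_nat; case: (d) => // n; rewrite -mulnn leq_pmulr.
Qed.

Lemma entry_le_opnorm (A : 'M[R]_d) i j : `|A i j| <= opnorm A.
Proof.
pose c := \sum_k \sum_l `|A k l|.
have c0 : 0 <= c by apply: sumr_ge0 => k _; exact: sumr_ge0.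
have le_c k (u : E) : enorm u <= 1 -> `|(A *m u^T) k 0| <= c.
  move=> u1; rewrite mxE (le_trans (ler_norm_sum _ _ _))//.
  apply: (@le_trans _ _ (\sum_l `|A k l|)); last first.
    rewrite /c [leRHS](bigD1 k)//= lerDl; apply: sumr_ge0 => k' _; exact: sumr_ge0.
  apply: ler_sum => l _; rewrite normrM mxE ler_piMr//.
  by rewrite (le_trans (norm_coord _ _))// (le_trans (norm_le_enorm u)).
have eAij : (A *m (evec j : E)^T)^T 0 i = A i j.
  rewrite !mxE (bigD1 j)//= big1 => [|l lj]; last by rewrite !mxE eqxx/= (negbTE lj) mulr0.
  by rewrite !mxE !eqxx mulr1 addr0.
rewrite -eAij (le_trans (norm_coord _ _))// (le_trans (norm_le_enorm _))//.
(* The supremum defining the norm dominates the value at e_j once its set is known to be bounded,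
   here by d times the sum of the absolute entries. *)
apply: ub_le_sup.
  exists (d%:R * c) => _ [u /= u1 <-]; rewrite (le_trans (enorm_le_norm _))//.
  by rewrite ler_wpM2l//; apply: norm_le_coord => // k; rewrite mxE le_c.
exists (evec j) => //=.
rewrite -(@ler_pXn2r _ 2)// ?nnegrE ?sqrtr_ge0// enorm_sqr expr1n /dotp (bigD1 j)//=.
rewrite big1 => [|l lj]; last by rewrite !mxE (negbTE lj) andbF mulr0.
by rewrite !mxE !eqxx mulr1 addr0.
Qed.

End lipschitz_partials.

(** * Growth and Lipschitz bounds on the gradient of the potential *)

Section potential.
Context {R : realType} {d : nat}.
Local Notation E := 'rV[R]_d.
Variables (V : E -> R) (L : R).
Hypothesis V_C : Ck 3 V.
Hypothesis V_G : forall x, enorm (grad V x) <= L * (1 + enorm x).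
Hypothesis V_H : forall x, opnorm (hess V x) <= L.

Lemma grad_growth i x : `|grad V x 0 i| <= `|L| * (1 + d%:R) * (1 + `|x|).
Proof.
rewrite (le_trans (norm_coord _ _))// (le_trans (norm_le_enorm _))// (le_trans (V_G x))//.
have e0 : 0 <= 1 + enorm x by rewrite addr_ge0// sqrtr_ge0.
rewrite (le_trans (ler_wpM2r e0 (ler_norm L)))// -mulrA ler_wpM2l//.
have := enorm_le_norm x; have : 0 <= d%:R :> R by []; have := normr_ge0 x; lra.
Qed.

Lemma grad_lip i : lip (`|L| * (1 + d%:R)) (fun x => grad V x 0 i).
Proof.
have -> : (fun x => grad V x 0 i) = 'D_(evec i) V by apply/funext => x; rewrite mxE.
case: V_C => _ /(_ i)[_ [_ /(_ _) V2]].
have h : lip (d%:R * `|L|) ('D_(evec i) V).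
  apply: lip_of_increments => // j; apply: partial_increment => x; first by have [] := V2 j.
  have := entry_le_opnorm (hess V x) i j; rewrite mxE => /le_trans; apply.
  by rewrite (le_trans (V_H x))// ler_norm.
move=> x y; rewrite (le_trans (h x y))// ler_wpM2r//.
by rewrite mulrC ler_wpM2l// lerDr.
Qed.

End potential.

(** * Bounds on the SVGD field *)

Section kernel_field.
Context {R : realType} {d : nat}.
Local Notation E := 'rV[R]_d.
Variables (kappa : R) (Sigma : 'M[R]_d).
Hypothesis kappa_gt1 : 1 < kappa.
Local Notation k := (ktilde kappa Sigma).

Lemma grad_ktilde i (x y : E) :
  grad (k x) y 0 i = x 0 i - dPsi kappa Sigma i (x - y).
Proof.
have [c tP] := Psi_taylor Sigma kappa_gt1.
have tk : taylor i (k x) (fun z => x 0 i - dPsi kappa Sigma i (x - z)) c.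
  move=> z h; rewrite /ktilde.
  have := tP i (x - z) (- h); rewrite sqrrN.
  have -> : x - z + - h *: evec i = x - (z + h *: evec i) by rewrite scaleNr opprD addrA.
  move=> /(le_trans _); apply.
  rewrite (_ : z + h *: evec i = h *: evec i + z); last by rewrite addrC.
  have -> : dotp x (h *: evec i + z) = h * x 0 i + dotp x z.
    rewrite dotpDr dotpZr; congr (h * _ + _).
    rewrite /dotp (bigD1 i)//= big1 => [|l li]; last by rewrite !mxE (negbTE li) andbF mulr0.
    by rewrite !mxE !eqxx mulr1 addr0.
  rewrite [h *: _ + z]addrC; apply: le_of_eq; congr (`|_|).
  by move: (Psi _ _ _) (Psi _ _ _) (dPsi _ _ _ _) (dotp _ _) => a b e f; ring.
by rewrite mxE; have [] := taylor_derive tk y.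
Qed.

Definition svgd_field (V : E -> R) (i : 'I_d) (x y : E) : R :=
  (- (k x y *: grad V y) + grad (k x) y) 0 i.

Lemma svgd_fieldE V i x y : svgd_field V i x y =
  - (k x y * grad V y 0 i) + (x 0 i - dPsi kappa Sigma i (x - y)).
Proof. by rewrite -grad_ktilde /svgd_field;
    move: (grad V y) (grad (k x) y) (k x y) => u v a; rewrite !mxE. Qed.

(** k grows like (1 + |x|)(1 + |y|) and the gradient of V like 1 + |y|, whence the quadratic growth
    in y and the linear growth in x. The constant precedes V and depends on V through G only. *)
Lemma svgd_field_bounds (G : R) : exists c : R, 0 <= c /\
  forall V : E -> R, (forall i x, `|grad V x 0 i| <= G * (1 + `|x|)) ->
  (forall i, lip G (fun x => grad V x 0 i)) ->
  [/\ forall i x y, `|svgd_field V i x y| <= c * (1 + `|x|) * (1 + `|y| ^+ 2),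
      forall i x x' y, `|svgd_field V i x y - svgd_field V i x' y|
        <= c * (1 + `|y| ^+ 2) * `|x - x'| &
      forall i x y y', `|svgd_field V i x y - svgd_field V i x y'|
        <= c * (1 + `|x|) * (1 + `|y| + `|y'|) * `|y - y'|].
Proof.
have [C0' P0'] := Psi_bounded Sigma kappa_gt1; have [C1' P1'] := Psi_lip Sigma kappa_gt1.
have [C2' P2'] := dPsi_lip Sigma kappa_gt1.
pose C0 := `|C0'|; pose C1 := `|C1'|; pose C2 := `|C2'|; pose D : R := d%:R.
have D0 : 0 <= D by [].
have [C00 C10 C20] : [/\ 0 <= C0, 0 <= C1 & 0 <= C2] by split; exact: normr_ge0.
have P0 z : `|Psi kappa Sigma z| <= C0 by rewrite (le_trans (P0' z))// ler_norm.
have P1 : lip C1 (Psi kappa Sigma : E -> R).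
  by move=> z w; rewrite (le_trans (P1' z w))// ler_wpM2r// ler_norm.
have P2 i : lip C2 (dPsi kappa Sigma i : E -> R).
  by move=> z w; rewrite (le_trans (P2' i z w))// ler_wpM2r// ler_norm.
have kb (x y : E) : `|k x y| <= (1 + C0 + D) * (1 + `|x|) * (1 + `|y|).
  have h1 := norm_dotp x y; have h2 := P0 (x - y).
  have : `|k x y| <= 1 + `|dotp x y| + `|Psi kappa Sigma (x - y)|.
    by rewrite /ktilde (le_trans (ler_normD _ _))// lerD2r (le_trans (ler_normD _ _))// normr1.
  rewrite -/D in h1; move=> /le_trans; apply.
  have x0 := normr_ge0 x; have y0 := normr_ge0 y.
  have xy := mulr_ge0 x0 y0.
  have : 0 <= (1 + C0) * (`|x| + `|y| + `|x| * `|y|) by rewrite mulr_ge0// !addr_ge0.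
  have : 0 <= D * (1 + `|x| + `|y|) by rewrite mulr_ge0// !addr_ge0.
  lra.
have k1 (x x' y : E) : `|k x y - k x' y| <= (D + C1) * (1 + `|y|) * `|x - x'|.
  have h1 := norm_dotp (x - x') y; have h2 := P1 (x - y) (x' - y).
  rewrite (_ : x - y - (x' - y) = x - x') in h2; last by rewrite opprB addrA subrK.
  have e : k x y - k x' y = dotp (x - x') y + (Psi kappa Sigma (x - y) - Psi kappa Sigma
    (x' - y)).
    have -> : dotp (x - x') y = dotp x y - dotp x' y by rewrite -scaleN1r dotpDl dotpZl mulN1r.
    rewrite /ktilde.
    by move: (Psi _ _ (x - y)) (Psi _ _ (x' - y)) (dotp x y) (dotp x' y) => a b e f; ring.
  rewrite e (le_trans (ler_normD _ _))// (le_trans (lerD h1 h2))// -/D.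
  have : 0 <= (D + C1 * `|y|) * `|x - x'| by rewrite mulr_ge0// addr_ge0// mulr_ge0.
  by clear h1 h2 e; lra.
have k2 (x y y' : E) : `|k x y - k x y'| <= (D + C1) * (1 + `|x|) * `|y - y'|.
  have h1 := norm_dotp x (y - y'); have h2 := P1 (x - y) (x - y').
  rewrite (_ : x - y - (x - y') = y' - y) in h2; last first.
    by rewrite opprB addrC addrA subrK.
  have e : k x y - k x y' = dotp x (y - y') + (Psi kappa Sigma (x - y) - Psi kappa Sigma (x
    - y')).
    have -> : dotp x (y - y') = dotp x y - dotp x y' by rewrite -scaleN1r dotpDr dotpZr mulN1r.
    by rewrite /ktilde; move: (Psi _ _ (x - y)) (Psi _ _ (x - y')) (dotp x y) (dotp x y')
        => a b g f; ring.
  rewrite [`|y' - y|]distrC in h2.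
  rewrite e (le_trans (ler_normD _ _))// (le_trans (lerD h1 h2))// -/D.
  have : 0 <= (D + C1 * `|x|) * `|y - y'| by rewrite mulr_ge0// addr_ge0// mulr_ge0.
  by clear h1 h2 e; lra.
pose c := 2 * `|G| * (1 + C0 + 2 * D + C1) + 1 + C2.
exists c; split=> [|V Vg Vl].
  by rewrite !addr_ge0// mulr_ge0 ?mulr_ge0// !addr_ge0// mulr_ge0.
have G0 : 0 <= `|G| by [].
have Vg' i x : `|grad V x 0 i| <= `|G| * (1 + `|x|).
  by rewrite (le_trans (Vg i x))// ler_wpM2r ?addr_ge0// ler_norm.
have Vl' i x y : `|grad V x 0 i - grad V y 0 i| <= `|G| * `|x - y|.
  by rewrite (le_trans (Vl i x y))// ler_wpM2r// ler_norm.
split.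
- move=> i x y; rewrite svgd_fieldE.
  have x0 := normr_ge0 x; have y0 := normr_ge0 y.
  have h1 : `|k x y * grad V y 0 i| <=
      (1 + C0 + D) * (1 + `|x|) * (1 + `|y|) * (`|G| * (1 + `|y|)).
    by rewrite normrM ler_pM.
  have h2 : `|x 0 i| <= `|x| by exact: norm_coord.
  have h3 : `|dPsi kappa Sigma i (x - y)| <= C2 * (`|x| + `|y|).
    have := P2 i (x - y) 0; rewrite dPsi0 !subr0 => /le_trans; apply.
    by rewrite ler_wpM2l// ler_normB.
  rewrite (le_trans (ler_normD _ _))// normrN.
  rewrite (le_trans (lerD h1 (le_trans (ler_normB _ _) (lerD h2 h3))))//.
  have y2 : (1 + `|y|) * (1 + `|y|) <= 2 * (1 + `|y| ^+ 2).
    by have := sqr_ge0 (1 - `|y|); rewrite sqrrB expr2; lra.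
  have q0 : 0 <= (1 + C0 + D) * (1 + `|x|) * `|G| by rewrite mulr_ge0// mulr_ge0 ?addr_ge0.
  have h4 := ler_wpM2l q0 y2.
  have h5 : `|x| + C2 * (`|x| + `|y|) <= (1 + C2) * (1 + `|x|) * (1 + `|y| ^+ 2).
    have h6 : `|y| <= 1 + `|y| ^+ 2 by have := sqr_ge0 (1 - `|y|); rewrite sqrrB expr2; lra.
    have h7 : `|x| <= (1 + `|x|) * (1 + `|y| ^+ 2).
      by have := mulr_ge0 x0 (sqr_ge0 `|y|); have := sqr_ge0 `|y|; lra.
    have h8 : `|x| + `|y| <= (1 + `|x|) * (1 + `|y| ^+ 2).
      by have := mulr_ge0 x0 (sqr_ge0 `|y|); lra.
    by have := ler_wpM2l C20 h8; lra.
  have h9 : 0 <= 2 * `|G| * (D + C1) * (1 + `|x|) * (1 + `|y| ^+ 2).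
    by do 2 (apply: mulr_ge0; last by rewrite addr_ge0 ?sqr_ge0);
        rewrite mulr_ge0 ?mulr_ge0 ?addr_ge0.
  have -> : c * (1 + `|x|) * (1 + `|y| ^+ 2) =
    (1 + C0 + D) * (1 + `|x|) * `|G| * (2 * (1 + `|y| ^+ 2)) +
    2 * `|G| * (D + C1) * (1 + `|x|) * (1 + `|y| ^+ 2) +
    (1 + C2) * (1 + `|x|) * (1 + `|y| ^+ 2) by rewrite /c; ring.
  by move: h4 h5 h9; lra.
- move=> i x x' y; rewrite !svgd_fieldE.
  rewrite (_ : _ - _ = - ((k x y - k x' y) * grad V y 0 i) + ((x - x') 0 i -
    (dPsi kappa Sigma i (x - y) - dPsi kappa Sigma i (x' - y)))); last first.
    have -> : (x - x') 0 i = x 0 i - x' 0 i by rewrite !mxE.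
    move: (k x y) (k x' y) (grad V y 0 i) (x 0 i) (x' 0 i) (dPsi _ _ i (x - y)) (dPsi _ _ i
        (x' - y)).
    by move=> a1 a2 a3 a4 a5 a6 a7; ring.
  have y0 := normr_ge0 y; have n0 := normr_ge0 (x - x').
  have h1 : `|(k x y - k x' y) * grad V y 0 i| <=
      (D + C1) * (1 + `|y|) * `|x - x'| * (`|G| * (1 + `|y|)).
    by rewrite normrM ler_pM.
  have h2 : `|(x - x') 0 i| <= `|x - x'| by exact: norm_coord.
  have h3 := P2 i (x - y) (x' - y).
  rewrite (_ : x - y - (x' - y) = x - x') in h3; last by rewrite opprB addrA subrK.
  rewrite (le_trans (ler_normD _ _))// normrN.
  rewrite (le_trans (lerD h1 (le_trans (ler_normB _ _) (lerD h2 h3))))//.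
  have y2 : (1 + `|y|) * (1 + `|y|) <= 2 * (1 + `|y| ^+ 2).
    by have := sqr_ge0 (1 - `|y|); rewrite sqrrB expr2; lra.
  have q0 : 0 <= (D + C1) * `|G| * `|x - x'| by rewrite mulr_ge0// mulr_ge0 ?addr_ge0.
  have h4 := ler_wpM2l q0 y2.
  have h5 : 0 <= (1 + C2) * `|y| ^+ 2 * `|x - x'| by rewrite mulr_ge0// mulr_ge0 ?addr_ge0
    ?sqr_ge0.
  have h9 : 0 <= 2 * `|G| * (1 + C0 + D) * (1 + `|y| ^+ 2) * `|x - x'|.
    rewrite mulr_ge0//; apply: mulr_ge0; last by rewrite addr_ge0 ?sqr_ge0.
    by rewrite mulr_ge0 ?mulr_ge0 ?addr_ge0.
  have -> : c * (1 + `|y| ^+ 2) * `|x - x'| =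
    (D + C1) * `|G| * `|x - x'| * (2 * (1 + `|y| ^+ 2)) +
    2 * `|G| * (1 + C0 + D) * (1 + `|y| ^+ 2) * `|x - x'| +
    (1 + C2) * (1 + `|y| ^+ 2) * `|x - x'| by rewrite /c; ring.
  by move: h4 h5 h9; lra.
- move=> i x y y'; rewrite !svgd_fieldE.
  rewrite (_ : _ - _ = - ((k x y - k x y') * grad V y 0 i + k x y' * (grad V y 0 i - grad V
    y' 0 i)) -
    (dPsi kappa Sigma i (x - y) - dPsi kappa Sigma i (x - y'))); last first.
    move: (k x y) (k x y') (grad V y 0 i) (grad V y' 0 i) (x 0 i) (dPsi _ _ i (x - y))
        (dPsi _ _ i (x - y')).
    by move=> a1 a2 a3 a4 a5 a6 a7; ring.
  have x0 := normr_ge0 x; have y0 := normr_ge0 y; have n0 := normr_ge0 (y - y').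
  have y'0 := normr_ge0 y'.
  have h1 : `|(k x y - k x y') * grad V y 0 i| <=
      (D + C1) * (1 + `|x|) * `|y - y'| * (`|G| * (1 + `|y|)).
    by rewrite normrM ler_pM.
  have h2 : `|k x y' * (grad V y 0 i - grad V y' 0 i)| <=
      (1 + C0 + D) * (1 + `|x|) * (1 + `|y'|) * (`|G| * `|y - y'|).
    by rewrite normrM ler_pM.
  have h3 := P2 i (x - y) (x - y').
  rewrite (_ : x - y - (x - y') = - (y - y')) in h3; last first.
    by rewrite opprB [RHS]opprB addrC addrA subrK.
  rewrite normrN in h3.
  rewrite (le_trans (ler_normB _ _))// normrN.
  rewrite (le_trans (lerD (le_trans (ler_normD _ _) (lerD h1 h2)) h3))//.
  pose W := (1 + `|x|) * `|y - y'|.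
  have W0 : 0 <= W by rewrite mulr_ge0// addr_ge0.
  have e1 : 0 <= (D + C1) * `|G| * W * (1 + `|y| + 2 * `|y'|).
    by rewrite mulr_ge0 ?mulr_ge0 ?addr_ge0// mulr_ge0.
  have e2 : 0 <= (1 + C0 + D) * `|G| * W * (1 + 2 * `|y| + `|y'|).
    by rewrite mulr_ge0 ?mulr_ge0 ?addr_ge0// mulr_ge0.
  have e3 : 0 <= C2 * (`|x| + (1 + `|x|) * (`|y| + `|y'|)) * `|y - y'|.
    by rewrite mulr_ge0// mulr_ge0// addr_ge0// mulr_ge0 ?addr_ge0.
  have e4 : 0 <= W * (1 + `|y| + `|y'|) by rewrite mulr_ge0// !addr_ge0.
  have -> : c * (1 + `|x|) * (1 + `|y| + `|y'|) * `|y - y'| =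
    (D + C1) * (1 + `|x|) * `|y - y'| * (`|G| * (1 + `|y|)) +
    (1 + C0 + D) * (1 + `|x|) * (1 + `|y'|) * (`|G| * `|y - y'|) +
    C2 * `|y - y'| + (D + C1) * `|G| * W * (1 + `|y| + 2 * `|y'|) +
    (1 + C0 + D) * `|G| * W * (1 + 2 * `|y| + `|y'|) +
    C2 * (`|x| + (1 + `|x|) * (`|y| + `|y'|)) * `|y - y'| +
    W * (1 + `|y| + `|y'|) by rewrite /c /W; ring.
  by move: e1 e2 e3 e4; lra.
Qed.

End kernel_field.

(** * From integrated moments to the Wasserstein bound *)

Section stability.
Context {R : realType} {d : nat}.
Local Notation E := 'rV[R]_d.
Local Notation lam := (@lebesgue_measure R).
Variables (F : 'I_d -> E -> E -> R) (c : R).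
Hypothesis c_ge0 : 0 <= c.
Hypothesis F_bound : forall i x y,
  `|F i x y| <= c * (1 + `|x|) * (1 + `|y| ^+ 2).
Hypothesis F_lip1 : forall i x x' y,
  `|F i x y - F i x' y| <= c * (1 + `|y| ^+ 2) * `|x - x'|.
Hypothesis F_lip2 : forall i x y y',
  `|F i x y - F i x y'| <= c * (1 + `|x|) * (1 + `|y| + `|y'|) * `|y - y'|.

Lemma weak_eq_max (mu : R -> probability E R) :
  weak_eq F mu -> weak_eq F (fun t => mu (Num.max 0 t)).
Proof.
move=> muw phi cphi t t0 flux; have [i1 e1] := muw phi cphi t t0.
have fE s : `[0, t]%classic s ->
    \int[mu s]_x dotp (grad phi x) (drift F (mu s) x) = flux s.
  by rewrite /= in_itv/= => /andP[s0 _]; rewrite /flux max_r.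
split.
  have e : {in `[0, t]%classic, EFin \o (fun s => \int[mu s]_x dotp (grad phi x)
      (drift F (mu s) x)) =1 EFin \o flux} by move=> s; rewrite inE => /fE /= ->.
  exact: (@eq_integrable _ _ R lam _ (measurable_itv _) _ _ e i1).
rewrite (max_r t0) maxxx e1; congr (_ + _).
by apply: eq_Rintegral => s; rewrite inE => /fE.
Qed.

Lemma m2_ge0 (rho : probability E R) : (0 <= m2 rho)%E.
Proof. by apply: integral_ge0 => x _; rewrite lee_fin sqr_ge0. Qed.

(** The integrability of 1 + m2(mu) + m2(nu) over [0, T] makes it finite at almost every time; these
    are the good times, and its real part gives the clock density. Its total clock is at most K. *)
Lemma weak_eq_wass (mu nu : R -> probability E R) (T K : R) : 0 < T ->
  weak_eq F mu -> weak_eq F nu ->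
  (\int[lam]_(t in `[0%R, T]) (1 + m2 (mu t) + m2 (nu t)) <= K%:E)%E ->
  forall t, 0 <= t -> t <= T ->
  (wass 2 (mu t) (nu t) <= (expR (@rate R d c / 2 * K))%:E * wass 2 (mu 0%R) (nu 0%R))%E.
Proof.
move=> T0 /weak_eq_max + /weak_eq_max.
pose mu' t := mu (Num.max 0 t); pose nu' t := nu (Num.max 0 t).
rewrite -/mu' -/nu' => muw nuw gK t t0 tT.
have mu_neg s : s <= 0 -> mu' s = mu' 0 by move=> s0; rewrite /mu' maxxx max_l.
have nu_neg s : s <= 0 -> nu' s = nu' 0 by move=> s0; rewrite /nu' maxxx max_l.
have mm := measurable_m2 (measurable_weak muw mu_neg).
have mn := measurable_m2 (measurable_weak nuw nu_neg).
pose g s : \bar R := (1 + m2 (mu' s) + m2 (nu' s))%E.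
have mg : measurable_fun setT g by apply: emeasurable_funD => //; exact: emeasurable_funD.
have g1 s : (1 <= g s)%E by rewrite /g -addeA leeDl// adde_ge0// m2_ge0.
have g0 s : (0 <= g s)%E by rewrite (le_trans _ (g1 s))// lee_fin.
have gK' : (\int[lam]_(s in `[0%R, T]) g s <= K%:E)%E.
  rewrite (le_trans _ gK)//; apply: le_of_eq.
  apply: eq_integral => s; rewrite inE/= in_itv/= => /andP[s0 _].
  by rewrite /g /mu' /nu' max_r.
have ig : lam.-integrable `[0, T] g.
  apply/integrableP; split; first exact: measurable_funTS.
  rewrite (_ : (fun s => `|g s|)%E = g); last by apply/funext => s; rewrite gee0_abs.
  by rewrite (le_lt_trans gK')// ltry.
pose good := [set s | (g s < +oo)%E].
(* [fine] sends an infinite value to 0, so the maximum with 1 keeps h >= 1 at every time, including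
   those where a moment is infinite. *)
pose h s := Num.max 1 (fine (g s)).
have mgood : measurable good.
  by rewrite -[good]setTI; exact: emeasurable_fun_infty_o.
have gfin s : good s -> (fine (g s))%:E = g s.
  by move=> gs; rewrite fineK// ge0_fin_numE.
have hg s : ((h s)%:E <= g s)%E.
  have [gs|] := boolP (g s < +oo)%E; last by rewrite -leNgt leye_eq => /eqP ->; rewrite leey.
  rewrite -(gfin s gs) lee_fin /h ge_max lexx andbT.
  by rewrite -lee_fin gfin.
have h1 s : 1 <= h s by rewrite /h le_max lexx.
have mh : measurable_fun setT h.
  apply: measurable_maxr => //; exact: measurableT_comp.
have ih : lam.-integrable `[0, T] (EFin \o h).
  apply: (le_integrable _ _ _ ig) => //.
    by apply/measurable_EFinP; exact: measurable_funTS.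
  move=> s _; rewrite gee0_abs; last by rewrite lee_fin (le_trans ler01).
  by rewrite gee0_abs//; exact: hg.
have agood : {ae lam, forall s, `[0, T]%classic s -> good s}.
  have := @integrable_ae _ _ R lam `[0, T]%classic (measurable_itv _) g ig.
  apply: filterS => s gs /gs; rewrite /good/= ge0_fin_numE//.
have mom (P : R -> probability E R) s : (1 + m2 (P s) <= g s)%E -> good s ->
    (P s).-integrable [set: E] (EFin \o (fun y => 1 + `|y| ^+ 2)) /\
    \int[P s]_y (1 + `|y| ^+ 2) <= h s.
  move=> Pg gs; apply: integrable_m2; rewrite (le_trans Pg)// -(gfin s gs) lee_fin.
  by rewrite /h le_max lexx orbT.
have mu_mom s : good s ->
    (mu' s).-integrable [set: E] (EFin \o (fun y => 1 + `|y| ^+ 2)) /\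
    \int[mu' s]_y (1 + `|y| ^+ 2) <= h s.
  by apply: mom; rewrite /g leeDl// m2_ge0.
have nu_mom s : good s ->
    (nu' s).-integrable [set: E] (EFin \o (fun y => 1 + `|y| ^+ 2)) /\
    \int[nu' s]_y (1 + `|y| ^+ 2) <= h s.
  by apply: mom; rewrite /g addeAC leeDl// m2_ge0.
have := wass_flow c_ge0 F_bound F_lip1 F_lip2 muw nuw mu_neg nu_neg T0 h1 ih mgood agood
  mu_mom nu_mom t0 tT.
rewrite {1 2}/mu' {1 2}/nu' max_r// maxxx => /le_trans; apply.
apply: lee_wpmul2r; first exact: poweR_ge0.
rewrite lee_fin ler_expR ler_wpM2l//; first by rewrite divr_ge0// ltW// rate_gt0.
have tTc : clock h t <= clock h T.
  by rewrite -subr_ge0 (le_trans _ (clock_ge h1 ih t0 tT (lexx _)))// subr_ge0.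
rewrite (le_trans tTc)// -lee_fin /clock EFin_Rintegral// (le_trans _ gK')//.
apply: ge0_le_integral => //.
- by move=> s _; rewrite lee_fin (le_trans ler01).
- by apply/measurable_EFinP; exact: measurable_funTS.
- exact: measurable_funTS.
Qed.

End stability.

Theorem lemma4p4 (R : realType) (d : nat) (d_gt0 : (0 < d)%N)
    (kappa : R) (kappa_gt : 3 / 2 < kappa)
    (Sigma : 'M[R]_d) (Sigma_spd : spd Sigma)
    (H : rkhs (ktilde kappa Sigma))
    (L a beta0 beta1 C_KGM : R)
    (a_gt0 : 0 < a) (beta0_ge0 : 0 <= beta0) (beta1_ge0 : 0 <= beta1)
    (alpha_init beta_init c_init C_init : R)
    (alpha_init_gt0 : 0 < alpha_init) (beta_init_gt0 : 0 < beta_init)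
    (c_init_gt0 : 0 < c_init) (C_init_gt0 : 0 < C_init) :
  exists2 C : R, 0 < C &
  forall (V : 'rV[R]_d -> R) (pi : probability 'rV[R]_d R)
    (P0 : forall N, probability (N.-tuple 'rV[R]_d) R)
    (mustar : probability 'rV[R]_d R),
  gibbs V pi ->
  potential_assumption V L a beta0 beta1 ->
  kgm_comparison V H pi C_KGM (kgm_exponent d kappa) ->
  initial_assumption pi P0 mustar alpha_init beta_init c_init C_init ->
  forall (mu nu : R -> probability 'rV[R]_d R),
  weak_solution V (ktilde kappa Sigma) mu ->
  weak_solution V (ktilde kappa Sigma) nu ->
  forall M : R -> R,
  (forall T : R, 0 < T ->
     (\int[lebesgue_measure]_(t in `[0%R, T]) (1 + m2 (mu t) + m2 (nu t))
        <= (M T)%:E)%E) ->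
  forall T : R, 0 < T ->
  (ereal_sup [set wass 2 (mu t) (nu t) | t in [set t : R | 0 <= t <= T]%R]
     <= (expR (C * M T))%:E * wass 2 (mu 0%R) (nu 0%R))%E.
Proof.
have kappa_gt1 : 1 < kappa by lra.
(* The bounds on the gradient of V follow from L and d alone, so c, and with it the final constant,
   is fixed before V and the solutions. *)
have [c [c0 cP]] := svgd_field_bounds Sigma kappa_gt1 (`|L| * (1 + d%:R)).
exists (@rate R d c / 2); first by rewrite divr_gt0// rate_gt0.
move=> V pi P0 mustar _ [_ V3 VG VH _ _] _ _ mu nu muw nuw M MT T T0.
have [F1 F2 F3] := cP V (grad_growth VG) (grad_lip V3 VH).
apply: ge_ereal_sup => _ [t /andP[t0 tT] <-].
exact: (weak_eq_wass c0 F1 F2 F3 T0 muw nuw (MT T T0)).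
Qed.
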